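(* Let $\mathscr V$ be a variety of algebras such that $\mathbf{Con}(\mathscr V)$ satisfies a nontrivial lattice identity. If $\mathbf{Con}(\mathscr V)$ has a finite basis for its equations, then $\mathbf{Con}(\mathscr V)$ is semidistributive.
   Context: For a variety $\mathscr V$ of algebras (of any fixed signature), $\mathbf{Con}(\mathscr V)=\{\mathbf{Con}(\mathbf A):\mathbf A\in\mathscr V\}$ is the class of congruence lattices of the members of $\mathscr V$. An identity in the language of lattices (operations $\wedge,\vee$) is nontrivial if it does not hold in all lattices; a class of lattices satisfies an identity if every member does. A class of lattices has a finite basis for its equations if there is a finite set $\Sigma$ of lattice identities true in all its members such that every lattice identity true in all its members is a consequence of $\Sigma$ (equivalently, the variety of lattices it generates is finitely axiomatizable by equations). A lattice is meet semidistributive if it satisfies $x\wedge y=x\wedge z\ \rightarrow\ x\wedge y=x\wedge(y\vee z)$ for all $x,y,z$; join semidistributive if it satisfies the dual implication $x\vee y=x\vee z\ \rightarrow\ x\vee y=x\vee(y\wedge z)$; and semidistributive if it satisfies both. A class of lattices is semidistributive if all its members are. *)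

(* Defs.v *)
From HB Require Import structures.
From mathcomp Require Import all_boot all_order.
From mathcomp Require Import boolp classical_sets cardinality.

Set Implicit Arguments.
Unset Strict Implicit.
Unset Printing Implicit Defensive.

Import Order.TTheory.
Local Open Scope order_scope.

(** * Algebras and varieties *)

(* Finitary signatures; the set of operation symbols may be infinite. *)
Record signature := Signature {
  symbol :> Type;
  arity : symbol -> nat
}.

Record algebra (S : signature) := Algebra {
  carrier :> Type;
  op : forall f : S, ('I_(arity f) -> carrier) -> carrier;
  carrier_nonempty : inhabited carrier
}.
Arguments op {S} a f _.

Inductive term (S : signature) : Type :=
| Var of nat
| App (f : S) of ('I_(arity f) -> term S).
Arguments Var {S} _.
Arguments App {S} f _.

Fixpoint term_eval (S : signature) (A : algebra S) (v : nat -> A)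
    (t : term S) : A :=
  match t with
  | Var n => v n
  | App f ts => op A f (fun i => term_eval v (ts i))
  end.

Definition equation (S : signature) : Type := (term S * term S)%type.

Definition algebra_satisfies (S : signature) (A : algebra S)
    (e : equation S) : Prop :=
  forall v : nat -> A, term_eval v e.1 = term_eval v e.2.

(* Classes of algebras and of lattices are plain [Prop]-valued functions
   rather than [set]s: [set] on such large types would put the universe of
   carriers strictly below that of [choiceType]. *)
Definition variety (S : signature) (V : algebra S -> Prop) : Prop :=
  exists E : set (equation S),
    forall A, V A <-> (forall e, E e -> algebra_satisfies A e).

(** * Congruence lattices *)

Record congruence (S : signature) (A : algebra S) := Congruence {
  con_rel :> A -> A -> Prop;
  con_refl : forall x, con_rel x x;
  con_sym : forall x y, con_rel x y -> con_rel y x;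
  con_trans : forall x y z, con_rel x y -> con_rel y z -> con_rel x z;
  con_op : forall (f : S) (u w : 'I_(arity f) -> A),
    (forall i, con_rel (u i) (w i)) -> con_rel (op A f u) (op A f w)
}.

Fact con_display : Order.disp_t. Proof. exact: Order.Disp tt tt. Qed.

Section CongruenceLattice.
Variables (S : signature) (A : algebra S).
Implicit Types th ph ps : congruence A.

Lemma congruence_eq th ph :
  (forall x y, con_rel th x y <-> con_rel ph x y) -> th = ph.
Proof.
case: th => r r1 r2 r3 r4; case: ph => s s1 s2 s3 s4 /= rs.
have E : r = s by apply/funext => x; apply/funext => y; apply/propext.
rewrite {}E {r rs} in r1 r2 r3 r4 *.
by congr Congruence; apply: Prop_irrelevance.
Qed.

HB.instance Definition _ := gen_eqMixin (congruence A).
HB.instance Definition _ := gen_choiceMixin (congruence A).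

Definition con_le th ph : bool := `[< forall x y, th x y -> ph x y >].

Lemma con_le_refl : reflexive con_le.
Proof. by move=> th; apply/asboolP. Qed.

Lemma con_le_anti : antisymmetric con_le.
Proof.
move=> th ph /andP[/asboolP le1 /asboolP le2]; apply: congruence_eq => x y.
by split; [apply: le1 | apply: le2].
Qed.

Lemma con_le_trans : transitive con_le.
Proof.
move=> ph th ps /asboolP le1 /asboolP le2; apply/asboolP => x y.
by move=> /le1 /le2.
Qed.

HB.instance Definition _ := Order.Le_isPOrder.Build con_display (congruence A)
  con_le_refl con_le_anti con_le_trans.

Definition con_meet th ph : congruence A.
Proof.
exists (fun x y => th x y /\ ph x y).
- by move=> x; split; apply: con_refl.
- by move=> x y [? ?]; split; apply: con_sym.
- by move=> x y z [? ?] [? ?]; split; apply: (@con_trans _ _ _ _ y).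
- by move=> f u w uw; split; apply: con_op => i; case: (uw i).
Defined.

(* The congruence generated by the union of [th] and [ph]. *)
Definition con_join th ph : congruence A.
Proof.
exists (fun x y => forall ps, (forall a b, th a b -> ps a b) ->
  (forall a b, ph a b -> ps a b) -> ps x y).
- by move=> x ps _ _; apply: con_refl.
- by move=> x y xy ps le1 le2; apply/con_sym/xy.
- move=> x y z xy yz ps le1 le2.
  by apply: (@con_trans _ _ _ _ y); [apply: xy | apply: yz].
- by move=> f u w uw ps le1 le2; apply: con_op => i; apply: uw.
Defined.

Lemma con_meetP th ph ps :
  (th <= con_meet ph ps) = (th <= ph) && (th <= ps).
Proof.
apply/idP/andP => [/asboolP le|[/asboolP le1 /asboolP le2]].
  by split; apply/asboolP => x y /le[].
by apply/asboolP => x y xy; split; [apply: le1 | apply: le2].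
Qed.

Lemma con_joinP th ph ps :
  (con_join th ph <= ps) = (th <= ps) && (ph <= ps).
Proof.
apply/idP/andP => [/asboolP le|[/asboolP le1 /asboolP le2]].
  split; apply/asboolP => x y xy; apply: le => qs h1 h2.
    exact: h1.
  exact: h2.
by apply/asboolP => x y; apply.
Qed.

HB.instance Definition _ := Order.POrder_MeetJoin_isLattice.Build
  con_display (congruence A) con_meetP con_joinP.

End CongruenceLattice.

(** * Lattice identities *)

Inductive lattice_term : Type :=
| LVar of nat
| LMeet of lattice_term & lattice_term
| LJoin of lattice_term & lattice_term.

Fixpoint lattice_eval (d : Order.disp_t) (L : latticeType d) (v : nat -> L)
    (t : lattice_term) : L :=
  match t with
  | LVar n => v n
  | LMeet s t => lattice_eval v s `&` lattice_eval v t
  | LJoin s t => lattice_eval v s `|` lattice_eval v t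
  end.

Definition lattice_identity : Type := (lattice_term * lattice_term)%type.

Definition lattice_satisfies (d : Order.disp_t) (L : latticeType d)
    (e : lattice_identity) : Prop :=
  forall v : nat -> L, lattice_eval v e.1 = lattice_eval v e.2.

Definition nontrivial_identity (e : lattice_identity) : Prop :=
  ~ (forall (d : Order.disp_t) (L : latticeType d), lattice_satisfies L e).

Definition consequence (Sigma : set lattice_identity)
    (e : lattice_identity) : Prop :=
  forall (d : Order.disp_t) (L : latticeType d),
    (forall s, Sigma s -> lattice_satisfies L s) -> lattice_satisfies L e.

Definition lattice_class := forall d : Order.disp_t, latticeType d -> Prop.

Definition class_satisfies (K : lattice_class) (e : lattice_identity) : Prop :=
  forall (d : Order.disp_t) (L : latticeType d), K d L -> lattice_satisfies L e.

Definition finitely_based (K : lattice_class) : Prop :=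
  exists Sigma : set lattice_identity,
    [/\ finite_set Sigma,
        forall e, Sigma e -> class_satisfies K e
      & forall e, class_satisfies K e -> consequence Sigma e].

(** * Semidistributivity *)

Definition meet_semidistributive (d : Order.disp_t) (L : latticeType d) : Prop :=
  forall x y z : L, x `&` y = x `&` z -> x `&` y = x `&` (y `|` z).

Definition join_semidistributive (d : Order.disp_t) (L : latticeType d) : Prop :=
  forall x y z : L, x `|` y = x `|` z -> x `|` y = x `|` (y `&` z).

Definition semidistributive (d : Order.disp_t) (L : latticeType d) : Prop :=
  meet_semidistributive L /\ join_semidistributive L.

Definition class_semidistributive (K : lattice_class) : Prop :=
  forall (d : Order.disp_t) (L : latticeType d), K d L -> semidistributive L.

(* The class { Con(A) : A in V }. *)
Inductive Con (S : signature) (V : algebra S -> Prop) : lattice_class :=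
| Con_intro (A : algebra S) of V A : Con V (congruence A : latticeType con_display).

(* Main.v *)
Require Import Defs.
From HB Require Import structures.
From mathcomp Require Import all_boot all_order ssralg.
From mathcomp Require Import boolp.

(** A lattice identity failing in some lattice already fails on a finite meet
    semilattice, so an identity of Con(V) makes the idempotent terms of V satisfy
    an induction principle.  If Con(V) is not semidistributive, some algebra has
    an idempotent-closed set on which polynomials satisfy a weak term condition,
    property (P); the induction principle upgrades (P) to a Mal'cev term and hence
    to a nontrivial abelian group on which the idempotent terms act additively.
    By the same argument, applied to sequences up to eventual congruence, Con(V)
    satisfies for every n an identity [cycle_lhs <= cycle_rhs] around a cycle of
    length n.  On the other hand, gluing lattices of submodules around such a
    cycle with a unipotent twist produces a lattice in which this identity fails
    although every sublattice with few generators embeds into a lattice of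
    submodules; so no finite set of identities of Con(V) implies all of them. *)

Set Implicit Arguments.
Unset Strict Implicit.
Unset Printing Implicit Defensive.

Import Order.TTheory GRing.Theory.

(** * Joins of equivalence relations *)

(** The induction principle is the absence of a semilattice in usable form. A predicate that passes
    to subsets and disjoint unions of sets of variables says which sets are irrelevant to a term; if
    the second projection were relevant, every idempotent term could act as the meet of its relevant
    variables. The obstacle between (P) and a Mal'cev term is that (P) controls only polynomials
    constant along two whole axes, while exact computations with terms need the term condition. The
    way out is to pass to smaller sets, whose elements cannot be told from a base point by
    polynomials constant on the diagonal. The induction principle forbids infinite descent, so the
    term condition may be assumed on the smaller sets. Sequences replace a compactness argument: a
    counterexample at every depth [K] of the identity gives one limit object. The twist must commute
    with all idempotent terms and be nontrivial over any nonzero group, also where negation is the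
    identity; hence a shear of [D * D]. Few elements cannot see it because each one excludes at most
    two places at which the cycle can be cut open. *)

Definition equivalence_rel_prop (T : Type) (R : T -> T -> Prop) : Prop :=
  [/\ forall x, R x x, forall x y, R x y -> R y x
    & forall x y z, R x y -> R y z -> R x z].

(** Chains run forward only. For equivalence relations this is already the join, and it also allows
    the non-symmetric relations obtained by confining the end of each step to a set. *)
Inductive jn (T : Type) (R Q : T -> T -> Prop) : T -> T -> Prop :=
| jn_refl a : jn R Q a a
| jn_stepl a b c : R a b -> jn R Q b c -> jn R Q a c
| jn_stepr a b c : Q a b -> jn R Q b c -> jn R Q a c.

Lemma jn_trans T (R Q : T -> T -> Prop) a b c :
  jn R Q a b -> jn R Q b c -> jn R Q a c.
Proof.
elim=> // {}a b' c' ab' _ IH /IH; first exact: jn_stepl.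
exact: jn_stepr.
Qed.

Lemma jn_l T (R Q : T -> T -> Prop) a b : R a b -> jn R Q a b.
Proof. by move=> ab; apply: jn_stepl ab (jn_refl _ _ _). Qed.

Lemma jn_r T (R Q : T -> T -> Prop) a b : Q a b -> jn R Q a b.
Proof. by move=> ab; apply: jn_stepr ab (jn_refl _ _ _). Qed.

Lemma jn_equiv T (R Q : T -> T -> Prop) :
  equivalence_rel_prop R -> equivalence_rel_prop Q ->
  equivalence_rel_prop (jn R Q).
Proof.
move=> [Rr Rs Rt] [Qr Qs Qt]; split; first exact: jn_refl.
  move=> x y; elim=> [a|a b c ab _ h|a b c ab _ h]; first exact: jn_refl.
    by apply: jn_trans h _; apply/jn_l/Rs.
  by apply: jn_trans h _; apply/jn_r/Qs.
by move=> x y z; apply: jn_trans.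
Qed.

Lemma jn_map T U (R Q : T -> T -> Prop) (R' Q' : U -> U -> Prop) (P : T -> Prop)
    (f : T -> U) :
  (forall a b, P a -> R a b -> P b /\ R' (f a) (f b)) ->
  (forall a b, P a -> Q a b -> P b /\ Q' (f a) (f b)) ->
  forall a b, P a -> jn R Q a b -> P b /\ jn R' Q' (f a) (f b).
Proof.
move=> hR hQ a b Pa ab; elim: ab Pa => {a b} [a|a b c ab _ IH|a b c ab _ IH] Pa.
- by split=> //; apply: jn_refl.
- by case: (hR _ _ Pa ab) => /IH [Pc bc] h; split=> //; apply: jn_stepl h bc.
- by case: (hQ _ _ Pa ab) => /IH [Pc bc] h; split=> //; apply: jn_stepr h bc.
Qed.

Lemma jn_sub T (R Q R' Q' : T -> T -> Prop) a b :
  (forall x y, R x y -> R' x y) -> (forall x y, Q x y -> Q' x y) ->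
  jn R Q a b -> jn R' Q' a b.
Proof.
move=> RR QQ ab.
by case: (@jn_map _ _ R Q R' Q' (fun=> True) id _ _ a b I ab) => // x y _ => [/RR|/QQ].
Qed.

Fixpoint walk (T : Type) (R Q : T -> T -> Prop) (l : nat) (a b : T) : Prop :=
  if l is l'.+1 then exists c d, [/\ R a c, Q c d & walk R Q l' d b] else a = b.

Lemma jn_walk T (R Q : T -> T -> Prop) a b :
  (forall x, R x x) -> (forall x, Q x x) -> jn R Q a b -> exists l, walk R Q l a b.
Proof.
move=> Rr Qr; elim=> {a b} [a|a b c ab _ [l bc]|a b c ab _ [l bc]].
- by exists 0.
- by exists l.+1, b, b.
- by exists l.+1, a, b.
Qed.

Lemma walkS T (R Q : T -> T -> Prop) l l' a b :
  (forall x, R x x) -> (forall x, Q x x) -> l <= l' ->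
  walk R Q l a b -> walk R Q l' a b.
Proof.
move=> Rr Qr; elim: l' l a => [|l' IH] [|l] a //=.
  by move=> _ ->; exists b, b; split=> //; apply: (IH 0).
by move=> ll [c [d [ac cd db]]]; exists c, d; split=> //; apply: IH db.
Qed.

Lemma fin_bound (J : finType) (P : J -> nat -> Prop) :
  (forall j m n, m <= n -> P j m -> P j n) -> (forall j, exists n, P j n) ->
  exists n, forall j, P j n.
Proof.
move=> mono ex; have [f hf] := choice ex.
exists (\max_j f j) => j; apply: mono (hf j); exact: leq_bigmax.
Qed.

Definition ptw (J T : Type) (R : T -> T -> Prop) (u w : J -> T) : Prop :=
  forall j, R (u j) (w j).

(** Since [J] is finite, one length serves the chains of all coordinates, the shorter ones being
    padded by reflexivity. This is why the tuples of polynomials are indexed by finite types. *)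
Lemma jn_tuple (J : finType) T (R Q : T -> T -> Prop) (u w : J -> T) :
  (forall x, R x x) -> (forall x, Q x x) ->
  (forall j, jn R Q (u j) (w j)) -> jn (ptw R) (ptw Q) u w.
Proof.
move=> Rr Qr uw.
have [l hl] : exists l, forall j, walk R Q l (u j) (w j).
  by apply: fin_bound => [j m n mn|j]; [exact: walkS | exact: jn_walk].
elim: l u hl {uw} => [|l IH] u /= hl.
  have -> : u = w by apply/funext.
  exact: jn_refl.
have [c hc] := choice hl; have [d hd] := choice hc.
apply: (@jn_stepl _ _ _ _ c) => [j|]; first by case: (hd j).
apply: (@jn_stepr _ _ _ _ d) => [j|]; first by case: (hd j).
by apply: IH => j; case: (hd j).
Qed.

(** * Lattice terms evaluated on equivalence relations *)

Fixpoint eqv_eval (T : Type) (E : nat -> T -> T -> Prop) (t : lattice_term) :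
    T -> T -> Prop :=
  match t with
  | LVar k => E k
  | LMeet s u => fun a b => eqv_eval E s a b /\ eqv_eval E u a b
  | LJoin s u => jn (eqv_eval E s) (eqv_eval E u)
  end.

Lemma eqv_eval_equiv T (E : nat -> T -> T -> Prop) t :
  (forall k, equivalence_rel_prop (E k)) -> equivalence_rel_prop (eqv_eval E t).
Proof.
move=> eqE; elim: t => [k|s [sr ss st] u [ur us ut]|s IHs u IHu] //=.
  split=> [x|x y [] /ss + /us|x y z [xy xy'] [yz yz']] //.
  by split; [apply: st xy yz | apply: ut xy' yz'].
exact: jn_equiv.
Qed.

(** The invariant [P] is carried along each chain because [f] may be compatible with the relations
    only on a part of [T], such as the classes of idempotent terms. *)
Lemma eqv_eval_map T U (E : nat -> T -> T -> Prop) (E' : nat -> U -> U -> Prop)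
    (P : T -> Prop) (f : T -> U) :
  (forall k a b, P a -> E k a b -> P b /\ E' k (f a) (f b)) ->
  forall t a b, P a -> eqv_eval E t a b -> P b /\ eqv_eval E' t (f a) (f b).
Proof.
move=> hE; elim=> [k|s IHs u IHu|s IHs u IHu] a b Pa /=; first exact: hE.
  by move=> [/(IHs _ _ Pa) [Pb ?] /(IHu _ _ Pa) [_ ?]].
by apply: jn_map.
Qed.

(** * Terms over an arbitrary set of variables *)

(** The type of variables is arbitrary because states of a semilattice, and later vectors, serve as
    variables themselves. *)
Inductive tm (S : signature) (X : Type) : Type :=
| TVar of X
| TApp (f : S) of ('I_(arity f) -> tm S X).
Arguments TVar {S X} _.
Arguments TApp {S X} f _.

Section Terms.
Variable S : signature.
Implicit Types (A : algebra S).

Fixpoint ev A (X : Type) (v : X -> A) (t : tm S X) : A :=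
  match t with
  | TVar x => v x
  | TApp f ts => op A f (fun i => ev v (ts i))
  end.

Fixpoint tsub (X Y : Type) (s : X -> tm S Y) (t : tm S X) : tm S Y :=
  match t with
  | TVar x => s x
  | TApp f ts => TApp f (fun i => tsub s (ts i))
  end.

Definition tmap (X Y : Type) (f : X -> Y) : tm S X -> tm S Y :=
  tsub (fun x => TVar (f x)).

Fixpoint of_term (t : term S) : tm S nat :=
  match t with
  | Var n => TVar n
  | App f ts => TApp f (fun i => of_term (ts i))
  end.

Lemma ev_tsub A X Y (s : X -> tm S Y) (v : Y -> A) t :
  ev v (tsub s t) = ev (fun x => ev v (s x)) t.
Proof. by elim: t => //= f ts IH; congr op; apply/funext. Qed.

Lemma ev_tmap A X Y (f : X -> Y) (v : Y -> A) t :
  ev v (tmap f t) = ev (fun x => v (f x)) t.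
Proof. exact: ev_tsub. Qed.

Lemma tmap_tmap X Y Z (f : X -> Y) (g : Y -> Z) t :
  tmap g (tmap f t) = tmap (fun x => g (f x)) t.
Proof. by elim: t => //= h ts IH; congr TApp; apply/funext. Qed.

Lemma ev_of_term A (v : nat -> A) t : ev v (of_term t) = term_eval v t.
Proof. by elim: t => //= f ts IH; congr op; apply/funext. Qed.

Lemma con_ev A (th : congruence A) X (u w : X -> A) t :
  (forall x, th (u x) (w x)) -> th (ev u t) (ev w t).
Proof. by move=> uw; elim: t => //= f ts IH; apply: con_op. Qed.

Lemma tm_fin X (t : tm S X) :
  exists (J : finType) (f : J -> X) (t' : tm S J), t = tmap f t'.
Proof.
elim: t => [x|g ts IH].
  by exists unit, (fun=> x), (TVar tt).
pose J i := projT1 (cid (IH i)); have hJ i := cid (projT2 (cid (IH i))).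
pose f i : J i -> X := projT1 (hJ i); have hf i := cid (projT2 (hJ i)).
pose t' i := projT1 (hf i); have ht i : ts i = tmap (f i) (t' i) := projT2 (hf i).
exists {i : 'I_(arity g) & J i}, (fun p => f (tag p) (tagged p)).
exists (TApp g (fun i => tmap (fun j => Tagged J j) (t' i))).
rewrite /tmap /=; congr TApp; apply/funext => i.
by rewrite ht [RHS]tmap_tmap.
Qed.

Lemma con_equiv A (th : congruence A) : equivalence_rel_prop th.
Proof. by split; [apply: con_refl | apply: con_sym | apply: con_trans]. Qed.

Lemma con_joinE A (th ph : congruence A) a b : con_join th ph a b <-> jn th ph a b.
Proof.
split=> [|ab ps h1 h2]; last first.
  elim: ab => {a b} [a|a b c /h1 ab _|a b c /h2 ab _]; first exact: con_refl.
    exact: con_trans ab.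
  exact: con_trans ab.
have [jr js jt] := jn_equiv (con_equiv th) (con_equiv ph).
have jo (f : S) (u w : 'I_(arity f) -> A) :
    (forall i, jn th ph (u i) (w i)) -> jn th ph (op A f u) (op A f w).
  move=> /(jn_tuple (con_refl th) (con_refl ph)).
  move=> /(@jn_map _ _ _ _ th ph (fun=> True) (op A f)) [] // u' w' _ uw;
    by split=> //; apply: con_op.
by move/(_ (Congruence jr js jt jo)); apply=> {}a {}b; [exact: jn_l | exact: jn_r].
Qed.

Fixpoint ceval A (v : nat -> congruence A) (t : lattice_term) : congruence A :=
  match t with
  | LVar n => v n
  | LMeet s t => con_meet (ceval v s) (ceval v t)
  | LJoin s t => con_join (ceval v s) (ceval v t)
  end.

Lemma cevalE A (v : nat -> congruence A) t a b :
  ceval v t a b <-> eqv_eval (fun k => con_rel (v k)) t a b.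
Proof.
elim: t a b => [k|s IHs u IHu|s IHs u IHu] a b //=.
  by rewrite IHs IHu.
split=> [/con_joinE|h]; last apply/con_joinE; last move: h.
  by apply: jn_sub => x y; [move/IHs | move/IHu].
by apply: jn_sub => x y; [move=> ?; apply/IHs | move=> ?; apply/IHu].
Qed.

Lemma lattice_eval_con A (v : nat -> congruence A) t :
  lattice_eval (v : nat -> (congruence A : latticeType _)) t = ceval v t.
Proof. by elim: t => //= s -> u ->. Qed.

(** * Quotients, products, term algebras *)

Section Quotient.
Variables (A : algebra S) (th : congruence A).

Definition quot_carrier := {c : A -> Prop | exists a, c = th a}.

Definition qcl (a : A) : quot_carrier := exist _ (con_rel th a) (ex_intro _ a erefl).

Definition qrep (c : quot_carrier) : A := projT1 (cid (proj2_sig c)).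

Lemma qclE a b : qcl a = qcl b <-> th a b.
Proof.
split=> [[e]|ab]; first by rewrite e; apply: con_refl.
have e : con_rel th a = th b.
  apply/funext => z; apply/propext; split=> h; last exact: con_trans h.
  by apply: con_trans h; apply: con_sym.
by rewrite /qcl; move: (ex_intro _ _ _); rewrite e => ?; congr exist; exact: Prop_irrelevance.
Qed.

Lemma qrepK c : qcl (qrep c) = c.
Proof.
case: c => c hc; rewrite /qcl /qrep /=; case: cid => a /= e.
by move: hc; rewrite e => hc; congr exist; exact: Prop_irrelevance.
Qed.

Lemma qrep_cl a : th (qrep (qcl a)) a.
Proof. by apply/qclE; rewrite qrepK. Qed.

Definition quot : algebra S :=
  @Algebra S quot_carrier (fun f u => qcl (op A f (fun i => qrep (u i))))
    (let: inhabits a := carrier_nonempty A in inhabits (qcl a)).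

Lemma ev_quot X (v : X -> A) t : ev (A := quot) (fun x => qcl (v x)) t = qcl (ev v t).
Proof.
elim: t => //= f ts IH; apply/qclE; apply: con_op => i.
by rewrite IH; apply: qrep_cl.
Qed.

Variables (ph : congruence A) (thph : forall a b, th a b -> ph a b).

Definition quot_con : congruence quot.
Proof.
exists (fun c d => ph (qrep c) (qrep d)).
- by move=> x; apply: con_refl.
- by move=> x y; apply: con_sym.
- by move=> x y z; apply: con_trans.
- move=> f u w uw /=; apply: con_trans (thph (qrep_cl _)) _.
  by apply: con_trans (con_op uw) (con_sym (thph (qrep_cl _))).
Defined.

Lemma quot_conE a b : quot_con (qcl a) (qcl b) <-> ph a b.
Proof.
have h c := thph (qrep_cl c); split=> /= ab.
  exact: con_trans (con_sym (h a)) (con_trans ab (h b)).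
exact: con_trans (h a) (con_trans ab (con_sym (h b))).
Qed.

End Quotient.

Definition prod_alg (I : Type) (A : I -> algebra S) : algebra S :=
  @Algebra S (forall i, A i) (fun f u i => op (A i) f (fun j => u j i))
    (inhabits (fun i => projT1 (cid (let: inhabits a := carrier_nonempty (A i) in
       ex_intro (fun=> True) a Logic.I)))).

Lemma ev_prod I (A : I -> algebra S) X (v : X -> prod_alg A) t :
  ev v t = fun i => ev (fun x => v x i) t.
Proof.
elim: t => [x|f ts IH] //=.
by apply: functional_extensionality_dep => i; congr op; apply/funext => j; rewrite IH.
Qed.

Definition term_alg (Y : Type) (y : Y) : algebra S :=
  @Algebra S (tm S Y) (@TApp S Y) (inhabits (TVar y)).

Lemma ev_term_alg Y (y : Y) X (s : X -> tm S Y) t :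
  ev (A := term_alg y) s t = tsub s t.
Proof. by elim: t => //= f ts IH; congr TApp; apply/funext. Qed.

Variable V : algebra S -> Prop.
Hypothesis hV : variety V.

Definition idem X (t : tm S X) : Prop :=
  forall A, V A -> forall a : A, ev (fun=> a) t = a.

Definition veq X (t t' : tm S X) : Prop :=
  forall A, V A -> forall v : X -> A, ev v t = ev v t'.

Lemma idem_tmap X Y (f : X -> Y) t : idem (tmap f t) <-> idem t.
Proof. by split=> h A VA a; rewrite -[RHS](h A VA) ev_tmap. Qed.

Lemma idem_tsub X Y (s : X -> tm S Y) t : idem t -> (forall x, idem (s x)) ->
  idem (tsub s t).
Proof.
move=> it si A VA a; rewrite ev_tsub -[RHS](it A VA a); congr ev.
by apply/funext => x; apply: si.
Qed.

Lemma veq_tmap X Y (f : X -> Y) t t' : veq t t' -> veq (tmap f t) (tmap f t').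
Proof. by move=> tt' A VA v; rewrite !ev_tmap tt'. Qed.

Lemma variety_quot A (th : congruence A) : V A -> V (quot th).
Proof.
have [E hE] := hV; rewrite !hE => VA e /VA ee v.
rewrite -!ev_of_term; have -> : v = fun n => qcl th (qrep (v n)).
  by apply/funext => n; rewrite qrepK.
by rewrite !ev_quot !ev_of_term ee.
Qed.

Lemma variety_prod I (A : I -> algebra S) : (forall i, V (A i)) -> V (prod_alg A).
Proof.
have [E hE] := hV; move=> VA; apply/hE => e Ee v.
rewrite -!ev_of_term !ev_prod; apply: functional_extensionality_dep => i.
by rewrite !ev_of_term; move: (VA i) => /hE /(_ e Ee).
Qed.

Section Free.
Variables (Y : Type) (y : Y).

Definition veq_con : congruence (term_alg y).
Proof.
exists (@veq Y) => //.
- by move=> s t st A VA v; rewrite st.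
- by move=> s t u st tu A VA v; rewrite st ?tu.
- move=> f u w uw A VA v /=; congr op; apply/funext => i; exact: uw.
Defined.

Definition free := quot veq_con.

Lemma variety_free : V free.
Proof.
have [E hE] := hV; apply/hE => e Ee v.
rewrite -!ev_of_term; have -> : v = fun n => qcl veq_con (qrep (v n)).
  by apply/funext => n; rewrite qrepK.
rewrite !ev_quot; apply/qclE => A VA w; rewrite !ev_term_alg !ev_tsub !ev_of_term.
by move: VA => /hE /(_ e Ee).
Qed.

End Free.

(** * Transfer of lattice inequalities *)

Definition holds (p q : lattice_term) : Prop :=
  forall A, V A -> forall v : nat -> congruence A, forall a b,
    eqv_eval (fun k => con_rel (v k)) p a b -> eqv_eval (fun k => con_rel (v k)) q a b.

Definition pick_prop (Y : Type) (y0 : Y) (P : Y -> Prop) : Y :=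
  if pselect (exists y, P y) is left h then projT1 (cid h) else y0.

Lemma pick_propP Y (y0 : Y) P : (exists y, P y) -> P (pick_prop y0 P).
Proof. by rewrite /pick_prop; case: pselect => // h _; case: cid. Qed.

Lemma class_reps Y (y0 : Y) (R : Y -> Y -> Prop) : equivalence_rel_prop R ->
  exists rho : Y -> Y, (forall y, R (rho y) y) /\ (forall y z, R y z -> rho y = rho z).
Proof.
move=> [Rr Rs Rt]; exists (fun y => pick_prop y0 (R y)); split=> [y|y z yz].
  by apply: Rs; apply: (@pick_propP _ _ (R y)); exists y.
suff -> : R y = R z by [].
apply/funext => w; apply/propext; split=> [yw|zw]; last exact: Rt yz zw.
by apply: Rt yw; apply: Rs.
Qed.

(* The identity is tested on the free algebra over [Y], where [E k] becomes the
   congruence identifying terms that agree after renaming along a choice of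
   [E k]-class representatives. *)
Lemma transfer (p q : lattice_term) (Y : Type) (y0 : Y) (act : tm S Y -> Y)
    (E : nat -> Y -> Y -> Prop) :
  holds p q -> (forall k, equivalence_rel_prop (E k)) ->
  (forall y, act (TVar y) = y) ->
  (forall t t', idem t -> idem t' -> veq t t' -> act t = act t') ->
  (forall k t (s : Y -> Y), idem t -> (forall y, E k (s y) y) ->
     E k (act t) (act (tmap s t))) ->
  forall a b, eqv_eval E p a b -> eqv_eval E q a b.
Proof.
move=> hpq eqE H1 H2 H3 a b pab.
have [rho hrho] := choice (fun k => class_reps y0 (eqE k)).
have hph_ex k : exists c : congruence (term_alg y0), forall t t',
    c t t' <-> veq (tmap (rho k) t) (tmap (rho k) t').
  unshelve refine (ex_intro _ (@Congruence S (term_alg y0)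
    (fun t t' => veq (tmap (rho k) t) (tmap (rho k) t')) _ _ _ _) _) => //=.
  - by move=> s t st A VA v; rewrite st.
  - by move=> s t u st tu A VA v; rewrite st ?tu.
  - move=> f u w uw A VA v /=; congr op; apply/funext => i; exact: uw.
have [ph hph] := choice hph_ex.
have le k t t' : veq_con y0 t t' -> ph k t t'.
  by move=> tt'; apply/hph/veq_tmap.
pose th k := quot_con (le k).
have : eqv_eval (fun k => con_rel (th k)) q (qcl (veq_con y0) (TVar a)) (qcl (veq_con y0) (TVar b)).
  apply: (hpq _ (variety_free y0) th).
  have [] // := @eqv_eval_map _ _ E (fun k => con_rel (th k)) (fun=> True)
    (fun y => qcl (veq_con y0) (TVar y)) _ p a b I pab.
  move=> k x y _ xy; split=> //; apply/quot_conE/hph; rewrite /tmap /=.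
  by rewrite ((hrho k).2 _ _ xy).
have ir x : idem (qrep (qcl (veq_con y0) (TVar x))).
  move=> A VA c; exact: (@qrep_cl _ (veq_con y0) (TVar x) A VA (fun=> c)).
have ar x : act (qrep (qcl (veq_con y0) (TVar x))) = x.
  by rewrite -[RHS]H1; apply: H2 (ir x) _ _ => //; exact: (@qrep_cl _ (veq_con y0) (TVar x)).
(* A chain for [q] starts at a variable, and terms that agree after a renaming are idempotent
   together. So [act] meets only idempotent terms, the only ones about which anything is assumed. *)
move=> hq; suff stp : forall k (c d : free y0), idem (qrep c) -> th k c d ->
    idem (qrep d) /\ E k (act (qrep c)) (act (qrep d)).
  have [_] := @eqv_eval_map _ _ (fun k => con_rel (th k)) E (fun c => idem (qrep c))
    (fun c => act (qrep c)) stp q _ _ (ir a) hq.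
  by rewrite !ar.
move=> k c d ic /hph cd.
have id_ : idem (qrep d).
  by move=> A VA x; rewrite -[RHS](ic A VA x); have := cd A VA (fun=> x); rewrite !ev_tmap.
split=> //; have [_ Es Et] := eqE k.
apply: Et (H3 _ _ (rho k) ic _) _; first by move=> y; case: (hrho k).
rewrite (H2 _ _ _ _ cd) ?idem_tmap //.
by apply: Es; apply: H3 => // y; case: (hrho k).
Qed.

End Terms.

(** * A finite meet semilattice on which a given inequality fails *)

(** Bits at the leaves determine bits at all nodes: the conjunction at a meet and, for valid states,
    the common bit of both sides at a join. The valid states of [q] under conjunction are the finite
    semilattice. *)
Fixpoint state (t : lattice_term) : Type :=
  match t with
  | LVar _ => bool
  | LMeet s u | LJoin s u => (state s * state u)%type
  end.

Fixpoint rho (t : lattice_term) : state t -> bool :=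
  match t with
  | LVar _ => fun I => I
  | LMeet s u => fun I => rho I.1 && rho I.2
  | LJoin s u => fun I => rho I.1
  end.

Fixpoint valid (t : lattice_term) : state t -> Prop :=
  match t with
  | LVar _ => fun=> True
  | LMeet s u => fun I => valid I.1 /\ valid I.2
  | LJoin s u => fun I => [/\ valid I.1, valid I.2 & rho I.1 = rho I.2]
  end.

Fixpoint sle (t : lattice_term) : state t -> state t -> Prop :=
  match t with
  | LVar _ => fun I J => I ==> J
  | LMeet s u | LJoin s u => fun I J => sle I.1 J.1 /\ sle I.2 J.2
  end.

Fixpoint weight (t : lattice_term) : state t -> nat :=
  match t with
  | LVar _ => fun I => nat_of_bool I
  | LMeet s u | LJoin s u => fun I => weight I.1 + weight I.2
  end.

Fixpoint bigm (T : Type) (P : T -> Prop) (t : lattice_term) : (T -> state t) -> state t :=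
  match t with
  | LVar _ => fun f => `[< forall y, P y -> f y >]
  | LMeet s u | LJoin s u => fun f =>
      (bigm P (fun y => (f y).1), bigm P (fun y => (f y).2))
  end.

Fixpoint full (t : lattice_term) : state t :=
  match t with
  | LVar _ => true
  | LMeet s u | LJoin s u => (full s, full u)
  end.

Lemma rho_bigm T (P : T -> Prop) t (f : T -> state t) :
  rho (bigm P f) = `[< forall y, P y -> rho (f y) >].
Proof.
elim: t f => [k|s IHs u IHu|s IHs u IHu] f //=.
rewrite IHs IHu; apply/andP/asboolP => [[/asboolP h /asboolP h'] y Py|h].
  by rewrite h ?h'.
by split; apply/asboolP => y /h /andP[].
Qed.

Lemma valid_bigm T (P : T -> Prop) t (f : T -> state t) :
  (forall y, P y -> valid (f y)) -> valid (bigm P f).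
Proof.
elim: t f => [k|s IHs u IHu|s IHs u IHu] f //= hf.
  by split; [apply: IHs | apply: IHu] => y /hf[].
split; [apply: IHs | apply: IHu | rewrite !rho_bigm].
- by move=> y /hf[].
- by move=> y /hf[].
- congr asbool; apply/propext; split=> h y Py; case: (hf y Py) => _ _ e.
    by rewrite -e h.
  by rewrite e h.
Qed.

Lemma bigm1 T (P : T -> Prop) t (f : T -> state t) y :
  (forall z, P z <-> z = y) -> bigm P f = f y.
Proof.
move=> hP; elim: t f => [k|s IHs u IHu|s IHs u IHu] f /=.
- by apply/asboolP/idP => [|h z /hP -> //]; apply; apply/hP.
- by rewrite IHs IHu -surjective_pairing.
- by rewrite IHs IHu -surjective_pairing.
Qed.

Lemma bigm_im T (P Q : T -> Prop) (s : T -> T) t (f : T -> state t) :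
  (forall z, Q z <-> exists2 y, P y & s y = z) -> bigm Q f = bigm P (fun y => f (s y)).
Proof.
move=> hQ; elim: t f => [k|u IHu w IHw|u IHu w IHw] f /=; rewrite ?IHu ?IHw //.
apply/asboolP/asboolP => h y; first by move=> Py; apply/h/hQ; exists y.
by case/hQ => z Pz <-; apply: h.
Qed.

Lemma sle_refl t (I : state t) : sle I I.
Proof. by elim: t I => [k|s IHs u IHu|s IHs u IHu] I //=; apply/implyP. Qed.

Lemma sle_trans t (J I K : state t) : sle I J -> sle J K -> sle I K.
Proof.
elim: t I J K => [k|s IHs u IHu|s IHs u IHu] I J K /=.
- by move=> /implyP IJ /implyP JK; apply/implyP => /IJ /JK.
- by move=> [? ?] [? ?]; split; [apply: IHs | apply: IHu]; eauto.
- by move=> [? ?] [? ?]; split; [apply: IHs | apply: IHu]; eauto.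
Qed.

Lemma sle_rho t (I J : state t) : sle I J -> rho I -> rho J.
Proof.
elim: t I J => [k|s IHs u IHu|s IHs u IHu] I J /=.
- by move/implyP.
- by move=> [/IHs h1 /IHu h2] /andP[/h1 -> /h2 ->].
- by move=> [/IHs h1 _].
Qed.

Lemma sle_weight t (I J : state t) : sle I J -> weight J <= weight I -> I = J.
Proof.
suff h : sle I J -> weight I <= weight J /\ (weight J <= weight I -> I = J).
  by move=> /h[].
have step (m m' n n' : nat) : m <= m' -> n <= n' ->
    m + n <= m' + n' /\ (m' + n' <= m + n -> m' <= m /\ n' <= n).
  move=> mm nn; split=> [|h]; first by rewrite leq_add.
  split; first by rewrite -(leq_add2r n); apply: leq_trans h; rewrite leq_add2l.
  by rewrite -(leq_add2l m); apply: leq_trans h; rewrite leq_add2r.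
elim: t I J => [k|s IHs u IHu|s IHs u IHu]; first by case; case.
all: move=> [I1 I2] [J1 J2] /= [/IHs [w1 e1] /IHu [w2 e2]].
all: have [w h] := step _ _ _ _ w1 w2; split=> // /h [/e1 -> /e2 -> //].
Qed.

Lemma bigm_pair_l t (I J : state t) : sle I J ->
  bigm (fun=> True) (fun b : bool => if b then I else J) = I.
Proof.
elim: t I J => [k|s IHs u IHu|s IHs u IHu] I J /=.
- by move=> /implyP h; apply/asboolP/idP => [/(_ true Logic.I) //|Ii [] _ //]; apply: h.
- move=> [/IHs h1 /IHu h2]; rewrite [RHS]surjective_pairing; congr pair.
    by rewrite -[RHS]h1; congr bigm; apply/funext; case.
  by rewrite -[RHS]h2; congr bigm; apply/funext; case.
- move=> [/IHs h1 /IHu h2]; rewrite [RHS]surjective_pairing; congr pair.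
    by rewrite -[RHS]h1; congr bigm; apply/funext; case.
  by rewrite -[RHS]h2; congr bigm; apply/funext; case.
Qed.

Lemma bigm_pair_r t (I J : state t) : sle I J ->
  bigm (fun=> True) (fun b : bool => if b then J else I) = I.
Proof.
move=> IJ; rewrite -[RHS](bigm_pair_l IJ).
rewrite (@bigm_im _ (fun=> True) (fun=> True) negb); last first.
  by case; split=> // _; [exists false | exists true].
by congr bigm; apply/funext; case.
Qed.

Lemma valid_full t : valid (full t) /\ rho (full t).
Proof. by elim: t => [k|s [? r1] u [? r2]|s [? r1] u [? r2]] //=; rewrite r1 r2. Qed.

Section Failure.
Variables (d : Order.disp_t) (L : latticeType d) (x : nat -> L).
Local Notation val := (lattice_eval x).

(* The bits agree at every node of value at least [x k].  A join shares its bit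
   with its two sides, so [a] is the value of the topmost join above the root. *)
Fixpoint srel (k : nat) (t : lattice_term) (a : L) : state t -> state t -> Prop :=
  match t with
  | LVar _ => fun I J => (x k <= a)%O -> I = J
  | LMeet s u => fun I J =>
      [/\ (x k <= a)%O -> rho I.1 && rho I.2 = rho J.1 && rho J.2,
          srel k (val s) I.1 J.1 & srel k (val u) I.2 J.2]
  | LJoin s u => fun I J => srel k a I.1 J.1 /\ srel k a I.2 J.2
  end.

(** The topmost nodes with bit 1 must have value at least [b], where a side of a join counts with
    the value of that join; nothing is required below a meet with bit 1. *)
Fixpoint tops (b : L) (t : lattice_term) (a : L) : state t -> Prop :=
  match t return state t -> Prop with
  | LVar _ => fun I => is_true I -> (b <= a)%O
  | LMeet s u => fun I => if rho I.1 && rho I.2 then is_true (b <= a)%O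
                          else tops b (val s) I.1 /\ tops b (val u) I.2
  | LJoin s u => fun I => tops b a I.1 /\ tops b a I.2
  end.

Lemma srel_equiv k t a : equivalence_rel_prop (@srel k t a).
Proof.
elim: t a => [j|s IHs u IHu|s IHs u IHu] a; split=> /=.
- by [].
- by move=> I J h /h.
- by move=> I J K h h' ka; rewrite h ?h'.
- by move=> I; split=> //; [case: (IHs (val s)) | case: (IHu (val u))].
- by move=> I J [h ? ?]; split; [move/h | case: (IHs (val s)); eauto | case: (IHu (val u)); eauto].
- move=> I J K [h h1 h2] [h' h1' h2']; split; first by move=> ka; rewrite h ?h'.
    by case: (IHs (val s)) => _ _; apply; eauto.
  by case: (IHu (val u)) => _ _; apply; eauto.
- by move=> I; split; [case: (IHs a) | case: (IHu a)].
- by move=> I J [? ?]; split; [case: (IHs a); eauto | case: (IHu a); eauto].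
- move=> I J K [h1 h2] [h1' h2']; split.
    by case: (IHs a) => _ _; apply; eauto.
  by case: (IHu a) => _ _; apply; eauto.
Qed.

Lemma srel_bigm k T (P : T -> Prop) t a (f g : T -> state t) :
  (forall y, P y -> srel k a (f y) (g y)) -> srel k a (bigm P f) (bigm P g).
Proof.
elim: t a f g => [j|s IHs u IHu|s IHs u IHu] a f g /= h.
- move=> ka; congr asbool; apply/propext; split=> H y Py; first by rewrite -h ?H.
  by rewrite h ?H.
- split; [|apply: IHs => y /h[] //|apply: IHu => y /h[] //].
  move=> ka; rewrite !rho_bigm -!asbool_and; congr asbool; apply/propext.
  split=> -[H1 H2]; split=> y Py; move: (h y Py) => [/(_ ka) + _ _];
    by rewrite (H1 y Py) (H2 y Py); case: rho => //=; case: rho.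
- by split; [apply: IHs => y /h[] | apply: IHu => y /h[]].
Qed.

Lemma tops_rho b t a (I : state t) :
  (val t <= a)%O -> valid I -> tops b a I -> rho I -> (b <= a)%O.
Proof.
elim: t a I => [j|s IHs u IHu|s IHs u IHu] a I ta /=; first by move=> _; exact.
  by move=> _ + r; rewrite r.
move=> [v1 _ _] [h1 _]; apply: IHs v1 h1.
by apply: le_trans ta; rewrite leUl.
Qed.

Lemma tops_meet_children b s u (I : state (LMeet s u)) : valid I ->
  tops b (val s) I.1 -> tops b (val u) I.2 -> rho I -> (b <= val (LMeet s u))%O.
Proof.
move=> [v1 v2] h1 h2 /andP[r1 r2] /=; rewrite lexI.
by rewrite (tops_rho _ v1 h1) // (tops_rho _ v2 h2).
Qed.

Lemma tops_top b t a (I : state t) : valid I -> rho I -> (b <= a)%O -> tops b a I.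
Proof.
elim: t a I => [j|s IHs u IHu|s IHs u IHu] a I //=; first by move=> _ ->.
move=> [v1 v2 e] r ba; split; first exact: IHs.
by apply: IHu; rewrite -?e.
Qed.

(** Descending from the root, a true node whose value is at least [x k] is kept with its whole
    subtree, and the leaves reached otherwise are switched off. Validity at a join survives because
    two sides that are not kept both end with bit 0, by [tops_rho]. *)
Lemma tops_var k t a (I : state t) : (val t <= a)%O -> valid I ->
  exists J, [/\ sle J I, valid J, srel k a I J & tops (x k) a J].
Proof.
have top t' a' (I' : state t') : valid I' -> (x k <= a')%O && rho I' ->
    exists J, [/\ sle J I', valid J, srel k a' I' J & tops (x k) a' J].
  move=> vI' /andP[ka rI]; exists I'; split=> //; first exact: sle_refl.
    by case: (srel_equiv k t' a') => r _ _; exact: r.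
  exact: tops_top.
elim: t a I => [j|s IHs u IHu|s IHs u IHu] a I ta vI;
  have [/(top _ _ _ vI) //|/negbTE h] := boolP ((x k <= a)%O && rho I).
- exists false; split=> //= ka; by move: h; rewrite ka /=; case: I {vI}.
- have [J1 [l1 v1 e1 h1]] := IHs (val s) I.1 (lexx _) vI.1.
  have [J2 [l2 v2 e2 h2]] := IHu (val u) I.2 (lexx _) vI.2.
  have lJ : @sle (LMeet s u) (J1, J2) I by [].
  exists (J1, J2); split=> //=; last first.
    case: ifP => // r; apply: le_trans ta.
    exact: (@tops_meet_children _ _ _ (J1, J2)).
  split=> // ka; move: h; rewrite ka /= => rI; rewrite rI.
  case rJ: (_ && _) => //; have := @sle_rho (LMeet s u) _ _ lJ.
  by rewrite /= rJ rI => /(_ isT).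
- have [vI1 vI2 eI] := vI.
  have [J1 [l1 v1 e1 h1]] := IHs a I.1 (le_trans (leUl _ _) ta) vI1.
  have [J2 [l2 v2 e2 h2]] := IHu a I.2 (le_trans (leUr _ _) ta) vI2.
  have r1 : rho J1 = false.
    apply/negbTE/negP => r1; move: h => /negP; apply; apply/andP; split.
      exact: tops_rho (le_trans (leUl _ _) ta) v1 h1 r1.
    exact: sle_rho l1 r1.
  have r2 : rho J2 = false.
    apply/negbTE/negP => r2; move: h => /negP; apply; apply/andP; split.
      exact: tops_rho (le_trans (leUr _ _) ta) v2 h2 r2.
    by rewrite /= eI; apply: sle_rho l2 r2.
  by exists (J1, J2); split=> //=; rewrite r1 r2.
Qed.

Lemma tops_join b c t a (I : state t) : tops b a I -> tops c a I ->
  tops (b `|` c)%O a I.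
Proof.
elim: t a I => [j|s IHs u IHu|s IHs u IHu] a I /=.
- by move=> h h' Ii; rewrite leUx h ?h'.
- by case: ifP => _; [move=> h h'; rewrite leUx h h'|move=> [? ?] [? ?]; split; eauto].
- by move=> [? ?] [? ?]; split; eauto.
Qed.

(** [M] starts as the union of [J] and [K]. Where a bit 1 reaches a meet or a join, the whole of [I]
    is restored below that node, which repairs validity; one of the two bounds then gives the value
    of the node. *)
Lemma tops_meet b c t a (I J K : state t) : (val t <= a)%O -> valid I -> valid J ->
  valid K -> sle J I -> sle K I -> tops b a J -> tops c a K ->
  exists M, [/\ sle M I, sle J M, sle K M, valid M & tops (b `&` c)%O a M].
Proof.
elim: t a I J K => [j|s IHs u IHu|s IHs u IHu] a I J K ta vI vJ vK JI KI tJ tK.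
- exists (J || K); split=> //=; last first.
  - case/orP=> [/tJ|/tK] h; first by rewrite leIxl.
    by rewrite leIxr.
  - by case: K {vK tK KI}; rewrite ?orbT.
  - by case: J {vJ tJ JI}.
  - by move: JI KI => /=; case: J {vJ tJ}; case: K {vK tK}; case: I {vI}.
- case h : (rho J || rho K).
    have bca : (b `&` c <= a)%O.
      case/orP: h => r; first by rewrite leIxl ?(tops_rho ta vJ tJ).
      by rewrite leIxr ?(tops_rho ta vK tK).
    have rI : rho I by case/orP: h; apply: sle_rho.
    exists I; split=> //; [exact: sle_refl | exact: tops_top].
  move/norP: (negbT h) => [rJ rK].
  move: tJ tK => /=; move: (rJ) (rK) => /= /negbTE -> /negbTE -> [tJ1 tJ2] [tK1 tK2].
  have [M1 [? ? ? vM1 tM1]] :=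
    IHs _ _ _ _ (lexx _) vI.1 vJ.1 vK.1 JI.1 KI.1 tJ1 tK1.
  have [M2 [? ? ? vM2 tM2]] :=
    IHu _ _ _ _ (lexx _) vI.2 vJ.2 vK.2 JI.2 KI.2 tJ2 tK2.
  exists (M1, M2); split=> //=; case: ifP => // r; apply: le_trans ta.
  exact: (@tops_meet_children _ _ _ (M1, M2)).
- have [vI1 vI2 eI] := vI; have [vJ1 vJ2 eJ] := vJ; have [vK1 vK2 eK] := vK.
  have [M1 [? ? ? vM1 tM1]] := IHs _ _ _ _ (le_trans (leUl _ _) ta)
    vI1 vJ1 vK1 JI.1 KI.1 tJ.1 tK.1.
  have [M2 [? ? ? vM2 tM2]] := IHu _ _ _ _ (le_trans (leUr _ _) ta)
    vI2 vJ2 vK2 JI.2 KI.2 tJ.2 tK.2.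
  case h : (rho M1 || rho M2); last first.
    move/norP: (negbT h) => [/negbTE r1 /negbTE r2].
    by exists (M1, M2); split=> //=; rewrite r1 r2.
  have bca : (b `&` c <= a)%O.
    case/orP: h => r; first by apply: tops_rho vM1 tM1 r; apply: le_trans ta; rewrite leUl.
    by apply: tops_rho vM2 tM2 r; apply: le_trans ta; rewrite leUr.
  have rI : rho I.
    by case/orP: h => r /=; last rewrite eI; apply: sle_rho r.
  exists I; split=> //; [exact: sle_refl | exact: tops_top].
Qed.

Variable q : lattice_term.

Definition vstate := {I : state q | valid I}.

Definition vrel k (I J : vstate) := srel k (val q) (sval I) (sval J).

Lemma vrel_equiv k : equivalence_rel_prop (vrel k).
Proof.
have [r s t] := srel_equiv k q (val q).
by split; rewrite /vrel; [move=> I; apply: r | move=> I J; apply: s | move=> I J K; apply: t].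
Qed.

Definition vmeet (T : Type) (P : T -> Prop) (f : T -> vstate) : vstate :=
  exist _ (bigm P (fun y => sval (f y))) (valid_bigm (fun y _ => proj2_sig (f y))).

Lemma vstate_eq (I J : vstate) : sval I = sval J -> I = J.
Proof.
case: I J => I vI [J vJ] /= e; move: vJ; rewrite -e => vJ.
by congr exist; exact: Prop_irrelevance.
Qed.

(** For a meet, the states found for both sides are merged into [M]; taking conjunctions with [M]
    turns a chain from [I] to a state [N] below [M] into a chain from [M] to [N]. For a join, a
    reachable state of least weight is left in place by the moves of either side, so it has both
    bounds. *)
Lemma tops_term (t : lattice_term) (I : vstate) : exists J : vstate,
  [/\ sle (sval J) (sval I), eqv_eval vrel t I J & tops (val t) (val q) (sval J)].
Proof.
have eqt u := eqv_eval_equiv u vrel_equiv.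
elim: t I => [k|s IHs u IHu|s IHs u IHu] I.
- have [J [JI vJ IJ tJ]] := tops_var k (lexx _) (proj2_sig I).
  by exists (exist _ J vJ).
- have [J [JI IJ tJ]] := IHs I; have [K [KI IK tK]] := IHu I.
  have [M [MI JM KM vM tM]] := tops_meet (lexx _) (proj2_sig I) (proj2_sig J)
    (proj2_sig K) JI KI tJ tK.
  pose M' : vstate := exist _ M vM.
  have conv t' (N : vstate) : sle (sval N) M -> eqv_eval vrel t' I N -> eqv_eval vrel t' I M'.
    move=> NM IN; have [_ es et] := eqt t'; apply: (et _ _ _ IN); apply: es.
    pose f (Z : vstate) := vmeet (fun=> True) (fun b : bool => if b then M' else Z).
    have fE (Z : vstate) : sle M (sval Z) -> f Z = M'.
      move=> MZ; apply: vstate_eq => /=; rewrite -[RHS](bigm_pair_l MZ).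
      by congr bigm; apply/funext; case.
    have fN (Z : vstate) : sle (sval Z) M -> f Z = Z.
      move=> ZM; apply: vstate_eq => /=; rewrite -[RHS](bigm_pair_r ZM).
      by congr bigm; apply/funext; case.
    suff : eqv_eval vrel t' (f I) (f N) by rewrite (fE I MI) (fN N NM).
    have [] // := @eqv_eval_map _ _ (vrel) (vrel) (fun=> True) f _ t' I N Logic.I IN.
    move=> k Z W _ ZW; split=> //; apply: srel_bigm => -[] _ //.
    by have [r _ _] := srel_equiv k q (val q); apply: r.
  exists M'; split=> //; split; [exact: conv IJ | exact: conv IK].
- have [m hm] : exists m, exists J : vstate, [/\ sle (sval J) (sval I),
      eqv_eval vrel (LJoin s u) I J & weight (sval J) = m].
    by exists (weight (sval I)), I; split=> //; [exact: sle_refl | exact: jn_refl].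
  have {m hm} [J [JI IJ Jmin]] : exists J : vstate, [/\ sle (sval J) (sval I),
      eqv_eval vrel (LJoin s u) I J & forall K : vstate, sle (sval K) (sval J) ->
        eqv_eval vrel (LJoin s u) I K -> sval K = sval J].
    have [n] := ubnP m; elim: n m hm => // n IH m [J [JI IJ Jm]] mn.
    have [[K [KJ IK wK]]|h] := pselect (exists K : vstate, [/\ sle (sval K) (sval J),
        eqv_eval vrel (LJoin s u) I K & weight (sval K) < m]).
      apply: (IH (weight (sval K))); last exact: leq_trans wK mn.
      by exists K; split=> //; exact: sle_trans KJ JI.
    exists J; split=> // K KJ IK; apply: (sle_weight KJ); rewrite Jm leqNgt.
    by apply/negP => wK; apply: h; exists K.
  exists J; split=> //; apply: tops_join.
    have [K [KJ JK tK]] := IHs J; rewrite -(Jmin K) //.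
    by apply: jn_trans IJ _; apply: jn_l.
  have [K [KJ JK tK]] := IHu J; rewrite -(Jmin K) //.
  by apply: jn_trans IJ _; apply: jn_r.
Qed.

(** The induction follows the tree of the term that carries the states: [pi] projects a state to the
    subtree at the current node, and each relation evaluated at that node preserves its bit. *)
Lemma eval_rho (t : lattice_term) (Z : Type) (F : nat -> Z -> Z -> Prop)
    (pi : Z -> state t) (a : L) : (val t <= a)%O ->
  (forall z, valid (pi z)) -> (forall k z z', F k z z' -> srel k a (pi z) (pi z')) ->
  forall z z', eqv_eval F t z z' -> rho (pi z) = rho (pi z').
Proof.
elim: t pi a => [j|s IHs u IHu|s IHs u IHu] pi a ta vpi hF z z' /=.
- by move=> /hF /= h; apply: h.
- move=> [h1 h2]; congr andb.
    apply: (IHs (fun z => (pi z).1) (val s)) h1 => // [y|k y y' /hF []] //.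
    by case: (vpi y).
  apply: (IHu (fun z => (pi z).2) (val u)) h2 => // [y|k y y' /hF []] //.
  by case: (vpi y).
- have v1 y : valid (pi y).1 by case: (vpi y).
  have v2 y : valid (pi y).2 by case: (vpi y).
  have e y : rho (pi y).1 = rho (pi y).2 by case: (vpi y).
  elim=> // {z z'} [z y z' zy _ <-|z y z' zy _ <-].
    apply: (IHs (fun z => (pi z).1) a) zy => // [|k w w' /hF [] //].
    by apply: le_trans ta; rewrite leUl.
  rewrite !e; apply: (IHu (fun z => (pi z).2) a) zy => // [|k w w' /hF [] //].
  by apply: le_trans ta; rewrite leUr.
Qed.

Definition vfull : vstate := exist _ (full q) (valid_full q).1.

Lemma eval_fails p : ~~ (val p <= val q)%O ->
  exists J, eqv_eval vrel p vfull J /\ ~ eqv_eval vrel q vfull J.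
Proof.
move=> npq; have [J [_ pJ tJ]] := tops_term p vfull; exists J; split=> // qJ.
have := @eval_rho q vstate vrel (@proj1_sig _ _) (val q) (lexx _)
  (fun z => proj2_sig z) (fun k z z' h => h) _ _ qJ.
rewrite /= (valid_full q).2 => rJ.
by move: npq; rewrite (tops_rho (lexx _) (proj2_sig J) tJ).
Qed.

End Failure.

Lemma nontrivial_fails (e : lattice_identity) : nontrivial_identity e ->
  exists d (L : latticeType d) (x : nat -> L) p q, (e = (p, q) \/ e = (q, p)) /\
    ~~ (lattice_eval x p <= lattice_eval x q)%O.
Proof.
case: e => p q he; apply: contrapT => h; apply: he => d L x /=; apply/eqP.
rewrite eq_le; apply/andP; split; apply: contrapT => /negP hn; apply: h.
  by exists d, L, x, p, q; split=> //; left.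
by exists d, L, x, q, p; split=> //; right.
Qed.

Section HMP.
Variables (S : signature) (V : algebra S -> Prop).
Hypothesis hV : variety V.

Lemma holds_of_satisfies p q : class_satisfies (Con V) (p, q) -> holds V p q.
Proof.
move=> h A VA v a b; rewrite -!cevalE -!lattice_eval_con.
by have := h _ _ (Con_intro VA) v; rewrite /= => ->.
Qed.

(* A Mal'cev-type induction: if [I] failed at the second variable, the finite
   semilattice of the previous section would carry a structure violating [e],
   each term acting by the meet over the set of its relevant variables. *)
Theorem binary_term_induction (e : lattice_identity) (I : tm S bool -> Prop) :
  nontrivial_identity e -> class_satisfies (Con V) e ->
  (forall t t', idem V t -> idem V t' -> veq V t t' -> I t -> I t') ->
  I (TVar false) ->
  (forall (J : finType) (t : tm S J) (U U' : J -> bool), idem V t ->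
     (forall j, U' j -> U j) -> I (tmap U t) -> I (tmap U' t)) ->
  (forall (J : finType) (t : tm S J) (U W : J -> bool), idem V t ->
     (forall j, ~~ (U j && W j)) -> I (tmap U t) -> I (tmap W t) ->
     I (tmap (fun j => U j || W j) t)) ->
  I (TVar true).
Proof.
move=> /nontrivial_fails [d [L [x [p [q [epq npq]]]]]] he Ieq I0 Isub Iun.
apply: contrapT => nI; have hpq : holds V p q.
  by apply: holds_of_satisfies; case: epq he => -> // h d' L' K v; rewrite /= (h _ _ K v).
have [J [pJ]] := eval_fails npq; apply.
pose Y := vstate q; pose ind (s : Y) := fun y : Y => `[< y = s >].
pose supp t (s : Y) := ~ I (tmap (ind s) t).
pose act (t : tm S Y) : Y := vmeet (supp t) id.
apply: (@transfer S V hV p q Y (vfull q) act (@vrel _ _ x q) hpq (vrel_equiv x _)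
  _ _ _ (vfull q) J pJ).
- move=> y; apply: vstate_eq; rewrite [LHS]/=.
  apply: (@bigm1 _ _ _ (fun y : Y => sval y)) => z.
  rewrite /supp /tmap /= /ind; case: asboolP => [->|ny]; first by split.
  by split=> [/(_ I0)|ez]; [case|case: ny].
- move=> t t' it it' tt'; rewrite /act; suff -> : supp t = supp t' by [].
  apply/funext => s; apply/propext; split=> h h'; apply: h; apply: Ieq h'; rewrite ?idem_tmap //.
    by move=> A VA v; rewrite !ev_tmap tt'.
  by move=> A VA v; rewrite !ev_tmap tt'.
move=> k t s it hs; rewrite /vrel /act /=.
(* Relevant variables of [tmap s t] are the images of those of [t]: a fibre of [s] whose variables
   are all irrelevant is irrelevant as a whole, its finitely many variables being added one at a
   time by [Iun]. The converse is [Isub]. *)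
rewrite (@bigm_im _ (supp t) (supp (tmap s t)) s); last first.
  move=> z; have [F [f [t' et]]] := tm_fin t; subst t.
  rewrite /supp !tmap_tmap; split; last first.
    move=> [y hy <-] h; apply: hy; rewrite tmap_tmap; apply: Isub h.
      by move: it; rewrite idem_tmap.
    by move=> j /asboolP ->; apply/asboolP.
  apply: contra_notP => /forall2NP h.
  have fib y : s y = z -> I (tmap (fun j => ind y (f j)) t').
    by move=> sy; case: (h y) => //; rewrite tmap_tmap => /contrapT.
  have it' : idem V t' by move: it; rewrite idem_tmap.
  have un (l : seq F) : (forall i, i \in l -> s (f i) = z) ->
      I (tmap (fun j => has (fun i => `[< f j = f i >]) l) t').
    elim: l => [|i l IH] hl.
      by apply: Ieq I0; rewrite ?idem_tmap // => A VA v; rewrite ev_tmap /= it'.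
    have {}IH : I (tmap (fun j => has (fun i => `[< f j = f i >]) l) t').
      by apply: IH => i' il; apply: hl; rewrite inE il orbT.
    have si : s (f i) = z by apply: hl; rewrite inE eqxx.
    have [/hasP [i' il /asboolP ii']|nl] := boolP (has (fun i' => `[< f i = f i' >]) l).
      suff -> : (fun j => has (fun i => `[< f j = f i >]) (i :: l)) =
               (fun j => has (fun i => `[< f j = f i >]) l) by [].
      apply/funext => j /=; case: asboolP => //= ->; apply/esym/hasP; exists i' => //.
      exact/asboolP.
    apply: Iun => //; last exact: fib.
    move=> j; apply/negP => /andP[/asboolP ji]; rewrite ji.
    exact/negP.
  have := un [seq i <- enum F | `[< s (f i) = z >]].
  set U := (fun j => has _ _); suff -> : U = fun j => ind z (s (f j)).
    by apply=> i; rewrite mem_filter => /andP[/asboolP].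
  apply/funext => j; apply/hasP/asboolP => [[i]|sj].
    by rewrite mem_filter => /andP[/asboolP + _] /asboolP ->.
  by exists j; [rewrite mem_filter mem_enum andbT; exact/asboolP | exact/asboolP].
have [r es _] := srel_equiv x k q (lattice_eval x q).
by apply: srel_bigm => y _; apply: es; apply: hs.
Qed.

End HMP.

(** * Polynomials on idempotent-closed sets *)

Section Core.
Variables (S : signature) (V : algebra S -> Prop).

Definition term_induction : Prop := forall I : tm S bool -> Prop,
  (forall t t', idem V t -> idem V t' -> veq V t t' -> I t -> I t') ->
  I (TVar false) ->
  (forall (J : finType) (t : tm S J) (U U' : J -> bool), idem V t ->
     (forall j, U' j -> U j) -> I (tmap U t) -> I (tmap U' t)) ->
  (forall (J : finType) (t : tm S J) (U W : J -> bool), idem V t ->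
     (forall j, ~~ (U j && W j)) -> I (tmap U t) -> I (tmap W t) ->
     I (tmap (fun j => U j || W j) t)) ->
  I (TVar true).

Hypothesis hind : term_induction.

Variables (B : algebra S) (VB : V B).

Lemma ev_cst X (t : tm S X) (a : B) : idem V t -> ev (fun=> a) t = a.
Proof. by move=> it; apply: it. Qed.

Lemma ev_cstE X (t : tm S X) (v : X -> B) (a : B) :
  idem V t -> (forall x, v x = a) -> ev v t = a.
Proof. by move=> it va; rewrite -(ev_cst a it); congr ev; apply/funext. Qed.

(** Term induction on the property that replacing [p] by [q] at the variables in a set moves the
    value of the term only within its [x]-class. *)
Lemma square_lemma (x y z : congruence B) (p q r s : B) :
  (forall a b, y a b -> z a b -> x a b) ->
  z p q -> z r s -> y p r -> y q s -> x q r -> x r s -> x q p.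
Proof.
move=> yzx pq rs pr qs xqr xrs.
pose bt (U : bool) := if U then q else p.
have key (J : finType) (t : tm S J) (U c c' : J -> bool) : idem V t ->
    x (ev (fun j => if U j then q else p) t) p -> (forall j, U j || (c j == c' j)) ->
    x (ev (fun j => if c j then r else p) t) (ev (fun j => if c' j then r else p) t).
  (* Row [i] of this matrix evaluates to [r] or [p] modulo [x]. Rows vary within [z] and columns
     within [y], so replacing row values by the diagonal costs only the meet of [y] and [z], hence
     only [x]. On [U] the diagonal stays in the common [x]-class of [q] and [s], whatever [d] is. *)
  move=> it hU cc; pose M (d : J -> bool) i j :=
    if U j then (if d i then s else q) else (if d i then r else p).
  have row d : x (ev (fun j => if d j then r else p) t) (ev (fun i => ev (M d i) t) t).
    apply: con_ev => i; rewrite /M; case: (d i); last exact: con_sym.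
    rewrite -{1}(ev_cst r it); apply: con_ev => j; case: (U j) => //; exact: con_refl.
  have diag d : x (ev (fun i => ev (M d i) t) t) (ev (fun i => M d i i) t).
    apply: yzx.
      have mid : y (ev (fun i => M d i i) t) (ev (fun i => if U i then q else p) t).
        apply: con_ev => i; rewrite /M.
        by case: (U i); case: (d i); try exact: con_refl; apply: con_sym.
      apply: con_trans (con_sym mid); rewrite -[X in y _ X](ev_cst _ it).
      apply: con_ev => i; apply: con_ev => j; rewrite /M.
      by case: (U j); case: (d i); try exact: con_refl; apply: con_sym.
    apply: con_ev => i; rewrite -[X in z _ X](ev_cst _ it).
    apply: con_ev => j; rewrite /M.
    by case: (U j); case: (d i); case: (U i); try exact: con_refl; try exact: con_sym.
  apply: con_trans (row c) (con_trans (diag c) _).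
  apply: con_trans _ (con_sym (con_trans (row c') (diag c'))).
  apply: con_ev => j; rewrite /M; case: (U j) (cc j) => [_|/eqP ->]; last exact: con_refl.
  have xqs := con_trans xqr xrs.
  by case: (c j); case: (c' j); try exact: con_refl; first [exact: xqs | exact: con_sym].
have base (J : finType) (t : tm S J) (U : J -> bool) : idem V t ->
    x (ev (fun j => if U j then q else p) t) (ev (fun j => if U j then r else p) t).
  by move=> it; apply: con_ev => j; case: (U j) => //; exact: con_refl.
apply: (hind (I := fun b => x (ev bt b) p)) => [t t' _ _ /(_ B VB) tt'||
    J t U U' it UU'|J t U W it UW].
- by rewrite tt'.
- exact: con_refl.
all: rewrite !ev_tmap.
- move=> hU; apply: con_trans (base _ t U' it) _; rewrite -[X in x _ X](ev_cst p it).
  have := key J t U U' (fun=> false) it hU; apply=> j /=.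
  by case E: (U' j); [rewrite UU' | rewrite orbT].
- move=> hU hW; apply: con_trans (base _ t _ it) _.
  apply: con_trans (key J t U _ W it hU _) (con_trans (con_sym (base _ t W it)) hW).
  by move=> j; case: (U j) => //=.
Qed.

Section Pol.
Variable N : B -> Prop.

Definition closed : Prop := forall X (t : tm S X) (v : X -> B),
  idem V t -> (forall x, N (v x)) -> N (ev v t).

(** Constants come from [N] and terms are idempotent, so a polynomial has values in [N] as soon as
    its generators do, although [N] need not be a subalgebra. *)
Inductive pol (W : Type) (G : (W -> B) -> Prop) : (W -> B) -> Prop :=
| pol_gen g : G g -> pol G g
| pol_cst c : N c -> pol G (fun=> c)
| pol_app X (t : tm S X) (h : W -> X -> B) : idem V t ->
    (forall x, pol G (fun w => h w x)) -> pol G (fun w => ev (h w) t).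

Definition coord (J : Type) (g : (J -> B) -> B) : Prop := exists j, g = fun X => X j.

Definition coord2 (J K : Type) (g : (J -> B) * (K -> B) -> B) : Prop :=
  (exists j, g = fun p => p.1 j) \/ (exists k, g = fun p => p.2 k).

Definition proj (g : B * B -> B) : Prop :=
  g = (fun p => p.1) \/ g = (fun p => p.2).

Lemma pol_subst W W' (G : (W -> B) -> Prop) (G' : (W' -> B) -> Prop)
    (f : W' -> W) h : pol G h -> (forall g, G g -> pol G' (fun w => g (f w))) ->
  pol G' (fun w => h (f w)).
Proof.
move=> ph hG; elim: ph => [g /hG //|c Nc|X t k it _ IH]; first exact: pol_cst.
exact: (pol_app (h := fun w => k (f w)) it).
Qed.

Lemma pol_comp2 W (G : (W -> B) -> Prop) g a b :
  pol proj g -> pol G a -> pol G b -> pol G (fun w => g (a w, b w)).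
Proof.
move=> pg pa pb; apply: (pol_subst (f := fun w => (a w, b w)) pg) => k.
by case=> ->.
Qed.

Lemma pol_compJ W J (G : (W -> B) -> Prop) nu (Z : W -> J -> B) :
  pol (@coord J) nu -> (forall j, pol G (fun w => Z w j)) -> pol G (fun w => nu (Z w)).
Proof. by move=> pn hZ; apply: (pol_subst (f := Z) pn) => _ [j ->]. Qed.

Lemma pol_compJK W J K (G : (W -> B) -> Prop) h (X : W -> J -> B) (Y : W -> K -> B) :
  pol (@coord2 J K) h -> (forall j, pol G (fun w => X w j)) ->
  (forall j, pol G (fun w => Y w j)) -> pol G (fun w => h (X w, Y w)).
Proof.
by move=> pn hX hY; apply: (pol_subst (f := fun w => (X w, Y w)) pn) => g [] [j ->] /=.
Qed.

Lemma pol_1 J (j : J) : pol (@coord J) (fun X => X j).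
Proof. by apply: pol_gen; exists j. Qed.

Lemma pol_l J K (j : J) : pol (@coord2 J K) (fun X => X.1 j).
Proof. by apply: pol_gen; left; exists j. Qed.

Lemma pol_r J K (j : K) : pol (@coord2 J K) (fun X => X.2 j).
Proof. by apply: pol_gen; right; exists j. Qed.

Lemma pol_fst : pol proj (fun X => X.1).
Proof. by apply: pol_gen; left. Qed.

Lemma pol_snd : pol proj (fun X => X.2).
Proof. by apply: pol_gen; right. Qed.

Hypothesis clN : closed.

Lemma pol_in W (G : (W -> B) -> Prop) h w :
  pol G h -> (forall g, G g -> N (g w)) -> N (h w).
Proof.
move=> ph hG; elim: ph => [g /hG //|c //|X t k it _ IH]; exact: clN.
Qed.

Definition allN (J : Type) (X : J -> B) : Prop := forall j, N (X j).

Lemma pol_coord_in J (nu : (J -> B) -> B) Z : pol (@coord J) nu -> allN Z -> N (nu Z).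
Proof. by move=> pn NZ; apply: (pol_in pn) => _ [j ->]. Qed.

(** Weaker than the term condition [propTC]: the hypothesis is constancy along a whole row and a
    whole column through [(c, c')], instead of a single equality. *)
Definition propP : Prop := forall (J K : finType) (h : (J -> B) * (K -> B) -> B),
  pol (@coord2 J K) h -> forall c c' e, allN c -> allN c' ->
  (forall X, allN X -> h (X, c') = e) -> (forall X, allN X -> h (c, X) = e) ->
  forall X Y, allN X -> allN Y -> h (X, Y) = e.

Definition propTC : Prop := forall (J K : finType) (h : (J -> B) * (K -> B) -> B),
  pol (@coord2 J K) h -> forall a b c c', allN a -> allN b -> allN c -> allN c' ->
  h (a, c) = h (a, c') -> h (b, c) = h (b, c').

Definition T2 (g : B * B -> B) (e : B) : Prop :=
  pol proj g /\ forall X, N X -> g (X, X) = e.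

(* No polynomial that is constant on the diagonal separates [u] from [v]. *)
Definition appr (u v : B) : Prop := forall g e, T2 g e -> g (u, v) = e.

Definition good (J : Type) (w : B) (nu : (J -> B) -> B) : Prop :=
  pol (@coord J) nu /\ forall Z, allN Z -> appr (nu Z) w.

(** The point [Z0] anchors each parametrisation at [w], so different elements of the new set can be
    compared by way of [w]. *)
Definition shrink (w u : B) : Prop :=
  exists (J : finType) (nu : (J -> B) -> B) (Z0 Z1 : J -> B),
    [/\ good w nu, allN Z0, allN Z1, nu Z0 = w & nu Z1 = u].

Lemma T2_swap g e : T2 g e -> T2 (fun p => g (p.2, p.1)) e.
Proof.
by move=> [pg dg]; split; [exact: pol_comp2 pg pol_snd pol_fst | exact: dg].
Qed.

Lemma appr_refl u : N u -> appr u u.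
Proof. by move=> Nu g e [_]; apply. Qed.

Lemma shrink_sub w u : shrink w u -> N u.
Proof. by move=> [J [nu [Z0 [Z1 [[pn _] _ N1 _ <-]]]]]; apply: pol_coord_in. Qed.

End Pol.

Lemma pol_sub (M N : B -> Prop) W (G : (W -> B) -> Prop) h :
  (forall u, M u -> N u) -> pol M G h -> pol N G h.
Proof.
move=> MN; elim=> [g /pol_gen //|c /MN Nc|X t k it _ IH]; first exact: pol_cst.
exact: pol_app.
Qed.

Lemma TC_sub (M N : B -> Prop) : (forall u, M u -> N u) -> propTC N -> propTC M.
Proof.
move=> MN tc J K h ph a b c c' Ma Mb Mc Mc'.
by apply: (tc _ _ _ (pol_sub MN ph)) => j; apply: MN.
Qed.

Lemma TC_trivial (M : B -> Prop) : (forall u v, M u -> M v -> u = v) -> propTC M.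
Proof.
move=> M1 J K h ph a b c c' Ma Mb Mc Mc' _; congr (h (_, _)).
by apply/funext => k; apply: M1.
Qed.

Lemma useP N (PN : propP N) (J K : finType) (h : (J -> B) * (K -> B) -> B) c c' e X Y :
  pol N (@coord2 J K) h -> allN N c -> allN N c' ->
  (forall X, allN N X -> h (X, c') = e) -> (forall X, allN N X -> h (c, X) = e) ->
  allN N X -> allN N Y -> h (X, Y) = e.
Proof. by move=> ph Nc Nc' h1 h2; apply: PN ph _ _ _ Nc Nc' h1 h2 X Y. Qed.

(** * Passing to elements indistinguishable from a base point *)

Section Shrink.
Variables (N : B -> Prop) (clN : closed N) (PN : propP N).

Lemma P11 (h : B * B -> B) c c' e : pol N proj h -> N c -> N c' ->
  (forall x, N x -> h (x, c') = e) -> (forall x, N x -> h (c, x) = e) ->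
  forall x y, N x -> N y -> h (x, y) = e.
Proof.
move=> ph Nc Nc' h1 h2 x y Nx Ny.
apply: (useP PN (h := fun p : (unit -> B) * (unit -> B) => h (p.1 tt, p.2 tt))
  (c := fun=> c) (c' := fun=> c') (X := fun=> x) (Y := fun=> y)) => //.
- by apply: pol_comp2 ph _ _; [apply: pol_l | apply: pol_r].
- by move=> X NX; apply: h1.
- by move=> X NX; apply: h2.
Qed.

Section At.
Variables (w : B) (Nw : N w).

Lemma shrink_base : shrink N w w.
Proof.
exists unit, (fun=> w), (fun=> w), (fun=> w); split=> //; split; first exact: pol_cst.
by move=> _ _; apply: appr_refl.
Qed.

(** The parametrisations of the arguments are plugged into [t]. That all values still look like [w]
    is shown by releasing the arguments one at a time: (P) is applied with the new argument as one
    block and those already released as the other. *)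
Lemma shrink_closed : closed (shrink N w).
Proof.
move=> X0 t0 v0 it0 hv0; have [F [f [t et]]] := tm_fin t0; move: it0.
rewrite et ev_tmap idem_tmap => it; set v := fun i => v0 (f i).
have {hv0} hv i : shrink N w (v i) by apply: hv0.
pose J i := projT1 (cid (hv i)); have h1 i := cid (projT2 (cid (hv i))).
pose nu i : (J i -> B) -> B := projT1 (h1 i); have h2 i := cid (projT2 (h1 i)).
pose Z0 i : J i -> B := projT1 (h2 i); have h3 i := cid (projT2 (h2 i)).
pose Z1 i : J i -> B := projT1 (h3 i).
have hnu i : [/\ good N w (nu i), allN N (Z0 i), allN N (Z1 i), nu i (Z0 i) = w
  & nu i (Z1 i) = v i] := projT2 (h3 i).
pose K := {i : F & J i}.
pose re (Z : K -> B) i := fun j : J i => Z (Tagged J j).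
have pnu i W (G : (W -> B) -> Prop) (Z : W -> J i -> B) :
    (forall j, pol N G (fun w => Z w j)) -> pol N G (fun w => nu i (Z w)).
  by move=> hZ; apply: pol_compJ hZ; case: (hnu i) => -[].
have nuN i Z : allN N Z -> N (nu i Z).
  by move=> NZ; apply: pol_coord_in NZ => //; case: (hnu i) => -[].
have z0 i : nu i (Z0 i) = w by case: (hnu i).
have NZ0 i : allN N (Z0 i) by case: (hnu i).
have main (l : seq F) g e : T2 N g e -> forall Z : K -> B, allN N Z ->
    g (ev (fun i => if i \in l then nu i (re Z i) else w) t, w) = e.
  move=> [pg dg]; elim: l => [|i l IH] Z NZ.
    by rewrite (ev_cstE (a := w)) // dg.
  have [il|il] := boolP (i \in l).
    rewrite -[RHS](IH Z NZ); congr (g (ev _ t, w)); apply/funext => j.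
    by rewrite inE; case: eqP => // ->; rewrite il.
  pose h (p : (J i -> B) * (K -> B)) := g (ev (fun j => if j == i then nu i p.1 else
    if j \in l then nu j (re p.2 j) else w) t, w).
  have -> : g (ev (fun j => if j \in i :: l then nu j (re Z j) else w) t, w) =
      h (re Z i, Z).
    rewrite /h /=; congr (g (ev _ t, w)); apply/funext => j.
    by rewrite inE; case: eqP => // ->.
  apply: (useP PN (h := h) (c := Z0 i) (c' := fun k : K => Z0 (tag k) (tagged k))) => //.
  - apply: (pol_comp2 (a := fun p => ev _ t)) pg _ (pol_cst _ Nw).
    apply: pol_app => // j; case: (j == i); first by apply: pnu => k; apply: pol_l.
    case: (j \in l); last exact: pol_cst.
    by apply: pnu => k; apply: pol_r.
  - by move=> k; apply: NZ0.
  - move=> Y NY; rewrite /h /=.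
    pose u Y := ev (fun j : F => if j == i then Y else w) t.
    have -> : ev (fun j => if j == i then nu i Y else if j \in l then
        nu j (re (fun k : K => Z0 (tag k) (tagged k)) j) else w) t = u (nu i Y).
      rewrite /u; congr (ev _ t); apply/funext => j.
      by case: (j == i) => //; case: (j \in l) => //; exact: (z0 j).
    have uw : u w = w by apply: ev_cstE => // j; case: ifP.
    rewrite -{1}uw; have [[_ hi] _ _ _ _] := hnu i.
    apply: (hi _ NY (fun p => g (u p.1, u p.2)) e); split=> [|z Nz].
      by apply: pol_comp2 pg _ _; apply: pol_app => // j; case: (j == i);
        first [exact: pol_cst | exact: pol_fst | exact: pol_snd].
    by apply: dg; apply: clN => // j; case: (j == i).
  - move=> Y NY; rewrite /h /= z0 -[RHS](IH Y NY); congr (g (ev _ t, w)).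
    by apply/funext => j; case: eqP => // ->; rewrite (negbTE il).
  - by move=> k; apply: NZ.
exists K, (fun Z => ev (fun i => nu i (re Z i)) t),
  (fun k => Z0 (tag k) (tagged k)), (fun k => Z1 (tag k) (tagged k)); split.
- split=> [|Z NZ g e gT].
    by apply: pol_app => // i; apply: pnu => j; apply: pol_1.
  rewrite -[RHS](main (enum F) g e gT Z NZ); congr (g (ev _ t, w)).
  by apply/funext => i; rewrite mem_enum.
- by move=> k; apply: NZ0.
- by move=> k; case: (hnu (tag k)) => _ _ h _ _; apply: h.
- by apply: ev_cstE => // i; exact: (z0 i).
- by congr ev; apply/funext => i; case: (hnu i).
Qed.

(** Turns a tuple from the smaller set into the value of polynomials over [N] that also pass through
    the constant tuple [w]; property (P) of [N] can then be applied to the parameters. *)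
Lemma shrink_thread (J : finType) (X : J -> B) : (forall j, shrink N w (X j)) ->
  exists (K : finType) (ga : (K -> B) -> J -> B) (Z0 Z1 : K -> B),
  [/\ forall W (G : (W -> B) -> Prop) (Z : W -> K -> B),
        (forall k, pol N G (fun w => Z w k)) -> forall j, pol N G (fun w => ga (Z w) j),
      allN N Z0 /\ ga Z0 = (fun=> w), allN N Z1 /\ ga Z1 = X &
      forall Z, allN N Z -> forall j, shrink N w (ga Z j)].
Proof.
move=> hX; pose I i := projT1 (cid (hX i)); have h1 i := cid (projT2 (cid (hX i))).
pose nu i : (I i -> B) -> B := projT1 (h1 i); have h2 i := cid (projT2 (h1 i)).
pose Z0 i : I i -> B := projT1 (h2 i); have h3 i := cid (projT2 (h2 i)).
pose Z1 i : I i -> B := projT1 (h3 i).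
have hnu i : [/\ good N w (nu i), allN N (Z0 i), allN N (Z1 i), nu i (Z0 i) = w
  & nu i (Z1 i) = X i] := projT2 (h3 i).
pose K := {i : J & I i}.
exists K, (fun Z j => nu j (fun k => Z (Tagged I k))),
  (fun k => Z0 (tag k) (tagged k)), (fun k => Z1 (tag k) (tagged k)); split.
- move=> W G Z hZ j; have [[pn _] _ _ _ _] := hnu j.
  by apply: pol_compJ pn _ => k; apply: hZ.
- split; first by move=> k; case: (hnu (tag k)) => _ h _ _ _; apply: h.
  by apply/funext => j; case: (hnu j).
- split; first by move=> k; case: (hnu (tag k)) => _ _ h _ _; apply: h.
  by apply/funext => j; case: (hnu j).
- move=> Z NZ j; have [gj N0 _ e0 _] := hnu j.
  exists (I j), (nu j), (Z0 j), (fun k => Z (Tagged I k)); split=> // k; apply: NZ.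
Qed.

(** The parametrisations of [c], [c'], [X] and [Y] have only the constant tuples [w] in common. The
    two axes are therefore moved from [(c, c')] to [(w, w)], and from there constancy spreads to
    [(X, Y)]. *)
Lemma shrink_P : propP (shrink N w).
Proof.
move=> J K h ph c c' e Nc Nc' h1 h2.
have {}ph : pol N (@coord2 J K) h by apply: pol_sub ph => u; exact: shrink_sub.
have poly Ka Kb (ga : (Ka -> B) -> J -> B) (gb : (Kb -> B) -> K -> B) :
  (forall W (G : (W -> B) -> Prop) (Z : W -> Ka -> B),
    (forall k, pol N G (fun w => Z w k)) -> forall j, pol N G (fun w => ga (Z w) j)) ->
  (forall W (G : (W -> B) -> Prop) (Z : W -> Kb -> B),
    (forall k, pol N G (fun w => Z w k)) -> forall j, pol N G (fun w => gb (Z w) j)) ->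
  pol N (@coord2 Ka Kb) (fun p => h (ga p.1, gb p.2)).
  move=> pa pb; apply: pol_compJK ph _ _.
    by apply: pa => k; apply: pol_l.
  by apply: pb => k; apply: pol_r.
have [Ka [ga [A0 [A1 [pa [NA0 eA0] [NA1 eA1] sa]]]]] := shrink_thread Nc.
have [Kb [gb [B0 [B1 [pb [NB0 eB0] [NB1 eB1] sb]]]]] := shrink_thread Nc'.
have step1 Z : allN N Z -> h (ga Z, fun=> w) = e.
  move=> NZ; rewrite -eB0.
  apply: (useP PN (poly _ _ _ _ pa pb) NA1 NB1 _ _ NZ NB0) => Y NY /=.
    by rewrite eB1 h1 //; exact: sa.
  by rewrite eA1 h2 //; exact: sb.
have step2 Y : allN (shrink N w) Y -> h (fun=> w, Y) = e.
  move=> sY; have [Kd [gd [D0 [D1 [pd [ND0 eD0] [ND1 eD1] sd]]]]] := shrink_thread sY.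
  rewrite -eD1 -eA0.
  apply: (useP PN (poly _ _ _ _ pa pd) NA1 ND0 _ _ NA0 ND1) => Z NZ /=.
    by rewrite eD0 step1.
  by rewrite eA1 h2 //; exact: sd.
have step3 X : allN (shrink N w) X -> h (X, fun=> w) = e.
  move=> sX; have [Kd [gd [D0 [D1 [pd [ND0 eD0] [ND1 eD1] sd]]]]] := shrink_thread sX.
  rewrite -eD1 -eB0.
  apply: (useP PN (poly _ _ _ _ pd pb) ND0 NB1 _ _ ND1 NB0) => Z NZ /=.
    by rewrite eB1 h1 //; exact: sd.
  by rewrite eD0 step2 //; exact: sb.
move=> X Y sX sY.
have [Kd [gd [D0 [D1 [pd [ND0 eD0] [ND1 eD1] sd]]]]] := shrink_thread sX.
have [Kf [gf [F0 [F1 [pf [NF0 eF0] [NF1 eF1] sf]]]]] := shrink_thread sY.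
rewrite -eD1 -eF1.
apply: (useP PN (poly _ _ _ _ pd pf) ND0 NF0 _ _ ND1 NF1) => Z NZ /=.
  by rewrite eF0 step3 //; exact: sd.
by rewrite eD0 step2 //; exact: sf.
Qed.

(** With one of the two parametrisations held at [w], goodness of the other gives the value [e].
    These are the two axes for (P). *)
Lemma shrink_T2 g e a b : T2 N g e -> shrink N w a -> shrink N w b -> g (a, b) = e.
Proof.
move=> gT [J [nu [Z0 [Z1 [gd N0 N1 e0 <-]]]]] [K [mu [Y0 [Y1 [gd' N0' N1' e0' <-]]]]].
apply: (useP PN (h := fun p => g (nu p.1, mu p.2)) _ N0 N0' _ _ N1 N1').
- apply: pol_comp2; first by case: gT.
    by case: gd => pn _; apply: pol_compJ pn _ => j; apply: pol_l.
  by case: gd' => pn _; apply: pol_compJ pn _ => j; apply: pol_r.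
- by move=> Z NZ /=; rewrite e0'; apply: gd.2 NZ _ _ gT.
- by move=> Z NZ /=; rewrite e0; apply: gd'.2 NZ _ _ (T2_swap gT).
Qed.

End At.

Definition bt (x y : B) (U : bool) : B := if U then y else x.

(** The polynomial [g] separates the variables in [U'] from the rest of [U]. It is constant on the
    diagonal of [N], hence constant on pairs from the shrunken set, where the rest of [U] may be put
    back to [p]. *)
Lemma shift w (J : finType) (t : tm S J) (U U' : J -> bool) : N w -> idem V t ->
  (forall j, U' j -> U j) ->
  (forall p X, N p -> N X -> ev (bt p X) (tmap U t) = p) ->
  forall p X, shrink N w p -> shrink N w X -> ev (bt p X) (tmap U' t) = p.
Proof.
move=> Nw it UU' hU p X sp sX; have Np := shrink_sub clN sp.
pose g (u : B * B) := ev (fun j => if U j then (if U' j then u.1 else u.2) else p) t.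
have gT : T2 N g p.
  split=> [|Y NY].
    apply: pol_app => // j; case: (U j); last exact: pol_cst.
    by case: (U' j); [exact: pol_fst | exact: pol_snd].
  rewrite -[RHS](hU p Y Np NY) ev_tmap; congr ev; apply/funext => j.
  by rewrite /bt; case: (U j) => //; case: (U' j).
rewrite -[RHS](shrink_T2 gT sX sp) ev_tmap; congr ev; apply/funext => j.
by rewrite /bt /=; case E: (U' j); [rewrite UU' | case: (U j)].
Qed.

End Shrink.

(** Term induction on the property that a binary term returns its first argument at some stage.
    Subsets cost one more shrinking, by [shift]; unions hold at a common later stage, by (P); for
    the second projection the property says that the stage has at most one element. *)
Lemma no_infinite_shrinking (Nn : nat -> B -> Prop) (w : nat -> B) :
  (forall j, closed (Nn j)) -> (forall j, propP (Nn j)) -> (forall j, Nn j (w j)) ->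
  (forall j, Nn j.+1 = shrink (Nn j) (w j)) ->
  exists j, forall p X, Nn j p -> Nn j X -> p = X.
Proof.
move=> cl P Nw NS.
have dec i j u : Nn (i + j) u -> Nn j u.
  elim: i => // i IH; rewrite addSn NS => /(@shrink_sub _ (cl _)); exact: IH.
suff [j hj] : exists j, forall p X, Nn j p -> Nn j X -> ev (bt p X) (TVar true) = p.
  by exists j => p X Np NX; rewrite -[LHS](hj p X Np NX).
apply: (hind (I := fun b => exists j, forall p X, Nn j p -> Nn j X -> ev (bt p X) b = p)).
- by move=> t t' _ _ tt' [j hj]; exists j => p X Np NX; rewrite -tt' ?hj.
- by exists 0.
- move=> J t U U' it UU' [j hj]; exists j.+1; rewrite NS; exact: shift (hj).
- move=> J t U W it UW [i hi] [j hj]; exists (i + j) => p X Np NX.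
  have decl u : Nn (i + j) u -> Nn i u by rewrite addnC; apply: dec.
  rewrite ev_tmap /bt; pose h (u : B * B) :=
    ev (fun k => if U k then u.1 else if W k then u.2 else p) t.
  have hUW v v' : h (v, v') = ev (fun k => if U k then v else if W k then v' else p) t by [].
  have -> : ev (fun k => if U k || W k then X else p) t = h (X, X).
    by rewrite hUW; congr (ev _ t); apply/funext => k; case: (U k).
  apply: (P11 (P (i + j)) (c := p) (c' := p)) => //.
  - apply: pol_app => // k; case: (U k); first exact: pol_fst.
    by case: (W k); [exact: pol_snd | exact: pol_cst].
  - move=> v Nv; rewrite hUW -[RHS](hi p v) ?ev_tmap; [|exact: decl|exact: decl].
    by congr (ev _ t); apply/funext => k; rewrite /bt; case: (U k) => //; case: (W k).
  - move=> v Nv; rewrite hUW -[RHS](hj p v) ?ev_tmap; [|exact: dec Np|exact: dec Nv].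
    congr (ev _ t); apply/funext => k; rewrite /bt; move: (UW k).
    by case: (U k) => //=; case: (W k).
Qed.

(** * A Mal'cev term from property (P) *)

Definition three := option bool.
Definition tri (T : Type) (a b c : T) (i : three) : T :=
  match i with None => a | Some false => b | Some true => c end.
Definition q3 (q : tm S three) (a b c : B) : B := ev (tri a b c) q.
Definition vx : tm S three := TVar None.
Definition vy : tm S three := TVar (Some false).
Definition vz : tm S three := TVar (Some true).
Definition comp3 (q a b c : tm S three) : tm S three := tsub (tri a b c) q.

Lemma q3_comp q a b c x y z :
  q3 (comp3 q a b c) x y z = q3 q (q3 a x y z) (q3 b x y z) (q3 c x y z).
Proof. by rewrite /q3 ev_tsub; congr ev; apply/funext => -[[]|]. Qed.

Lemma idem_comp q a b c : idem V q -> idem V a -> idem V b -> idem V c ->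
  idem V (comp3 q a b c).
Proof. by move=> iq ia ib ic; apply: idem_tsub => // -[[]|]. Qed.

Lemma q3_cst q a : idem V q -> q3 q a a a = a.
Proof. by move=> iq; apply: ev_cstE => // -[[]|]. Qed.

Lemma pol_q3 N W (G : (W -> B) -> Prop) q a b c : idem V q ->
  pol N G a -> pol N G b -> pol N G c -> pol N G (fun w => q3 q (a w) (b w) (c w)).
Proof. by move=> iq pa pb pc; apply: pol_app => // -[[]|]. Qed.

Lemma closed_q3 N q a b c : closed N -> idem V q -> N a -> N b -> N c -> N (q3 q a b c).
Proof. by move=> cl iq Na Nb Nc; apply: cl => // -[[]|]. Qed.

Definition sel (J : Type) (t : tm S J) (U : J -> bool) (x y : B) : B :=
  ev (fun j => if U j then y else x) t.

Lemma sel_cst J (t : tm S J) U x : idem V t -> sel t U x x = x.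
Proof. by move=> it; apply: ev_cstE => // j; case: ifP. Qed.

(* Specialised to [b = TVar true] this says that [q] is a Mal'cev operation. *)
Definition connects (R : B -> B -> Prop) (q : tm S three) (b : B -> B -> B) x y z : Prop :=
  R (q3 q x y y) x /\ R (q3 q (b x y) y z) (b x z).

Ltac pt := repeat first [ exact: pol_fst | exact: pol_snd | exact: pol_l | exact: pol_r
  | exact: pol_1 | by apply: pol_cst | apply: pol_q3 => // ].

(** In a module where the variables in [U] have total coefficient [alpha], [connects] for [U]
    describes the operation [x + alpha (z - y)]. Expanding the present term there gives the same
    operation with the coefficient of [U']; a Mal'cev term is the case of coefficient 1. *)
Definition shrink_term (J : Type) (t : tm S J) (U U' : J -> bool) (p : tm S three) :=
  comp3 p (tmap (fun j => if U j then (if U' j then Some true else Some false) else None) t)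
    vy vx.

Lemma q3_shrink_term J (t : tm S J) U U' p x y z : q3 (shrink_term t U U' p) x y z =
  q3 p (ev (fun j => if U j then (if U' j then z else y) else x) t) y x.
Proof.
rewrite q3_comp /q3 ev_tmap; congr ev; apply/funext => -[[]|] //=.
by congr ev; apply/funext => j; case: (U j) => //; case: (U' j).
Qed.

Lemma idem_shrink_term J (t : tm S J) U U' p : idem V t -> idem V p ->
  idem V (shrink_term t U U' p).
Proof. by move=> it ip; apply: idem_comp => //; rewrite idem_tmap. Qed.

Lemma sel_in N J (t : tm S J) U x y : closed N -> idem V t -> N x -> N y -> N (sel t U x y).
Proof. by move=> cl it Nx Ny; apply: cl => // j; case: (U j). Qed.

Lemma pol_sel N W (G : (W -> B) -> Prop) J (t : tm S J) U a b : idem V t ->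
  pol N G a -> pol N G b -> pol N G (fun w => sel t U (a w) (b w)).
Proof. by move=> it pa pb; apply: pol_app => // j; case: (U j). Qed.

Lemma sel2_sub J (t : tm S J) (U U' : J -> bool) x z : (forall j, U' j -> U j) ->
  ev (fun j => if U j then (if U' j then z else x) else x) t = sel t U' x z.
Proof.
move=> UU'; congr (ev _ t); apply/funext => j; move: (UU' j).
by case: (U j); case: (U' j) => // /(_ isT).
Qed.

Lemma sel2_id J (t : tm S J) (U U' : J -> bool) x y :
  ev (fun j => if U j then (if U' j then y else y) else x) t = sel t U x y.
Proof. by congr (ev _ t); apply/funext => j; case: (U' j). Qed.

(** With first argument [y], [G] takes equal values at [c] and [c'], both computable from [hp]. The
    term condition carries the equality to first argument [x], where [c'] gives the wanted value. *)
Lemma exact_shrink M (J : finType) (t : tm S J) (U U' : J -> bool) p :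
  closed M -> propTC M -> idem V t -> idem V p -> (forall j, U' j -> U j) ->
  (forall x y z, M x -> M y -> M z -> connects eq p (sel t U) x y z) ->
  forall x y z, M x -> M y -> M z -> connects eq (shrink_term t U U' p) (sel t U') x y z.
Proof.
move=> cl tc it ip UU' hp x y z Mx My Mz.
have selM U0 u v : M u -> M v -> M (sel t U0 u v) by apply: sel_in.
have hfix v : M v -> q3 p (sel t U v y) y v = v.
  by move=> Mv; rewrite (hp v y v Mv My Mv).2 sel_cst.
rewrite /connects !q3_shrink_term sel2_id hfix //; split=> //.
pose th (u : (unit -> B) * (bool -> B)) := sel t U' (u.1 tt) (u.2 false).
pose G u := q3 p (ev (fun j => if U j then (if U' j then u.2 true else y) else th u) t)
  y (th u).
pose c b := if b then z else y; pose c' b := if b then y else z.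
have pth : pol M (@coord2 unit bool) th by apply: pol_sel => //; pt.
have pG : pol M (@coord2 unit bool) G.
  apply: pol_q3 => //; last by apply: pol_cst.
  by apply: pol_app => // j; case: (U j) => //; case: (U' j); pt.
have GE u : G u = q3 p (ev (fun j => if U j then (if U' j then u.2 true else y) else th u) t)
  y (th u) by [].
have Gc' v : M v -> G (fun=> v, c') = sel t U' v z.
  move=> Mv; rewrite GE /= sel2_id hfix //; exact: selM.
rewrite -[RHS](Gc' x Mx) -[LHS]/(G (fun=> x, c)).
apply: (tc _ _ G pG (fun=> y)) => //; try by case.
rewrite Gc' // GE /th /= sel_cst // sel2_sub // (hp _ y y _ My My).1 //; exact: selM.
Qed.

(** Without the term condition, the claim is verified only for [x = y] and for [z = y]; these are
    two axes, and (P) supplies the rest. *)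
Lemma appr_shrink N (J : finType) (t : tm S J) (U U' : J -> bool) p :
  closed N -> propP N -> idem V t -> idem V p -> (forall j, U' j -> U j) ->
  (forall x y z, N x -> N y -> N z -> connects (appr N) p (sel t U) x y z) ->
  forall x y z, N x -> N y -> N z ->
    connects (appr N) (shrink_term t U U' p) (sel t U') x y z.
Proof.
move=> cl PN it ip UU' hp.
have hfix x y : N x -> N y -> appr N (q3 p (sel t U x y) y x) x.
  by move=> Nx Ny; have := (hp x y x Nx Ny Nx).2; rewrite sel_cst.
move=> x y z Nx Ny Nz; rewrite /connects !q3_shrink_term sel2_id; split; first exact: hfix.
move=> g e gT; pose h (u : B * B) := g (q3 p (ev (fun j => if U j then
  (if U' j then u.2 else y) else sel t U' u.1 y) t) y (sel t U' u.1 y), sel t U' u.1 u.2).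
apply: (P11 PN (h := h) (c := y) (c' := y)) => //.
- apply: pol_comp2; [by case: gT | | by apply: pol_sel => //; pt].
  apply: pol_q3 => //; [|by apply: pol_cst|by apply: pol_sel => //; pt].
  apply: pol_app => // j; case: (U j); first by case: (U' j); pt.
  by apply: pol_sel => //; pt.
- move=> v Nv; rewrite /h /= sel2_id; apply: hfix gT => //; exact: sel_in.
- move=> v Nv; rewrite /h /= !sel_cst // sel2_sub //.
  by apply: (hp _ y y _ Ny Ny).1 gT; apply: sel_in.
Qed.

(** In the module picture the coefficients of the two sets are added. *)
Definition union_term (p1 p2 : tm S three) := comp3 p2 p1 vy vz.

Lemma q3_union_term p1 p2 x y z :
  q3 (union_term p1 p2) x y z = q3 p2 (q3 p1 x y z) y z.
Proof. exact: q3_comp. Qed.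

Lemma sel_or J (t : tm S J) (U W : J -> bool) x y :
  ev (fun j => if U j then y else if W j then y else x) t = sel t (fun j => U j || W j) x y.
Proof. by congr (ev _ t); apply/funext => j; case: (U j). Qed.

Lemma sel_orl J (t : tm S J) (U W : J -> bool) x y :
  ev (fun j => if U j then y else if W j then x else x) t = sel t U x y.
Proof. by congr (ev _ t); apply/funext => j; case: (W j). Qed.

Lemma sel_orr J (t : tm S J) (U W : J -> bool) x y : (forall j, ~~ (U j && W j)) ->
  ev (fun j => if U j then x else if W j then y else x) t = sel t W x y.
Proof.
move=> UW; congr (ev _ t); apply/funext => j; move: (UW j).
by case: (U j) => //=; case: (W j).
Qed.

Lemma exact_union M (J : finType) (t : tm S J) (U W : J -> bool) p1 p2 :
  closed M -> propTC M -> idem V t -> idem V p1 -> idem V p2 ->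
  (forall j, ~~ (U j && W j)) ->
  (forall x y z, M x -> M y -> M z -> connects eq p1 (sel t U) x y z) ->
  (forall x y z, M x -> M y -> M z -> connects eq p2 (sel t W) x y z) ->
  forall x y z, M x -> M y -> M z ->
    connects eq (union_term p1 p2) (sel t (fun j => U j || W j)) x y z.
Proof.
move=> cl tc it ip1 ip2 UW hp1 hp2 x y z Mx My Mz.
have selM U0 u v : M u -> M v -> M (sel t U0 u v) by apply: sel_in.
rewrite /connects !q3_union_term (hp1 x y y Mx My My).1 (hp2 x y y Mx My My).1.
split=> //.
have e1 : q3 p1 (sel t (fun j => U j || W j) x y) y z =
    q3 p1 (ev (fun j => if U j then z else if W j then y else x) t) z z.
  pose G (u : (unit -> B) * (bool -> B)) := q3 p1 (ev (fun j => if U j then u.2 false else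
    if W j then u.1 tt else x) t) (u.2 true) z.
  have pG : pol M (@coord2 unit bool) G.
    apply: pol_q3 => //; [|by pt|by pt]; apply: pol_app => // j.
    by case: (U j); [pt | case: (W j); pt].
  rewrite -sel_or; apply: (tc _ _ G pG (fun=> x) (fun=> y) (fun=> y) (fun=> z)) => //.
  by rewrite /G /= !sel_orl (hp1 x y z Mx My Mz).2 (hp1 _ z z _ Mz Mz).1 //; apply: selM.
rewrite e1 (hp1 _ z z _ Mz Mz).1; last first.
  by apply: cl => // j; case: (U j) => //; case: (W j).
pose G (u : (unit -> B) * (bool -> B)) := q3 p2 (ev (fun j => if U j then u.1 tt else
  if W j then u.2 false else x) t) (u.2 true) z.
have pG : pol M (@coord2 unit bool) G.
  apply: pol_q3 => //; [|by pt|by pt]; apply: pol_app => // j.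
  by case: (U j); [pt | case: (W j); pt].
have := tc _ _ G pG (fun=> x) (fun=> z) (fun=> y) (fun=> z).
rewrite /G /= !sel_orr // sel_or => -> //.
  by rewrite (hp2 _ z z _ Mz Mz).1 //; apply: selM.
by rewrite (hp2 x y z Mx My Mz).2 (hp2 _ z z _ Mz Mz).1 //; apply: selM.
Qed.

(** The pair [(y, z)] is doubled, one copy for [U] and one for [W]. Collapsing the copy of [W] to
    [x] leaves the claim for [p1], with the outer [p2] absorbed by [tilde]; collapsing the copy of
    [U] leaves [aux]. Then (P) applies. *)
Lemma appr_union N (J : finType) (t : tm S J) (U W : J -> bool) p1 p2 :
  closed N -> propP N -> idem V t -> idem V p1 -> idem V p2 ->
  (forall j, ~~ (U j && W j)) ->
  (forall x y z, N x -> N y -> N z -> connects (appr N) p1 (sel t U) x y z) ->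
  (forall x y z, N x -> N y -> N z -> connects (appr N) p2 (sel t W) x y z) ->
  forall x y z, N x -> N y -> N z ->
    connects (appr N) (union_term p1 p2) (sel t (fun j => U j || W j)) x y z.
Proof.
move=> cl PN it ip1 ip2 UW hp1 hp2 x y z Nx Ny Nz.
have selN U0 u v : N u -> N v -> N (sel t U0 u v) by apply: sel_in.
have tilde g e v : T2 N g e -> N v -> T2 N (fun u => g (q3 p2 u.1 v v, u.2)) e.
  move=> gT Nv; split=> [|u Nu]; last by apply: (hp2 _ _ _ Nu Nv Nv).1 gT.
  by apply: pol_comp2; [case: gT | pt | pt].
rewrite /connects !q3_union_term; split=> g e gT.
  by apply: (hp1 _ _ _ Nx Ny Ny).1 (tilde _ _ _ gT Ny).
have aux v : N v -> forall u u', N u -> N u' ->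
    g (q3 p2 (q3 p1 (sel t W u v) u u) v u', sel t W u u') = e.
  move=> Nv; apply: (P11 PN (h := fun u => g (q3 p2 (q3 p1 (sel t W u.1 v) u.1 u.1) v u.2,
    sel t W u.1 u.2)) (c := v) (c' := v)) => //= [|u Nu|u Nu].
  - apply: pol_comp2; [by case: gT | | by apply: pol_sel => //; pt].
    apply: pol_q3 => //; pt; by apply: pol_sel => //; pt.
  - by apply: (hp1 _ _ _ _ Nu Nu).1 (tilde _ _ _ gT Nv); apply: selN.
  - rewrite sel_cst // q3_cst // -{1}(sel_cst W v it).
    by apply: (hp2 _ _ _ Nv Nv Nu).2 gT.
pose h (u : (bool -> B) * (bool -> B)) := g (q3 p2 (q3 p1 (ev (fun j => if U j then
   u.1 false else if W j then u.2 false else x) t) (u.1 false) (u.1 true))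
   (u.2 false) (u.2 true),
  ev (fun j => if U j then u.1 true else if W j then u.2 true else x) t).
pose c b := if b then z else y.
have -> : g (q3 p2 (q3 p1 (sel t (fun j => U j || W j) x y) y z) y z,
    sel t (fun j => U j || W j) x z) = h (c, c) by rewrite /h /= !sel_or.
apply: (useP PN (h := h) (c := fun=> x) (c' := fun=> x)) => //; try by case.
- have pe b : pol N (@coord2 bool bool) (fun u => ev (fun j => if U j then u.1 b else
      if W j then u.2 b else x) t).
    by apply: pol_app => // j; case: (U j); [pt | case: (W j); pt].
  apply: pol_comp2; [by case: gT | | exact: pe].
  by apply: pol_q3 => //; pt; apply: pe.
- move=> v Nv; rewrite /h /= !sel_orl.
  by apply: (hp1 x (v false) (v true) Nx (Nv _) (Nv _)).2 (tilde _ _ _ gT Nx).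
- by move=> v Nv; rewrite /h /= !sel_orr //; apply: aux.
Qed.

Lemma sel_bt J (t : tm S J) U : (fun x y => ev (bt x y) (tmap U t)) = sel t U.
Proof. by apply/funext => x; apply/funext => y; rewrite ev_tmap. Qed.

Definition malcev_on (N : B -> Prop) (m : tm S three) : Prop :=
  idem V m /\ forall x y, N x -> N y -> q3 m x y y = x /\ q3 m x x y = y.

Section Malcev.
Variables (N : B -> Prop) (cl : closed N) (PN : propP N).

(** In group notation [k] is the mixed difference [h(X, Y) - h(X, c') - h(a, Y) + h(a, c') + w]. It
    equals [w] on both axes, hence everywhere by (P); at [(b, c)] the hypothesis reduces it to
    [h(b, c)]. *)
Lemma malcev_TC m : malcev_on N m -> propTC N.
Proof.
move=> [im hm] J K h ph a b c c' Na Nb Nc Nc' hac.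
have Nh X Y : allN N X -> allN N Y -> N (h (X, Y)).
  by move=> NX NY; apply: (pol_in cl ph) => _ [] [j ->] /=.
pose w := h (b, c').
pose k u := q3 m (q3 m (h u) (h (u.1, c')) w) (q3 m (h (a, u.2)) (h (a, c')) w) w.
have Nw : N w by apply: Nh.
have : k (b, c) = w.
  apply: (useP PN (h := k) (c := a) (c' := c')) => // [|X NX|X NX].
  - have p1 : pol N (@coord2 J K) (fun u => h (u.1, c')).
      by apply: pol_compJK ph _ _ => j; [apply: pol_l | apply: pol_cst].
    have p2 : pol N (@coord2 J K) (fun u => h (a, u.2)).
      by apply: pol_compJK ph _ _ => j; [apply: pol_cst | apply: pol_r].
    have Nac : N (h (a, c')) by apply: Nh.
    by pt.
  - by rewrite /k /= !(hm _ w _ Nw).2 ?q3_cst //; apply: Nh.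
  - rewrite /k /= (hm _ w _ Nw).2 //; apply: closed_q3 => //; exact: Nh.
rewrite /k /= hac (hm (h (a, c')) w _ Nw).2; last exact: Nh.
have Nbc : N (h (b, c)) by apply: Nh.
by rewrite -/w !(hm _ w Nbc Nw).1.
Qed.

(** One term induction proves both statements for the same [d], exactly on the shrunken sets and
    approximately on [N], starting from the first projection. *)
Lemma approximate_malcev : (forall w, N w -> propTC (shrink N w)) -> exists d,
  [/\ idem V d,
    forall w x y z, N w -> shrink N w x -> shrink N w y -> shrink N w z ->
      connects eq d (fun _ y => y) x y z &
    forall x y z, N x -> N y -> N z -> connects (appr N) d (fun _ y => y) x y z].
Proof.
move=> tc; apply: (hind (I := fun b => exists d, [/\ idem V d,
    forall w x y z, N w -> shrink N w x -> shrink N w y -> shrink N w z ->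
      connects eq d (fun x y => ev (bt x y) b) x y z &
    forall x y z, N x -> N y -> N z ->
      connects (appr N) d (fun x y => ev (bt x y) b) x y z])).
- move=> t t' _ _ tt' [d hd]; exists d.
  have <- : (fun x y => ev (bt x y) t) = (fun x y => ev (bt x y) t') => //.
  by apply/funext => x; apply/funext => y; apply: tt'.
- by exists vx; split=> // x y z Nx Ny Nz; split; apply: appr_refl.
- move=> J t U U' it UU' [d []]; rewrite !sel_bt => id_ h1 h2.
  exists (shrink_term t U U' d); split; first exact: idem_shrink_term.
    move=> w x y z Nw; apply: exact_shrink => //; [exact: shrink_closed | exact: tc|].
    by move=> *; apply: (h1 w).
  exact: appr_shrink.
- move=> J t U W it UW [d1 []]; rewrite !sel_bt => id1 h1 h1' [d2 []].
  move=> id2 h2 h2'.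
  exists (union_term d1 d2); split; first exact: idem_comp.
    move=> w x y z Nw; apply: exact_union => //; [exact: shrink_closed | exact: tc| |].
      by move=> *; apply: (h1 w).
    by move=> *; apply: (h2 w).
  exact: appr_union.
Qed.


(** * From an approximate to an exact Mal'cev term *)

Section Correction.
Hypothesis tc : forall w, N w -> propTC (shrink N w).
Variable d : tm S three.
Hypothesis id_ : idem V d.
Hypothesis exact_d : forall w x y z, N w -> shrink N w x -> shrink N w y ->
  shrink N w z -> connects eq d (fun _ y => y) x y z.
Hypothesis appr_d : forall x y z, N x -> N y -> N z ->
  connects (appr N) d (fun _ y => y) x y z.

Local Notation D := (q3 d).
(** If [d] were [x - y + z], so would be [p]. The gain is that [D x z z] lies in the set shrunk at
    [x], where [d] is exact, so [P x z z] is exactly [x]. *)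
Let p := comp3 d d (comp3 d vx vz vz) vx.
Local Notation P := (q3 p).

Let PE x y z : P x y z = D (D x y z) (D x z z) x.
Proof. by rewrite /p !q3_comp. Qed.

Let ip : idem V p.
Proof. by do !apply: idem_comp => //. Qed.

Let ND x y z : N x -> N y -> N z -> N (D x y z).
Proof. exact: closed_q3. Qed.

Let shD w x y z : N w -> shrink N w x -> shrink N w y -> shrink N w z ->
  shrink N w (D x y z).
Proof. by move=> Nw; apply: closed_q3 => //; apply: shrink_closed. Qed.

Let Dr w x y : N w -> shrink N w x -> shrink N w y -> D x y y = x.
Proof. by move=> Nw sx sy; apply: (exact_d Nw sx sy sy).1. Qed.

Let Dl w x y : N w -> shrink N w x -> shrink N w y -> D x x y = y.
Proof. by move=> Nw sx sy; apply: (exact_d Nw sx sx sy).2. Qed.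

Let A_in x z : N x -> N z -> shrink N x (D x z z).
Proof.
move=> Nx Nz; exists unit, (fun Z => D x (Z tt) (Z tt)), (fun=> x), (fun=> z).
split=> //; last exact: q3_cst.
split=> [|Z NZ]; first by pt.
exact: (appr_d Nx (NZ tt) (NZ tt)).1.
Qed.

Let P_right x z : N x -> N z -> P x z z = x.
Proof.
by move=> Nx Nz; rewrite PE (Dl Nx) //; [apply: A_in | apply: shrink_base].
Qed.

Let star b y z : N b -> N y -> N z -> appr N (D b (D y z z) y) b.
Proof.
move=> Nb Ny Nz g e gT; have sy := shrink_base Ny.
apply: (P11 PN (h := fun u => g (D u.1 (D y u.2 u.2) y, u.1)) (c := y) (c' := y)) => //=.
- by apply: pol_comp2; [case: gT | pt | pt].
- move=> u Nu; rewrite (q3_cst y id_); exact: (appr_d Nu Ny Ny).1.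
- move=> u Nu; apply: (shrink_T2 PN gT _ sy).
  by apply: shD => //; apply: A_in.
Qed.

Let P_in y z : N y -> N z -> shrink N z (P y y z).
Proof.
move=> Ny Nz; exists unit, (fun Z => P (Z tt) (Z tt) z), (fun=> z), (fun=> y).
split=> //; last exact: q3_cst.
split=> [|Z NZ]; first by pt.
move: (Z tt) (NZ tt) => {NZ Ny y Z} y Ny g e gT; rewrite PE.
apply: ((appr_d Ny Ny Nz).2 (fun u => g (D u.1 (D y z z) y, u.2)) e).
split=> [|u Nu]; last exact: star gT.
by apply: pol_comp2; [case: gT | pt; apply: ND | pt].
Qed.

Let P_left_in z u : N z -> shrink N z u -> P z z u = u.
Proof.
move=> Nz su; have sz := shrink_base Nz.
by rewrite PE (Dl Nz sz su) (Dr Nz sz su) (Dr Nz su sz).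
Qed.

Let P_in_in y z u : N y -> N z -> shrink N z u -> shrink N z (P y y u).
Proof.
move=> Ny Nz [J [nu [Z0 [Z1 [[pn gn] N0 N1 e0 <-]]]]].
exists (option J), (fun Z => P (Z None) (Z None) (nu (fun j => Z (Some j)))),
  (fun i => if i is Some j then Z0 j else z), (fun i => if i is Some j then Z1 j else y).
have NS Z : allN N Z -> allN N (fun j : J => Z (Some j)) by move=> NZ j; apply: NZ.
split=> //; try by case.
- split=> [|Z NZ g e gT].
    by pt; apply: pol_compJ pn _ => j; pt.
  apply: (useP PN (h := fun u : (unit -> B) * (J -> B) =>
    g (P (u.1 tt) (u.1 tt) (nu u.2), z)) (c := fun=> z) (c' := Z0)
    (X := fun=> Z None) (Y := fun j => Z (Some j))) => //=.
  + apply: pol_comp2; [by case: gT | | by pt].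
    by pt; apply: pol_compJ pn _ => j; pt.
  + move=> X NX; rewrite e0; apply: shrink_T2 gT _ (shrink_base Nz) => //.
    exact: P_in.
  + move=> X NX; rewrite P_left_in //; first exact: gn gT.
    by exists J, nu, Z0, X.
- by rewrite [nu _]e0; apply: q3_cst.
Qed.

(** On the set shrunk at [z] this says that [u] goes to [P y y u] by the translation [P y y z - z].
    It is checked for [y = z] and for [u = z], and (P) extends it. *)
Let P_cancel y z u : N y -> N z -> shrink N z u -> D (D (P y y u) (P y y z) z) u z = z.
Proof.
move=> Ny Nz [J [nu [Z0 [Z1 [[pn gn] N0 N1 e0 <-]]]]]; have sz := shrink_base Nz.
apply: (useP PN (h := fun u : (unit -> B) * (J -> B) =>
  D (D (P (u.1 tt) (u.1 tt) (nu u.2)) (P (u.1 tt) (u.1 tt) z) z) (nu u.2) z)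
  (c := fun=> z) (c' := Z0) (X := fun=> y)) => //=.
- by pt; apply: pol_compJ pn _ => j; pt.
- by move=> X NX; rewrite e0 (Dl Nz _ sz) ?q3_cst //; apply: P_in.
- move=> X NX; have sX : shrink N z (nu X) by exists J, nu, Z0, X.
  by rewrite P_left_in // q3_cst // (Dr Nz sX sz) (Dl Nz sX sz).
Qed.

(** A translation is undone by precompensation: [u] stands for [z - a + z]. The term condition on
    the set shrunk at [z] cancels [a] and [u] from the equality given by [P_cancel]. *)
Let P_fix y z : N y -> N z -> P y y (D z (P y y z) z) = z.
Proof.
move=> Ny Nz; have sz := shrink_base Nz; set a := P y y z.
have sa : shrink N z a by apply: P_in.
set u := D z a z; have su : shrink N z u by apply: shD.
have sr : shrink N z (P y y u) by apply: P_in_in.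
pose G (v : (bool -> B) * (unit -> B)) := D (D (v.2 tt) (v.1 false) z) (v.1 true) z.
have pG : pol (shrink N z) (@coord2 bool unit) G by rewrite /G; pt.
have := tc Nz pG (a := fun b => if b then u else a) (b := fun=> z)
  (c := fun=> P y y u) (c' := fun=> z).
rewrite /G /= P_cancel // -/u (Dl Nz su sz) !(Dr Nz _ sz) //; apply=> //; by case.
Qed.

Lemma corrected_malcev : malcev_on N (comp3 p vx vy (comp3 d vz (comp3 p vy vy vz) vz)).
Proof.
split; first by do !apply: idem_comp => //.
have eE x y z : q3 (comp3 p vx vy (comp3 d vz (comp3 p vy vy vz) vz)) x y z =
    P x y (D z (P y y z) z).
  by rewrite q3_comp [X in q3 p _ _ X]q3_comp [X in q3 d _ X _]q3_comp.
move=> x y Nx Ny; rewrite !eE; split; last exact: P_fix.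
by rewrite (q3_cst y ip) (q3_cst y id_); exact: P_right.
Qed.

End Correction.
End Malcev.

(** If every shrinking of a set satisfied the term condition, the set would have an exact Mal'cev
    term and satisfy it too. So a failure is inherited by some shrinking, and iterating this
    contradicts [no_infinite_shrinking]. *)
Theorem P_TC N : closed N -> propP N -> propTC N.
Proof.
move=> cl PN; apply: contrapT => ntc.
pose T := {M : B -> Prop | [/\ closed M, propP M & ~ propTC M]}.
have step (M : T) : exists M'w : T * B, sval M M'w.2 /\ sval M'w.1 = shrink (sval M) M'w.2.
  case: M => M [cM PM nM] /=; apply: contrapT => h; apply: nM.
  have tcs w : M w -> propTC (shrink M w).
    move=> Mw; apply: contrapT => nt; apply: h.
    have cS : closed (shrink M w) by exact: shrink_closed.
    have PS : propP (shrink M w) by exact: shrink_P.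
    by exists (exist _ (shrink M w) (And3 cS PS nt), w).
  have [d [id_ ed ad]] := approximate_malcev cM PM tcs.
  exact: malcev_TC (corrected_malcev cM PM tcs id_ ed ad).
have [f hf] := choice step.
pose M0 : T := exist _ N (And3 cl PN ntc).
pose Nn j := iter j (fun M => (f M).1) M0.
have [j hj] := @no_infinite_shrinking (fun j => sval (Nn j)) (fun j => (f (Nn j)).2)
  (fun j => let: And3 c _ _ := proj2_sig (Nn j) in c)
  (fun j => let: And3 _ c _ := proj2_sig (Nn j) in c)
  (fun j => (hf (Nn j)).1) (fun j => (hf (Nn j)).2).
have [_ _] := proj2_sig (Nn j); apply; exact: TC_trivial.
Qed.

Theorem P_malcev N : closed N -> propP N -> exists m, malcev_on N m.
Proof.
move=> cl PN.
have tcs w : N w -> propTC (shrink N w).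
  by move=> Nw; apply: TC_sub (P_TC cl PN) => u; apply: shrink_sub.
have [d [id_ ed ad]] := approximate_malcev cl PN tcs.
by eexists; apply: corrected_malcev ed ad.
Qed.

End Core.

(** * Sources of property (P) *)

Lemma jn_ind_r T (R Q : T -> T -> Prop) (P : T -> Prop) a c :
  P a -> (forall b b', P b -> R b b' -> P b') -> (forall b b', P b -> Q b b' -> P b') ->
  jn R Q a c -> P c.
Proof.
move=> Pa hR hQ ac; elim: ac Pa => {a c} // a b c ab _ IH Pa; apply: IH.
  exact: hR ab.
exact: hQ ab.
Qed.

Lemma jn_restrict T (R Q : T -> T -> Prop) (P : T -> Prop) a c :
  P a -> (forall b b', P b -> R b b' -> P b') -> (forall b b', P b -> Q b b' -> P b') ->
  jn R Q a c -> jn (fun b b' => R b b' /\ P b') (fun b b' => Q b b' /\ P b') a c.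
Proof.
move=> Pa hR hQ ac.
have h1 b b' : P b -> R b b' -> P b' /\ (R b b' /\ P b').
  by move=> Pb bb; have Pb' := hR _ _ Pb bb.
have h2 b b' : P b -> Q b b' -> P b' /\ (Q b b' /\ P b').
  by move=> Pb bb; have Pb' := hQ _ _ Pb bb.
by have [_] := @jn_map _ _ R Q (fun b b' => R b b' /\ P b') (fun b b' => Q b b' /\ P b')
  P id h1 h2 a c Pa ac.
Qed.

Section Sources.
Variables (S : signature) (V : algebra S -> Prop).
Hypothesis hV : variety V.
Hypothesis hind : term_induction V.

Lemma pol_con (A : algebra S) (th : congruence A) (N : A -> Prop) W (G : (W -> A) -> Prop)
    h w w' : pol V N G h -> (forall g, G g -> th (g w) (g w')) -> th (h w) (h w').
Proof.
move=> ph hG; elim: ph => [g /hG //|c _|X t k _ _ IH]; first exact: con_refl.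
exact: con_ev.
Qed.

Lemma pol2_con (A : algebra S) (th : congruence A) (N : A -> Prop) J K h
    (X X' : J -> A) (Y Y' : K -> A) : pol V N (@coord2 S A J K) h ->
  ptw th X X' -> ptw th Y Y' -> th (h (X, Y)) (h (X', Y')).
Proof. by move=> ph XX YY; apply: (pol_con ph) => _ [] [j ->] /=. Qed.

Definition modP (A : algebra S) (de : congruence A) (M : A -> Prop) : Prop :=
  forall (J K : finType) h, pol V M (@coord2 S A J K) h ->
  forall c c' e, allN M c -> allN M c' ->
  (forall X, allN M X -> de (h (X, c')) e) -> (forall Y, allN M Y -> de (h (c, Y)) e) ->
  forall X Y, allN M X -> allN M Y -> de (h (X, Y)) e.

Section QuotientP.
Variables (A : algebra S) (de : congruence A) (M : A -> Prop).

Definition image_set (c : quot de) : Prop := exists2 b, M b & c = qcl de b.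

Lemma image_choice J (X : J -> quot de) : allN image_set X ->
  exists2 X' : J -> A, allN M X' & X = fun j => qcl de (X' j).
Proof.
move=> hX; have hX' j : exists b, M b /\ X j = qcl de b by case: (hX j) => b; exists b.
by have [X' h] := choice hX'; exists X'; [move=> j; case: (h j) |
  apply/funext => j; case: (h j)].
Qed.

Lemma closed_image : closed V M -> closed V image_set.
Proof.
move=> cl X t v it hv; have [v' Mv' ->] := image_choice hv.
by exists (ev v' t); [apply: cl | rewrite ev_quot].
Qed.

Lemma pol_lift J K (h : (J -> quot de) * (K -> quot de) -> quot de) :
  pol V image_set (@coord2 S (quot de) J K) h ->
  exists2 h', pol V M (@coord2 S A J K) h' &
    forall X Y, h (fun j => qcl de (X j), fun k => qcl de (Y k)) = qcl de (h' (X, Y)).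
Proof.
elim=> [g [] [j ->]|c [b Mb ->]|X t k it _ IH].
- by exists (fun p => p.1 j) => //; apply: pol_l.
- by exists (fun p => p.2 j) => //; apply: pol_r.
- by exists (fun=> b) => //; apply: pol_cst.
- have IH' x : exists h', pol V M (@coord2 S A J K) h' /\
      forall X Y, k (fun j => qcl de (X j), fun k => qcl de (Y k)) x = qcl de (h' (X, Y)).
    by case: (IH x) => h' ? ?; exists h'.
  have [h' hh] := choice IH'.
  exists (fun w => ev (fun x => h' x w) t); first by apply: pol_app => // x; case: (hh x).
  move=> Y Z; rewrite -ev_quot; congr ev; apply/funext => x.
  by case: (hh x) => _ ->.
Qed.

Lemma quot_P : modP de M -> propP V image_set.
Proof.
move=> hM J K h /pol_lift [h' ph hh] c c' e.
move=> /image_choice [c1 Mc1 ->] /image_choice [c1' Mc1' ->] h1 h2 X Y.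
move=> /image_choice [X1 MX1 ->] /image_choice [Y1 MY1 ->].
rewrite hh -(qrepK e); apply/qclE; apply: (hM _ _ _ ph c1 c1') => // Z MZ; apply/qclE.
  by rewrite qrepK -hh h1 // => j; exists (Z j).
by rewrite qrepK -hh h2 // => j; exists (Z j).
Qed.

End QuotientP.

(* The square lemma fills a grid of values [h (X, Y)] from its two axes. *)
Lemma grid (A : algebra S) (x y z : congruence A) (N : A -> Prop) (J K : Type)
    (h : (J -> A) * (K -> A) -> A) (c : J -> A) (c' : K -> A) e
    (R : (J -> A) -> Prop) (Q : (K -> A) -> Prop) : V A ->
  (forall a b, y a b -> z a b -> x a b) -> pol V N (@coord2 S A J K) h ->
  (forall X, R X -> x (h (X, c')) e) -> (forall Y, Q Y -> x (h (c, Y)) e) ->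
  R c -> Q c' -> forall X Y,
  jn (fun b b' => ptw x b b' /\ R b') (fun b b' => ptw y b b' /\ R b') c X ->
  jn (fun b b' => ptw x b b' /\ Q b') (fun b b' => ptw z b b' /\ Q b') c' Y ->
  x (h (X, Y)) e.
Proof.
move=> VA yzx ph h1 h2 Rc Qc' X Y cX cY; move: X cX.
apply: (jn_ind_r (P := fun Y => forall X, jn (fun b b' => ptw x b b' /\ R b')
  (fun b b' => ptw y b b' /\ R b') c X -> x (h (X, Y)) e)) cY => [X cX|U W hU [UW _] X cX|
  U W hU [UW QW] X cX].
- by apply/h1; apply: (jn_ind_r (P := R) Rc _ _ cX) => b b' _ [].
- apply: con_trans (hU X cX); apply: con_sym; apply: (pol2_con ph) => // j.
  exact: con_refl.
have [] : x (h (X, W)) e /\ jn (fun b b' => ptw x b b' /\ R b')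
    (fun b b' => ptw y b b' /\ R b') c X; last by [].
apply: (jn_ind_r (P := fun X => x (h (X, W)) e /\ jn (fun b b' => ptw x b b' /\ R b')
    (fun b b' => ptw y b b' /\ R b') c X) _ _ _ cX).
- by split; [apply: h2 | apply: jn_refl].
- move=> b b' [hb cb] [bb' Rb']; split; last exact: jn_trans cb (jn_l _ _).
  apply: con_trans hb; apply: con_sym; apply: (pol2_con ph) => // j; exact: con_refl.
move=> b b' [hb cb] [bb' Rb']; have cb' := jn_trans cb (jn_r _ (conj bb' Rb')).
split; first last.
  exact: cb'.
apply: con_trans (hU b' cb'); apply: con_sym.
apply: (@square_lemma _ _ hind A VA x y z (h (b', W)) (h (b', U)) (h (b, W)) (h (b, U))).
- exact: yzx.
- by apply: (pol2_con ph) => j; [exact: con_refl | apply: con_sym].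
- by apply: (pol2_con ph) => j; [exact: con_refl | apply: con_sym].
- by apply: (pol2_con ph) => j; [apply: con_sym | exact: con_refl].
- by apply: (pol2_con ph) => j; [apply: con_sym | exact: con_refl].
- exact: con_trans (hU b' cb') (con_sym hb).
- exact: con_trans hb (con_sym (hU b cb)).
Qed.

(** Even the term condition holds modulo the meet of [x] and [y]: two tuples of the block are joined
    by [y]- and [z]-steps, and since [y] and [z] agree inside [x], a step of either kind preserves
    the congruence between [h (b, d)] and [h (b, d')]. *)
Lemma meet_source (A : algebra S) (x y z : congruence A) (a : A) : V A ->
  (forall u v, x u v -> y u v <-> z u v) ->
  modP (con_meet x y) (con_meet x (con_join y z) a).
Proof.
move=> VA xyz J K h ph c c' e Mc Mc' h1 h2 X Y MX MY.
suff tc b b' d d' : allN (con_meet x (con_join y z) a) b ->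
    allN (con_meet x (con_join y z) a) b' ->
    allN (con_meet x (con_join y z) a) d -> allN (con_meet x (con_join y z) a) d' ->
    con_meet x y (h (b, d)) (h (b, d')) -> con_meet x y (h (b', d)) (h (b', d')).
  apply: con_trans (h1 X MX); apply: (tc c X) => //.
  by apply: con_trans (h2 _ MY) (con_sym (h2 _ Mc')).
move=> Mb Mb' Md Md'.
have dd' : ptw (con_meet x (con_join y z)) d d'.
  by move=> k; apply: con_trans (con_sym (Md k)) (Md' k).
have bb' : jn (ptw y) (ptw z) b b'.
  apply: jn_tuple => [u|u|j]; try exact: con_refl.
  apply/con_joinE; have [_] := Mb j; have [_] := Mb' j.
  by move=> h3 h4; apply: con_trans (con_sym h4) h3.
have xd u : x (h (u, d)) (h (u, d')).
  by apply: (pol2_con ph) => // j; [exact: con_refl | case: (dd' j)].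
move=> hb; apply: (jn_ind_r (P := fun b => con_meet x y (h (b, d)) (h (b, d'))) hb _ _ bb').
  move=> u v [_ hu] uv; split=> //.
  apply: con_trans (con_trans hu _); last first.
    by apply: (pol2_con ph) => // j; exact: con_refl.
  by apply: (pol2_con ph) => // j; [apply: con_sym | exact: con_refl].
move=> u v [/xyz hx hu] uv; split=> //; apply/xyz => //.
have hz : z (h (u, d)) (h (u, d')) by apply/xyz.
apply: con_trans (con_trans hz _); last first.
  by apply: (pol2_con ph) => // j; exact: con_refl.
by apply: (pol2_con ph) => // j; [apply: con_sym | exact: con_refl].
Qed.

(** Inside a [th]-block, tuples are reached from [c] by steps of [x] and [y], and from [c'] by steps
    of [x] and [z]. The grid argument then applies. *)
Lemma join_source (A : algebra S) (x y z th : congruence A) (a : A) : V A ->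
  (forall u v, y u v -> z u v -> x u v) ->
  (forall u v, th u v <-> jn x y u v) -> (forall u v, th u v <-> jn x z u v) ->
  modP x (th a).
Proof.
move=> VA yzx thy thz J K h ph c c' e Mc Mc' h1 h2 X Y MX MY.
have xth u v : x u v -> th u v by move=> ?; apply/thy/jn_l.
have yth u v : y u v -> th u v by move=> ?; apply/thy/jn_r.
have zth u v : z u v -> th u v by move=> ?; apply/thz/jn_r.
apply: (grid VA yzx ph h1 h2 Mc Mc').
  apply: jn_restrict => // [b b' Mb bb' j|b b' Mb bb' j|].
  - exact: con_trans (Mb j) (xth _ _ (bb' j)).
  - exact: con_trans (Mb j) (yth _ _ (bb' j)).
  - apply: jn_tuple => [u|u|j]; try exact: con_refl.
    by apply/thy; apply: con_trans (con_sym (Mc j)) (MX j).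
apply: jn_restrict => // [b b' Mb bb' j|b b' Mb bb' j|].
- exact: con_trans (Mb j) (xth _ _ (bb' j)).
- exact: con_trans (Mb j) (zth _ _ (bb' j)).
- apply: jn_tuple => [u|u|j]; try exact: con_refl.
  by apply/thz; apply: con_trans (con_sym (Mc' j)) (MY j).
Qed.

Lemma con_block_closed (A : algebra S) (th : congruence A) (a : A) : V A ->
  closed V (th a).
Proof.
move=> VA X t v it hv; rewrite -[a in th a _](it A VA a); exact: con_ev.
Qed.

Lemma nontrivial_source (A : algebra S) (de th : congruence A) a b : V A ->
  modP de (th a) -> th a b -> ~ de a b ->
  exists (B : algebra S) (N : B -> Prop), [/\ V B, closed V N, propP V N &
    exists u v, [/\ N u, N v & u <> v]].
Proof.
move=> VA hP ab nab; exists (quot de), (image_set (de := de) (th a)); split.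
- exact: variety_quot.
- exact/closed_image/con_block_closed.
- exact: quot_P.
- exists (qcl de a), (qcl de b); split.
  + by exists a => //; apply: con_refl.
  + by exists b.
  + by move/qclE.
Qed.

Lemma not_semidistributive_source (A : algebra S) : V A ->
  ~ semidistributive (congruence A : latticeType con_display) ->
  exists (B : algebra S) (N : B -> Prop), [/\ V B, closed V N, propP V N &
    exists u v, [/\ N u, N v & u <> v]].
Proof.
move=> VA /not_andP [] /existsNP [x /existsNP [y /existsNP [z /not_implyP [e ne]]]].
  have xyz u v : x u v -> y u v <-> z u v.
    have le (w w' : congruence A) : (con_meet x w = con_meet x w') -> x u v -> w u v -> w' u v.
      move=> ww' xu wu; have : con_meet x w u v by [].
      by rewrite ww' => -[].
    by move=> xu; split; apply: le.
  have [a /existsNP [b /not_implyP [ab nab]]] : exists a, ~ forall b,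
      con_meet x (con_join y z) a b -> con_meet x y a b.
    apply: contrapT => /forallNP h; apply: ne; apply: congruence_eq => u v.
    split; last by move/(contrapT (h u)).
    by move=> [xu yu]; split=> //; apply/con_joinE/jn_l.
  exact: nontrivial_source (meet_source VA xyz) ab nab.
(* Enlarging [x] in this way puts the meet of [y] and [z] below it, as the grid requires, and leaves
   its joins with [y] and with [z] unchanged. *)
pose x1 := con_join x (con_meet y z).
have yz u v : y u v -> z u v -> x1 u v by move=> yu zu; apply/con_joinE/jn_r.
have xx1 u v : x u v -> x1 u v by move=> xu; apply/con_joinE/jn_l.
have x1y u v : con_join x y u v <-> jn x1 y u v.
  rewrite con_joinE; split; first exact: jn_sub.
  move=> h; apply/con_joinE => ps hx hy; move: h => /con_joinE; apply=> // a b.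
  by move=> h0; apply: h0 => // p q [/hy].
have x1z u v : con_join x y u v <-> jn x1 z u v.
  have -> : con_join x y = con_join x z by exact: e.
  rewrite con_joinE; split; first exact: jn_sub.
  move=> h; apply/con_joinE => ps hx hy; move: h => /con_joinE; apply=> // a b.
  by move=> h0; apply: h0 => // p q [_ /hy].
have [a /existsNP [b /not_implyP [ab nab]]] : exists a, ~ forall b,
    con_join x y a b -> x1 a b.
  apply: contrapT => /forallNP h; apply: ne; apply: congruence_eq => u v.
  split; first by move/(contrapT (h u)).
  by move=> h'; apply/x1y/jn_l.
exact: nontrivial_source (join_source VA yz x1y x1z) ab nab.
Qed.

End Sources.

(** * The abelian group carried by a set with property (P) *)

(** Additivity is asked of idempotent terms because they are the ones that preserve [N] and fix its
    chosen zero. *)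
Record linear_action (S : signature) (V : algebra S -> Prop) (D : zmodType) := LinearAction {
  tact :> forall Y : Type, tm S Y -> (Y -> D) -> D;
  tact_var : forall Y (y : Y) u, tact (TVar y) u = u y;
  tact_veq : forall Y (t t' : tm S Y) u, idem V t -> idem V t' -> veq V t t' ->
    tact t u = tact t' u;
  tact_map : forall X Y (f : X -> Y) t u, tact (tmap f t) u = tact t (fun x => u (f x));
  tact_add : forall Y (t : tm S Y) u w, idem V t ->
    tact t (fun y => u y + w y)%R = (tact t u + tact t w)%R
}.

Section Group.
Variables (S : signature) (V : algebra S -> Prop) (B : algebra S) (VB : V B).
Variables (N : B -> Prop) (cl : closed V N) (PN : propP V N).
Variables (m : tm S three) (mN : malcev_on V N m).
Local Notation M := (q3 m).
Let im : idem V m := mN.1.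

Let Mr x y : N x -> N y -> M x y y = x.
Proof. by move=> Nx Ny; case: (mN.2 x y Nx Ny). Qed.

Let Ml x y : N x -> N y -> M x x y = y.
Proof. by move=> Nx Ny; case: (mN.2 x y Nx Ny). Qed.

Let MN x y z : N x -> N y -> N z -> N (M x y z).
Proof. by move=> Nx Ny Nz; apply: (closed_q3 cl im). Qed.

(** The auxiliary [k] compares the two sides and equals [e0] when [x = y] or [z = y], since there
    both inner Mal'cev expressions collapse. By (P) it is [e0] at [(x, z)]. *)
Lemma malcev_commute X (t : tm S X) (x y z : X -> B) : idem V t ->
  allN N x -> allN N y -> allN N z ->
  ev (fun i => M (x i) (y i) (z i)) t = M (ev x t) (ev y t) (ev z t).
Proof.
have [J [f [t' ->]]] := tm_fin t; rewrite idem_tmap !ev_tmap => {t} it Nx Ny Nz.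
set x' := fun j => x (f j); set y' := fun j => y (f j); set z' := fun j => z (f j).
have {}Nx : allN N x' by move=> j; apply: Nx.
have {}Ny : allN N y' by move=> j; apply: Ny.
have {}Nz : allN N z' by move=> j; apply: Nz.
have Nev v : allN N v -> N (ev v t') by apply: cl.
pose e0 := M (ev x' t') (ev y' t') (ev z' t'); rewrite -/e0.
pose k (u : (J -> B) * (J -> B)) :=
  M (ev (fun j => M (u.1 j) (y' j) (u.2 j)) t') (M (ev u.1 t') (ev y' t') (ev u.2 t')) e0.
have Ne0 : N e0 by apply: MN; apply: Nev.
have : k (x', z') = e0.
  apply: (useP PN (h := k) (c := y') (c' := y')) => // [|X' NX|X' NX].
  - have p1 : pol V N (@coord2 S B J J) (fun u => ev u.1 t').
      by apply: pol_app => // j; apply: pol_l.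
    have py : pol V N (@coord2 S B J J) (fun=> ev y' t') by apply/pol_cst/Nev.
    have p2 : pol V N (@coord2 S B J J) (fun u => ev u.2 t').
      by apply: pol_app => // j; apply: pol_r.
    apply: pol_q3 => //; [|exact: pol_q3 | exact: pol_cst].
    by apply: pol_app => // j; apply: pol_q3 => //; [exact: pol_l | exact: pol_cst | exact: pol_r].
  - rewrite /k /= (Mr (Nev _ NX) (Nev _ Ny)).
    have -> : (fun j => M (X' j) (y' j) (y' j)) = X'.
      by apply/funext => j; apply: Mr.
    by apply: Ml => //; apply: Nev.
  - rewrite /k /= (Ml (Nev _ Ny) (Nev _ NX)).
    have -> : (fun j => M (y' j) (y' j) (X' j)) = X'.
      by apply/funext => j; apply: Ml.
    by apply: Ml => //; apply: Nev.
rewrite /k /= -/e0 Mr //; apply: cl => // j; exact: MN.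
Qed.

(** Associativity, commutativity and inverses all follow from this identity on suitable 3 by 3
    arrays filled up with [o]. *)
Lemma malcev_commute3 a b c a' b' c' a'' b'' c'' :
  N a -> N b -> N c -> N a' -> N b' -> N c' -> N a'' -> N b'' -> N c'' ->
  M (M a b c) (M a' b' c') (M a'' b'' c'') = M (M a a' a'') (M b b' b'') (M c c' c'').
Proof.
move=> Na Nb Nc Na' Nb' Nc' Na'' Nb'' Nc''.
rewrite -(@malcev_commute _ m (tri a a' a'') (tri b b' b'') (tri c c' c'')) //;
  try by move=> [[]|].
by congr ev; apply/funext => -[[]|].
Qed.

Variables (o : B) (No : N o).

Let T := {b : B | N b}.

Let T_eq (a b : T) : sval a = sval b -> a = b.
Proof.
case: a b => a Na [b Nb] /= e; move: Nb; rewrite -e => Nb.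
by congr exist; apply: Prop_irrelevance.
Qed.

Let add (a b : T) : T := exist _ (M (sval a) o (sval b)) (MN (svalP a) No (svalP b)).
Let opp (a : T) : T := exist _ (M o (sval a) o) (MN No (svalP a) No).
Let zero : T := exist _ o No.

Let addA : associative add.
Proof.
move=> a b c; have [Na Nb Nc] := And3 (svalP a) (svalP b) (svalP c); apply: T_eq => /=.
have := malcev_commute3 Na No No No No No Nb No Nc.
by rewrite (Mr Na No) (Mr No No) (Ml No Nc).
Qed.

Let addC : commutative add.
Proof.
move=> a b; have [Na Nb] := conj (svalP a) (svalP b); apply: T_eq => /=.
have := malcev_commute3 No No Na No No No Nb No No.
by rewrite (Ml No Na) (Mr Nb No) (Ml No Nb) (Mr Na No) (Mr No No).
Qed.

Let add0 : left_id zero add.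
Proof. by move=> a; apply: T_eq => /=; apply: Ml => //; apply: svalP. Qed.

Let addN : left_inverse zero opp add.
Proof.
move=> a; have Na := svalP a; apply: T_eq => /=.
have := malcev_commute3 No Na No No No No No No Na.
by rewrite (Ml No Na) (Mr No No) (Mr Na No) (Mr No Na).
Qed.

Lemma linear_action_exists (b : B) : N b -> b <> o ->
  exists (D : zmodType) (la : linear_action V D), exists d : D, (d <> 0)%R.
Proof.
move=> Nb bo.
pose cT : choiceType := HB.pack_for choiceType T (gen_eqMixin T) (gen_choiceMixin T).
pose D : zmodType := HB.pack_for zmodType cT
  (GRing.isZmodule.Build cT addA addC add0 addN).
have Nv Y (u : Y -> T) : allN N (fun y => sval (u y)) by move=> y; apply: svalP.
pose act Y (t : tm S Y) (u : Y -> D) : D :=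
  if pselect (idem V t) is left it then
    exist N (ev (fun y => sval (u y)) t) (cl it (Nv Y u)) else zero.
have actE Y (t : tm S Y) (u : Y -> D) : idem V t ->
    sval (act Y t u) = ev (fun y => sval (u y)) t.
  by rewrite /act; case: pselect.
have h1 Y (y : Y) u : act Y (TVar y) u = u y by apply: T_eq; rewrite actE.
have h2 Y (t t' : tm S Y) u : idem V t -> idem V t' -> veq V t t' -> act Y t u = act Y t' u.
  by move=> it it' tt'; apply: T_eq; rewrite !actE ?tt'.
have h3 X Y (f : X -> Y) t u : act Y (tmap f t) u = act X t (fun x => u (f x)).
  have [it|nit] := pselect (idem V t).
    by apply: T_eq; rewrite !actE ?idem_tmap // ev_tmap.
  by rewrite /act; case: pselect => [/idem_tmap //|_]; case: pselect.
have h4 Y (t : tm S Y) u w : idem V t ->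
    act Y t (fun y => u y + w y)%R = (act Y t u + act Y t w)%R.
  move=> it; apply: T_eq; rewrite actE //.
  rewrite [RHS](_ : _ = M (sval (act Y t u)) o (sval (act Y t w))) // !actE //.
  rewrite -{1}(it B VB o) -malcev_commute //; exact: Nv.
exists D, (LinearAction h1 h2 h3 h4), (exist N b Nb : T) => e.
by apply: bo; have : sval (exist N b Nb : T) = sval zero by rewrite e.
Qed.

End Group.

(** * Identities of the congruence lattices *)

Definition evt (P : nat -> Prop) : Prop := exists k0, forall k, k0 <= k -> P k.

Lemma evt_imp (P Q : nat -> Prop) : (forall k, P k -> Q k) -> evt P -> evt Q.
Proof. by move=> PQ [k0 h]; exists k0 => k /h /PQ. Qed.

Lemma evt_and (P Q : nat -> Prop) : evt P -> evt Q -> evt (fun k => P k /\ Q k).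
Proof.
move=> [k0 h] [k1 h1]; exists (maxn k0 k1) => k; rewrite geq_max => /andP[? ?].
by split; [apply: h | apply: h1].
Qed.

Lemma evt_all (P : nat -> Prop) : (forall k, P k) -> evt P.
Proof. by move=> h; exists 0. Qed.

Lemma evt_fin (J : finType) (P : J -> nat -> Prop) :
  (forall j, evt (P j)) -> evt (fun k => forall j, P j k).
Proof.
move=> h; have [|k0 hk] := @fin_bound J (fun j n => forall k, n <= k -> P j k) _ h.
  by move=> j m n mn hm k nk; apply: hm; apply: leq_trans nk.
by exists k0 => k k0k j; apply: hk k0k.
Qed.

(** * Sequences of algebras with a decreasing chain of congruences *)

Section Limit.
Variables (S : signature) (V : algebra S -> Prop).
Hypothesis hV : variety V.
Hypothesis hind : term_induction V.
Variables (A : nat -> algebra S) (VA : forall k, V (A k)).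
Variables (s : forall k, A k) (th : nat -> forall k, congruence (A k)).
Hypothesis th_dec : forall i k u v, th i.+1 k u v -> th i k u v.

Let th_le i j k u v : i <= j -> th j k u v -> th i k u v.
Proof.
by move=> /subnK <-; elim: (j - i) => // n IH; rewrite addSn => /th_dec.
Qed.

(** The intersection over [i] of the blocks of [evt_con (th i)]. The later inclusions lose one
    level, putting [th i.+1] below joins at level [i], and only the intersection of all levels
    absorbs this loss. *)
Definition thread (u : prod_alg A) : Prop := forall i, evt (fun k => th i k (s k) (u k)).

Lemma thread_closed : closed V thread.
Proof.
move=> X t v it hv i; have [J [f [t' et]]] := tm_fin t; move: it; rewrite et idem_tmap.
move=> it; apply: (@evt_imp (fun k => forall j, th i k (s k) (v (f j) k))).
  move=> k h; rewrite ev_tmap ev_prod -[s k](it (A k) (VA k)); exact: con_ev.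
by apply: evt_fin => j; apply: hv.
Qed.

(* A failure of uniformity at every level could be diagonalised into a single
   tuple of threads. *)
Lemma thread_uniform (J : finType) (Phi : forall k, (J -> A k) -> Prop) :
  (forall X : J -> prod_alg A, (forall j, thread (X j)) ->
     evt (fun k => Phi k (fun j => X j k))) ->
  exists i, evt (fun k => forall Z : J -> A k, (forall j, th i k (s k) (Z j)) -> Phi k Z).
Proof.
move=> h; apply: contrapT => /forallNP nh.
pose bad i k (Z : J -> A k) := (forall j, th i k (s k) (Z j)) /\ ~ Phi k Z.
have hb i k0 : exists k, k0 <= k /\ exists Z, bad i k Z.
  apply: contrapT => /forallNP nk; apply: (nh i); exists k0 => k kk Z hZ.
  by apply: contrapT => nP; apply: (nk k); split=> //; exists Z.
have [g hg] := choice (fun p : nat * nat => hb p.1 p.2).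
pose ka := fix ka i := if i is i'.+1 then g (i, (ka i').+1) else g (0, 0).
have kaS i : ka i < ka i.+1 by case: (hg (i.+1, (ka i).+1)).
have kam i j : i < j -> ka i < ka j.
  elim: j => // j IH; rewrite ltnS leq_eqVlt => /orP[/eqP -> //|/IH ij].
  exact: ltn_trans (kaS j).
have kab i : exists Z, bad i (ka i) Z.
  by case: i => [|i]; [case: (hg (0, 0)) | case: (hg (i.+1, (ka i).+1))].
pose P k (Z : J -> A k) := exists2 i, ka i = k & bad i k Z.
pose X0 k : J -> A k :=
  if pselect (exists Z, P k Z) is left e then projT1 (cid e) else fun=> s k.
have hX0 k : P k (X0 k) \/ X0 k = (fun=> s k) /\ ~ exists Z, P k Z.
  by rewrite /X0; case: pselect => [e|ne]; [left; case: cid | right].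
have kai i : i <= ka i by elim: i => // i IH; apply: leq_ltn_trans IH (kaS i).
have [j|k0 hk0] := h (fun j k => X0 k j).
  move=> i; exists (ka i) => k ik; have [[i' ei [hZ _]]|[-> _]] := hX0 k; last exact: con_refl.
  apply: th_le (hZ j); rewrite leqNgt; apply/negP => /kam; rewrite ei.
  by rewrite ltnNge ik.
have [Z hZ] := kab k0.
have [[i' ei [_ nP]]|[_ []]] := hX0 (ka k0); last by exists Z, k0.
by apply: nP; apply: hk0; exact: kai.
Qed.

Definition evt_con (x : forall k, congruence (A k)) : congruence (prod_alg A).
Proof.
exists (fun u v : prod_alg A => evt (fun k => x k (u k) (v k))).
- by move=> u; apply: evt_all => k; apply: con_refl.
- by move=> u v; apply: evt_imp => k; apply: con_sym.
- move=> u v w uv vw; apply: evt_imp (evt_and uv vw) => k [].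
  exact: con_trans.
- move=> f u w uw; apply: evt_imp (evt_fin uw) => k h; exact: con_op.
Defined.

Lemma pol_prod (M : prod_alg A -> Prop) J K h k : pol V M (@coord2 S (prod_alg A) J K) h ->
  exists hk, pol V (fun=> True) (@coord2 S (A k) J K) hk /\
    forall X Y, h (X, Y) k = hk (fun j => X j k, fun j => Y j k).
Proof.
elim=> [g [] [j ->]|c _|X t f it _ IH].
- by exists (fun p => p.1 j); split=> //; apply: pol_l.
- by exists (fun p => p.2 j); split=> //; apply: pol_r.
- by exists (fun=> c k); split=> //; apply: pol_cst.
- have [g hg] := choice IH.
  exists (fun p => ev (fun x => g x p) t); split.
    by apply: pol_app => // x; case: (hg x).
  move=> Y Z; rewrite ev_prod; congr ev; apply/funext => x.
  by case: (hg x).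
Qed.

(** The limit form of [join_source]. Uniformity makes both axes constant on whole [th i]-blocks from
    some index on; the tuples lie in level [i.+1], so the chains that join them stay in level
    [i]. *)
Lemma limit_modP (x y z : forall k, congruence (A k))
    (lx ly lz : nat -> forall k, congruence (A k)) :
  (forall k u v, y k u v -> z k u v -> x k u v) ->
  (forall i k u v, lx i k u v -> x k u v /\ th i k u v) ->
  (forall i k u v, ly i k u v -> y k u v /\ th i k u v) ->
  (forall i k u v, lz i k u v -> z k u v /\ th i k u v) ->
  (forall i k u v, th i.+1 k u v -> jn (lx i k) (ly i k) u v) ->
  (forall i k u v, th i.+1 k u v -> jn (lx i k) (lz i k) u v) ->
  modP V (evt_con x) thread.
Proof.
move=> yzx hlx hly hlz hy hz J K h ph c c' e Mc Mc' h1 h2 X Y MX MY.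
pose hk k := projT1 (cid (pol_prod k ph)).
have [phk hkE] : (forall k, pol V (fun=> True) (@coord2 S (A k) J K) (hk k)) /\
    forall X Y k, h (X, Y) k = hk k (fun j => X j k, fun j => Y j k).
  by split=> [k|X' Y' k]; case: (projT2 (cid (pol_prod k ph))).
have [|i1 e1] := @thread_uniform J (fun k Z => x k (hk k (Z, fun j => c' j k)) (e k)).
  move=> Z hZ; have := h1 Z hZ; apply: evt_imp => k; by rewrite hkE.
have [|i2 e2] := @thread_uniform K (fun k Z => x k (hk k (fun j => c j k, Z)) (e k)).
  move=> Z hZ; have := h2 Z hZ; apply: evt_imp => k; by rewrite hkE.
pose i := maxn i1 i2.
have tup (I : finType) (T : I -> prod_alg A) : allN thread T ->
    evt (fun k => forall j, th i.+1 k (s k) (T j k)).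
  by move=> hT; apply: evt_fin => j; apply: hT.
have := evt_and (evt_and e1 e2) (evt_and (evt_and (tup _ _ Mc) (tup _ _ Mc'))
  (evt_and (tup _ _ MX) (tup _ _ MY))).
apply: evt_imp => k [[{}e1 {}e2] [[hc hc'] [hX hY]]]; rewrite hkE.
have xle u v : lx i k u v -> x k u v by move=> /hlx[].
have xth u v : lx i k u v -> th i k u v by move=> /hlx[].
pose R I (Z : I -> A k) := forall j, th i k (s k) (Z j).
have path (I : finType) (ll : nat -> forall k, congruence (A k)) (l : forall k, congruence (A k))
    (Z W : I -> A k) :
    (forall i k u v, ll i k u v -> l k u v /\ th i k u v) ->
    (forall i k u v, th i.+1 k u v -> jn (lx i k) (ll i k) u v) ->
    (forall j, th i.+1 k (s k) (Z j)) -> (forall j, th i.+1 k (s k) (W j)) ->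
    jn (fun b b' => ptw (x k) b b' /\ R I b') (fun b b' => ptw (l k) b b' /\ R I b') Z W.
  move=> hll hj sZ sW.
  have RZ : R I Z by move=> j; apply/th_dec/sZ.
  apply: (@jn_sub _ (fun b b' => ptw (lx i k) b b' /\ R I b')
                    (fun b b' => ptw (ll i k) b b' /\ R I b')).
  - by move=> u v [uv Rv]; split=> // j; apply/xle/uv.
  - by move=> u v [uv Rv]; split=> // j; case: (hll _ _ _ _ (uv j)).
  apply: jn_restrict => //.
  - by move=> u v Ru uv j; apply: con_trans (Ru j) (xth _ _ (uv j)).
  - by move=> u v Ru uv j; case: (hll _ _ _ _ (uv j)) => _; apply: con_trans (Ru j).
  apply: jn_tuple => [u|u|j]; try exact: con_refl.
  by apply: hj; apply: con_trans (con_sym (sZ j)) (sW j).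
apply: (grid hind (VA k) (@yzx k) (phk k) (R := R J) (Q := R K) _ _ _ _
  (path J ly y _ _ hly hy hc hX) (path K lz z _ _ hlz hz hc' hY)).
- by move=> Z hZ; apply: e1 => j; apply: th_le (hZ j); rewrite leq_maxl.
- by move=> Z hZ; apply: e2 => j; apply: th_le (hZ j); rewrite leq_maxr.
- by move=> j; apply/th_dec/hc.
- by move=> j; apply/th_dec/hc'.
Qed.

Lemma limit_malcev (x : forall k, congruence (A k)) : modP V (evt_con x) thread ->
  exists m i, idem V m /\ evt (fun k => forall u v, th i k (s k) u -> th i k (s k) v ->
    x k (q3 m u v v) u /\ x k (q3 m u u v) v).
Proof.
move=> hP; have VB : V (prod_alg A) by apply: variety_prod.
have cl := closed_image (de := evt_con x) thread_closed.
have [m [im hm]] := P_malcev hind (variety_quot hV (evt_con x) VB) cl (quot_P hP).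
have [|i hi] := @thread_uniform bool (fun k Z =>
  x k (q3 m (Z false) (Z true) (Z true)) (Z false) /\
  x k (q3 m (Z false) (Z false) (Z true)) (Z true)); last first.
  exists m, i; split=> //; apply: evt_imp hi => k h u v su sv.
  by have [|h1 h2] := h (fun b => if b then v else u); first by case.
move=> X hX; have hX' b : image_set (de := evt_con x) thread (qcl (evt_con x) (X b)).
  by exists (X b).
have q3q (a b c : prod_alg A) : @q3 S (quot (evt_con x)) m (qcl (evt_con x) a) (qcl (evt_con x) b)
    (qcl (evt_con x) c) = qcl (evt_con x) (q3 m a b c).
  by rewrite /q3 -ev_quot; congr ev; apply/funext => -[[]|].
have q3k (a b c : prod_alg A) k : q3 m a b c k = q3 m (a k) (b k) (c k).
  by rewrite /q3 ev_prod; congr ev; apply/funext => -[[]|].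
have := hm _ _ (hX' false) (hX' true); rewrite !q3q => -[/qclE h1 /qclE h2].
by apply: evt_imp (evt_and h1 h2) => k; rewrite !q3k.
Qed.

(** A Mal'cev term modulo both [x1] and [x2] makes the two kinds of steps permute. Along a chain
    from [s k] to [t k] a midpoint [w] is maintained; an [la]-step from [e] to [e'] replaces it by
    [m(w, e, e')], which is [x1]-related to [w] and [x2]-related to [e']. *)
Lemma limit_decomposition (x1 x2 y z : forall k, congruence (A k))
    (la lb lc : nat -> forall k, congruence (A k)) (t : forall k, A k) :
  modP V (evt_con x1) thread -> modP V (evt_con x2) thread ->
  (forall i k u v, la i k u v -> x1 k u v /\ th i k u v) ->
  (forall i k u v, lb i k u v -> x2 k u v /\ th i k u v) ->
  (forall i k u v, th i.+1 k u v -> jn (la i k) (lb i k) u v) ->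
  (forall k, th k k (s k) (t k)) ->
  evt (fun k => exists w, x1 k (s k) w /\ x2 k w (t k)).
Proof.
move=> P1 P2 hla hlb hab st.
have P12 : modP V (evt_con (fun k => con_meet (x1 k) (x2 k))) thread.
  move=> J K h ph c c' e Mc Mc' h1 h2 X Y MX MY; apply: evt_and.
    apply: (P1 J K h ph c c' e Mc Mc') => // Z MZ.
      by apply: evt_imp (h1 Z MZ) => k [].
    by apply: evt_imp (h2 Z MZ) => k [].
  apply: (P2 J K h ph c c' e Mc Mc') => // Z MZ.
    by apply: evt_imp (h1 Z MZ) => k [].
  by apply: evt_imp (h2 Z MZ) => k [].
have [m [i [im hm]]] := limit_malcev P12.
have ik : evt (fun k => i < k) by exists i.+1.
apply: evt_imp (evt_and hm ik) => k [{}hm {}ik].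
have : jn (la i k) (lb i k) (s k) (t k) by apply: hab; apply: th_le (st k).
pose P e := th i k (s k) e /\ exists w, [/\ th i k (s k) w, x1 k (s k) w & x2 k w e].
move=> h; suff [_ [w [_ sw wt]]] : P (t k) by exists w.
apply: (jn_ind_r (P := P)) h => [|e e' [se [w [sw1 sw we]]] ee'|e e' [se [w [sw1 sw we]]] ee'].
- by split; [exact: con_refl | exists (s k); split; exact: con_refl].
- have [xe te] := hla _ _ _ _ ee'; have se' := con_trans se te.
  split=> //; exists (q3 m w e e').
  have [h1 _] := hm w e sw1 se; have [_ h2] := hm e e' se se'.
  split.
  + rewrite -[s k](ev_cst (VA k) (s k) im); apply: con_ev => -[[]|] //.
  + apply: con_trans sw (con_trans (con_sym h1.1) _).
    by apply: con_ev => -[[]|] //=; exact: con_refl.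
  + apply: con_trans _ h2.2.
    by apply: con_ev => -[[]|] //=; exact: con_refl.
- have [xe te] := hlb _ _ _ _ ee'; split; first exact: con_trans se te.
  by exists w; split=> //; apply: con_trans we xe.
Qed.

End Limit.

(* Iterating [a := a /\ (b \/ c)] and its symmetric versions; at each level the
   join of the three terms is below every pairwise join of the previous level. *)
Definition refine (t : lattice_term * lattice_term * lattice_term) :=
  let: (a, b, c) := t in
  (LMeet a (LJoin b c), LMeet b (LJoin a c), LMeet c (LJoin a b)).

Definition level (j i : nat) :=
  iter i refine (LVar (3 * j), LVar (3 * j + 1), LVar (3 * j + 2)).

Definition top3 (t : lattice_term * lattice_term * lattice_term) :=
  let: (a, b, c) := t in LJoin a (LJoin b c).

Definition pairs3 (t : lattice_term * lattice_term * lattice_term) :=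
  let: (a, b, c) := t in LJoin (LMeet a b) (LJoin (LMeet a c) (LMeet b c)).

(** Adding the pairwise meets puts [b /\ c] below [bar1] and [a /\ c] below [bar2], the hypothesis
    on [y], [z] and [x] in [limit_modP]. *)
Definition bar1 j := LJoin (LVar (3 * j)) (pairs3 (level j 0)).
Definition bar2 j := LJoin (LVar (3 * j + 1)) (pairs3 (level j 0)).

Fixpoint bigmeet (f : nat -> lattice_term) n :=
  if n is n'.+1 then LMeet (bigmeet f n') (f n) else f 0.

Fixpoint bigjoin (f : nat -> lattice_term) n :=
  if n is n'.+1 then LJoin (bigjoin f n') (f n) else f 0.

Definition link i j := LMeet (LJoin (bar1 i) (bar1 j)) (LJoin (bar2 i) (bar2 j)).

Definition cycle_lhs N K := bigmeet (fun j => top3 (level j K)) N.+1.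

(** Suppose each [j] has a midpoint [z_j], with [bar1 j] from [s] to [z_j] and [bar2 j] from [z_j]
    to [t]; then [link i j] relates [z_i] and [z_j]. The formula records that [s] reaches [z_0]
    directly and also through [z_(N+1)], from which [z_0] is reached both by the closing link and
    back around the cycle. *)
Definition cycle_rhs N := LJoin (bar2 0) (LMeet (bar1 0) (LJoin (bar1 N.+1)
  (LMeet (link N.+1 0) (bigjoin (fun j => link j j.+1) N)))).

Lemma bigmeet_le S (A : algebra S) (v : nat -> congruence A) f n j a b :
  j <= n -> ceval v (bigmeet f n) a b -> ceval v (f j) a b.
Proof.
elim: n => [|n IH] /=; first by rewrite leqn0 => /eqP ->.
by rewrite leq_eqVlt => /orP[/eqP ->|/IH h] [h1 h2]; [|apply: h].
Qed.

Section Identity.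
Variables (S : signature) (V : algebra S -> Prop).
Hypothesis hV : variety V.
Hypothesis hind : term_induction V.

(** Counterexamples for all [K] form a sequence in which the [K]-th pair is related at depth [K].
    For each of the finitely many [j] the limit argument gives midpoints from some index on, so one
    member of the sequence has them all and satisfies the identity after all. *)
Lemma cycle_identity N : exists K, holds V (cycle_lhs N K) (cycle_rhs N).
Proof.
apply: contrapT => /forallNP nh.
have hA K : exists A : algebra S, V A /\ exists (v : nat -> congruence A) (s t : A),
    ceval v (cycle_lhs N K) s t /\ ~ ceval v (cycle_rhs N) s t.
  apply: contrapT => h; apply: (nh K) => A VA v s t /cevalE h1; apply/cevalE.
  by apply: contrapT => h2; apply: h; exists A; split=> //; exists v, s, t.
pose A K := projT1 (cid (hA K)); have VA K : V (A K) by case: (projT2 (cid (hA K))).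
have hv K : exists v : nat -> congruence (A K), exists s t : A K,
  ceval v (cycle_lhs N K) s t /\ ~ ceval v (cycle_rhs N) s t.
  by case: (projT2 (cid (hA K))).
pose v K := projT1 (cid (hv K)); have hs K := cid (projT2 (cid (hv K))).
pose s K := projT1 (hs K); have ht K := cid (projT2 (hs K)).
pose t K := projT1 (ht K).
have hst K : ceval (v K) (cycle_lhs N K) (s K) (t K) /\
  ~ ceval (v K) (cycle_rhs N) (s K) (t K) := projT2 (ht K).
have dec (j : nat) : j <= N.+1 ->
    evt (fun k => exists w, ceval (v k) (bar1 j) (s k) w /\ ceval (v k) (bar2 j) w (t k)).
  move=> jN.
  pose la i k := ceval (v k) (level j i).1.1; pose lb i k := ceval (v k) (level j i).1.2.
  pose lc i k := ceval (v k) (level j i).2.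
  pose th i k := ceval (v k) (top3 (level j i)).
  have lS i : level j i.+1 = (LMeet (level j i).1.1 (LJoin (level j i).1.2 (level j i).2),
     LMeet (level j i).1.2 (LJoin (level j i).1.1 (level j i).2),
     LMeet (level j i).2 (LJoin (level j i).1.1 (level j i).1.2)).
    by rewrite {1}/level iterS -/(level j i); case: (level j i) => -[a b] c.
  have thE i k : th i k = con_join (la i k) (con_join (lb i k) (lc i k)).
    by rewrite /th /la /lb /lc; case: (level j i) => -[a b] c.
  have leJ i k u w : [/\ la i k u w -> th i k u w, lb i k u w -> th i k u w &
      lc i k u w -> th i k u w].
    by split=> h; rewrite thE; apply/con_joinE; [apply: jn_l | apply: jn_r | apply: jn_r];
      rewrite //; apply/con_joinE; [apply: jn_l | apply: jn_r].
  have dl i k u w : [/\ la i.+1 k u w -> la i k u w, lb i.+1 k u w -> lb i k u w &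
      lc i.+1 k u w -> lc i k u w].
    by rewrite /la /lb /lc lS; split; case.
  have d0 i k u w : [/\ la i k u w -> la 0 k u w, lb i k u w -> lb 0 k u w &
      lc i k u w -> lc 0 k u w].
    elim: i => // i [h1 h2 h3]; have [h4 h5 h6] := dl i k u w.
    by split; [move/h4 | move/h5 | move/h6].
  have th3 i k u w (W : congruence (A k)) :
      [/\ forall a b, la i.+1 k a b -> W a b, forall a b, lb i.+1 k a b -> W a b &
        forall a b, lc i.+1 k a b -> W a b] -> th i.+1 k u w -> W u w.
    by move=> [h1 h2 h3]; rewrite thE; apply=> // a b; apply.
  have thab i k u w : th i.+1 k u w -> jn (la i k) (lb i k) u w.
    move=> h; apply/con_joinE; apply: th3 h; rewrite /la /lb /lc lS; split=> a b [h1 h2] //.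
      exact/con_joinE/jn_l.
    exact/con_joinE/jn_r.
  have thac i k u w : th i.+1 k u w -> jn (la i k) (lc i k) u w.
    move=> h; apply/con_joinE; apply: th3 h; rewrite /la /lb /lc lS; split=> a b [h1 h2] //.
      exact/con_joinE/jn_l.
    exact/con_joinE/jn_r.
  have thbc i k u w : th i.+1 k u w -> jn (lb i k) (lc i k) u w.
    move=> h; apply/con_joinE; apply: th3 h; rewrite /la /lb /lc lS; split=> a b [h1 h2] //.
      exact/con_joinE/jn_l.
    exact/con_joinE/jn_r.
  have th_dec i k u w : th i.+1 k u w -> th i k u w.
    apply: th3; split=> a b; have [h1 h2 h3] := dl i k a b; have [h4 h5 h6] := leJ i k a b.
    - by move/h1.
    - by move/h2.
    - by move/h3.
  have b1 k u w : [/\ la 0 k u w -> ceval (v k) (bar1 j) u w,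
      lb 0 k u w -> ceval (v k) (bar2 j) u w,
      lb 0 k u w -> lc 0 k u w -> ceval (v k) (bar1 j) u w &
      la 0 k u w -> lc 0 k u w -> ceval (v k) (bar2 j) u w].
    split=> [h|h|h h'|h h']; apply/con_joinE.
    - exact: jn_l.
    - exact: jn_l.
    - by apply/jn_r/con_joinE/jn_r/con_joinE/jn_r.
    - by apply/jn_r/con_joinE/jn_r/con_joinE/jn_l.
  apply: (@limit_decomposition _ _ hV hind A VA s th th_dec (fun k => ceval (v k) (bar1 j))
    (fun k => ceval (v k) (bar2 j)) (lb 0) (lc 0) la lb lc).
  - apply: (@limit_modP _ _ hind A VA s th th_dec _ (lb 0) (lc 0) la lb lc) => //.
    + by move=> k u w; have [_ _ + _] := b1 k u w.
    + move=> i k u w h; have [h1 _ _] := d0 i k u w; have [h2 _ _] := leJ i k u w.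
      by split; [case: (b1 k u w) => + _ _ _; apply; apply: h1 | apply: h2].
    + move=> i k u w h; have [_ h1 _] := d0 i k u w; have [_ h2 _] := leJ i k u w.
      by split; [apply: h1 | apply: h2].
    + move=> i k u w h; have [_ _ h1] := d0 i k u w; have [_ _ h2] := leJ i k u w.
      by split; [apply: h1 | apply: h2].
  - apply: (@limit_modP _ _ hind A VA s th th_dec _ (la 0) (lc 0) lb la lc) => //.
    + by move=> k u w; have [_ _ _] := b1 k u w.
    + move=> i k u w h; have [_ h1 _] := d0 i k u w; have [_ h2 _] := leJ i k u w.
      by split; [case: (b1 k u w) => _ + _ _; apply; apply: h1 | apply: h2].
    + move=> i k u w h; have [h1 _ _] := d0 i k u w; have [h2 _ _] := leJ i k u w.
      by split; [apply: h1 | apply: h2].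
    + move=> i k u w h; have [_ _ h1] := d0 i k u w; have [_ _ h2] := leJ i k u w.
      by split; [apply: h1 | apply: h2].
    + move=> i k u w /thab; elim=> {u w} [u|u w z h _|u w z h _]; first exact: jn_refl.
        exact: jn_stepr.
      exact: jn_stepl.
  - move=> i k u w h; have [h1 _ _] := d0 i k u w; have [h2 _ _] := leJ i k u w.
    by split; [case: (b1 k u w) => + _ _ _; apply; apply: h1 | apply: h2].
  - move=> i k u w h; have [_ h1 _] := d0 i k u w; have [_ h2 _] := leJ i k u w.
    by split; [case: (b1 k u w) => _ + _ _; apply; apply: h1 | apply: h2].
  - exact: thab.
  - by move=> k; apply: (bigmeet_le (f := fun j => top3 (level j k)) jN (hst k).1).
have [k hk] : evt (fun k => forall j : 'I_N.+2, exists w,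
    ceval (v k) (bar1 j) (s k) w /\ ceval (v k) (bar2 j) w (t k)).
  by apply: evt_fin => j; apply: dec; rewrite -ltnS.
have [|z hz] := choice (P := fun j w => j <= N.+1 ->
    ceval (v k) (bar1 j) (s k) w /\ ceval (v k) (bar2 j) w (t k)).
  move=> j; have [jN|jN] := leqP j N.+1; last by exists (s k) => //; rewrite leqNgt jN.
  by have [w hw] := hk k (leqnn k) (Ordinal (jN : j < N.+2)); exists w.
have hlink i j : i <= N.+1 -> j <= N.+1 -> ceval (v k) (link i j) (z i) (z j).
  move=> /hz [h1 h2] /hz [h1' h2']; split; apply/con_joinE.
    exact: jn_stepl (con_sym h1) (jn_r _ h1').
  exact: jn_stepl h2 (jn_r _ (con_sym h2')).
have hjoin n : n <= N -> ceval (v k) (bigjoin (fun j => link j j.+1) n) (z 0) (z n.+1).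
  elim: n => [|n IH] nN; first exact: hlink.
  apply/con_joinE; apply: jn_stepl (IH (ltnW nN)) (jn_r _ _); apply: hlink => //.
  exact: ltnW.
have [_] := hst k; apply; apply/con_joinE; apply: jn_stepr (jn_l _ (hz 0 isT).2).
split; first by have [] := hz 0 isT.
apply/con_joinE; apply: jn_stepl (hz N.+1 (leqnn _)).1 (jn_r _ _).
split; first exact: hlink.
exact: con_sym (hjoin N (leqnn _)).
Qed.

End Identity.

(** * Lattices of submodules with a twist *)

Section Twisted.
Local Open Scope ring_scope.
Variables (S : signature) (V : algebra S -> Prop).
Hypothesis hV : variety V.
Variables (E : zmodType) (la : linear_action V E) (lam linv : E -> E).
Hypothesis lamD : forall x y, lam (x + y) = lam x + lam y.
Hypothesis lamK : cancel lam linv.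
Hypothesis linvK : cancel linv lam.
Hypothesis lamA : forall Y (t : tm S Y) u, idem V t ->
  la Y t (fun y => lam (u y)) = lam (la Y t u).

Lemma linvD x y : linv (x + y) = linv x + linv y.
Proof. by apply: (can_inj lamK); rewrite lamD !linvK. Qed.

Lemma linvA Y (t : tm S Y) u : idem V t -> la Y t (fun y => linv (u y)) = linv (la Y t u).
Proof.
move=> it; apply: (can_inj lamK); rewrite linvK -lamA //; congr (la _ _ _).
by apply/funext => y; rewrite linvK.
Qed.

Lemma lam0 : lam 0 = 0.
Proof. by apply: (addrI (lam 0)); rewrite -lamD !addr0. Qed.

Lemma linv0 : linv 0 = 0.
Proof. by apply: (can_inj lamK); rewrite linvK lam0. Qed.

Lemma lamN x : lam (- x) = - lam x.
Proof. by apply: (addrI (lam x)); rewrite -lamD !subrr lam0. Qed.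

Lemma linvN x : linv (- x) = - linv x.
Proof. by apply: (can_inj lamK); rewrite lamN !linvK. Qed.

Lemma la_zero Y (t : tm S Y) : idem V t -> la Y t (fun=> 0) = 0.
Proof.
move=> it; apply: (addrI (la Y t (fun=> 0))); rewrite addr0 -tact_add //.
by congr (la _ _ _); apply/funext => y; rewrite addr0.
Qed.

Lemma la_opp Y (t : tm S Y) u : idem V t -> la Y t (fun y => - u y) = - la Y t u.
Proof.
move=> it; apply: (addrI (la Y t u)); rewrite subrr -(la_zero it) -tact_add //.
by congr (la _ _ _); apply/funext => y; rewrite subrr.
Qed.

Variable N : nat.
Local Notation n := N.+2.

(* A vector has a row coordinate [v false i] and a column coordinate [v true i]
   for every [i]; the twist [g] acts on the row coordinates only. *)
Definition vec := bool -> 'I_n -> E.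
Implicit Types (v u w : vec) (X Y Z : vec -> Prop) (c : 'I_n).

Definition g v : vec := fun b i => if b then v b i else lam (v b i).
Definition ginv v : vec := fun b i => if b then v b i else linv (v b i).

Lemma gK v : ginv (g v) = v.
Proof. by apply/funext => -[]; apply/funext => i //=; apply: lamK. Qed.

Lemma ginvK v : g (ginv v) = v.
Proof. by apply/funext => -[]; apply/funext => i //=; apply: linvK. Qed.

(** Closure under [lam] and [linv] makes a submodule that touches no column invariant under the
    twist. *)
Record is_sub X : Prop := IsSub {
  sub_0 : X (fun _ _ => 0);
  sub_D : forall u w, X u -> X w -> X (fun b i => u b i + w b i);
  sub_N : forall u, X u -> X (fun b i => - u b i);
  sub_lam : forall u, X u -> X (fun b i => lam (u b i));
  sub_linv : forall u, X u -> X (fun b i => linv (u b i));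
  sub_act : forall T (t : tm S T) (w : T -> vec), idem V t -> (forall y, X (w y)) ->
    X (fun b i => la T t (fun y => w y b i))
}.

Definition addS X Y v := exists u w, [/\ X u, Y w & v = fun b i => u b i + w b i].
Definition capS X Y v := X v /\ Y v.
Definition gset X v := X (ginv v).
Definition gunset X v := X (g v).

Lemma is_sub_add X Y : is_sub X -> is_sub Y -> is_sub (addS X Y).
Proof.
move=> sX sY; split.
- exists (fun _ _ => 0), (fun _ _ => 0); split; [exact: sub_0 | exact: sub_0 |].
  by apply/funext => b; apply/funext => i; rewrite addr0.
- move=> _ _ [u [w [Xu Yw ->]]] [u' [w' [Xu' Yw' ->]]].
  exists (fun b i => u b i + u' b i), (fun b i => w b i + w' b i).
  split; [exact: sub_D | exact: sub_D |].
  by apply/funext => b; apply/funext => i; rewrite addrACA.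
- move=> _ [u [w [Xu Yw ->]]]; exists (fun b i => - u b i), (fun b i => - w b i).
  split; [exact: sub_N | exact: sub_N |].
  by apply/funext => b; apply/funext => i; rewrite opprD.
- move=> _ [u [w [Xu Yw ->]]]; exists (fun b i => lam (u b i)), (fun b i => lam (w b i)).
  split; [exact: sub_lam | exact: sub_lam |].
  by apply/funext => b; apply/funext => i; rewrite lamD.
- move=> _ [u [w [Xu Yw ->]]]; exists (fun b i => linv (u b i)), (fun b i => linv (w b i)).
  split; [exact: sub_linv | exact: sub_linv |].
  by apply/funext => b; apply/funext => i; rewrite linvD.
- move=> T t w it hw; have [u hu] := choice hw; have [z hz] := choice hu.
  exists (fun b i => la T t (fun y => u y b i)), (fun b i => la T t (fun y => z y b i)).
  split; try by apply: sub_act => // y; case: (hz y).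
  apply/funext => b; apply/funext => i; rewrite -tact_add //; congr (la _ _ _).
  by apply/funext => y; case: (hz y) => _ _ ->.
Qed.

Lemma is_sub_cap X Y : is_sub X -> is_sub Y -> is_sub (capS X Y).
Proof.
move=> sX sY; split.
- by split; apply: sub_0.
- by move=> u w [? ?] [? ?]; split; apply: sub_D.
- by move=> u [? ?]; split; apply: sub_N.
- by move=> u [? ?]; split; apply: sub_lam.
- by move=> u [? ?]; split; apply: sub_linv.
- by move=> T t w it hw; split; apply: sub_act => // y; case: (hw y).
Qed.

Lemma is_sub_ext X (f : vec -> vec) : is_sub X ->
  f (fun _ _ => 0) = (fun _ _ => 0) ->
  (forall u w, f (fun b i => u b i + w b i) = fun b i => f u b i + f w b i) ->
  (forall u, f (fun b i => - u b i) = fun b i => - f u b i) ->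
  (forall u, f (fun b i => lam (u b i)) = fun b i => lam (f u b i)) ->
  (forall u, f (fun b i => linv (u b i)) = fun b i => linv (f u b i)) ->
  (forall T (t : tm S T) (w : T -> vec), idem V t ->
     f (fun b i => la T t (fun y => w y b i)) = fun b i => la T t (fun y => f (w y) b i)) ->
  is_sub (fun v => X (f v)).
Proof.
move=> sX f0 fD fN fl fi fA; split.
- by rewrite f0; apply: sub_0.
- by move=> u w Xu Xw; rewrite fD; apply: sub_D.
- by move=> u Xu; rewrite fN; apply: sub_N.
- by move=> u Xu; rewrite fl; apply: sub_lam.
- by move=> u Xu; rewrite fi; apply: sub_linv.
- by move=> T t w it hw; rewrite fA //; apply: sub_act.
Qed.

Lemma is_sub_gset X : is_sub X -> is_sub (gset X).
Proof.
move=> sX; apply: (is_sub_ext (f := ginv)) => // *; apply/funext => -[];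
  apply/funext => i //=.
- exact: linv0.
- exact: linvD.
- exact: linvN.
- by rewrite lamK linvK.
- by rewrite -linvA.
Qed.

Lemma is_sub_gunset X : is_sub X -> is_sub (gunset X).
Proof.
move=> sX; apply: (is_sub_ext (f := g)) => // *; apply/funext => -[];
  apply/funext => i //=.
- exact: lam0.
- exact: lamN.
- by rewrite lamK linvK.
- by rewrite -lamA.
Qed.

Definition mv (i : 'I_n) (e : E) : vec := fun b k => if b then 0 else if k == i then e else 0.

(* The rows not filled by [X] and the columns touched by [X]. *)
Definition Rm X (i : 'I_n) : Prop := exists e, ~ X (mv i e).
Definition Cm X (j : 'I_n) : Prop := exists2 v, X v & v true j <> 0.

(** Rows and columns alternate around a cycle, column [j] lying between rows [j] and [ordS j].
    Unfilled rows and touched columns must always be neighbours, so elements that have both are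
    local. *)
Definition allowed X : Prop := forall i j, Rm X i -> Cm X j -> i = j \/ i = ordS j.

Lemma ginv_mv i e : ginv (mv i e) = mv i (linv e).
Proof.
apply/funext => -[]; apply/funext => k //=; rewrite /ginv /mv.
by case: eqP => // _; apply: linv0.
Qed.

Lemma Rm_gset X : Rm (gset X) = Rm X.
Proof.
apply/funext => i; apply/propext; split=> -[e he].
  by exists (linv e); rewrite -ginv_mv.
by exists (lam e); rewrite /gset ginv_mv lamK.
Qed.

Lemma Cm_gset X : Cm (gset X) = Cm X.
Proof.
apply/funext => j; apply/propext; split=> -[v Xv nz]; first by exists (ginv v).
by exists (g v) => //; rewrite /gset gK.
Qed.

Lemma gset_gunset X : gset (gunset X) = X.
Proof. by apply/funext => v; rewrite /gset /gunset ginvK. Qed.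

Lemma gunset_gset X : gunset (gset X) = X.
Proof. by apply/funext => v; rewrite /gset /gunset gK. Qed.

Lemma Rm_gunset X : Rm (gunset X) = Rm X.
Proof. by rewrite -Rm_gset gset_gunset. Qed.

Lemma Cm_gunset X : Cm (gunset X) = Cm X.
Proof. by rewrite -Cm_gset gset_gunset. Qed.

(* Cutting the cycle at column [c] makes [psi c X] an honest submodule: the twist
   applies to those [X] that live between row 1 and the cut. *)
Definition flag X c : bool := `[< exists i : 'I_n, Rm X i /\ (0 < i <= c)%N >].
Definition psi c X : vec -> Prop := if flag X c then gset X else X.
Definition unpsi c X : vec -> Prop := if flag X c then gunset X else X.

Lemma Rm_psi c X : Rm (psi c X) = Rm X.
Proof. by rewrite /psi; case: ifP => _ //; apply: Rm_gset. Qed.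

Lemma Cm_psi c X : Cm (psi c X) = Cm X.
Proof. by rewrite /psi; case: ifP => _ //; apply: Cm_gset. Qed.

Lemma Rm_unpsi c X : Rm (unpsi c X) = Rm X.
Proof. by rewrite /unpsi; case: ifP => _ //; apply: Rm_gunset. Qed.

Lemma Cm_unpsi c X : Cm (unpsi c X) = Cm X.
Proof. by rewrite /unpsi; case: ifP => _ //; apply: Cm_gunset. Qed.

Lemma flag_Rm X Y c : Rm X = Rm Y -> flag X c = flag Y c.
Proof. by rewrite /flag => ->. Qed.

Lemma psiK c X : psi c (unpsi c X) = X.
Proof.
rewrite /psi (flag_Rm c (Rm_unpsi c X)) /unpsi.
by case: (flag X c) => //; apply: gset_gunset.
Qed.

Lemma unpsiK c X : unpsi c (psi c X) = X.
Proof.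
rewrite /unpsi (flag_Rm c (Rm_psi c X)) /psi.
by case: (flag X c) => //; apply: gunset_gset.
Qed.

(** The condition for using the chart that cuts the cycle at [c]. Submodules with all rows filled do
    not feel the twist, so they may touch [c]. *)
Definition avoid X c : Prop := (forall i, ~ Rm X i) \/ ~ Cm X c.

Lemma avoid_RC X Y c : Rm X = Rm Y -> Cm X = Cm Y -> avoid X c -> avoid Y c.
Proof. by rewrite /avoid => -> ->. Qed.

Lemma Rm_sub X Y i : (forall v, X v -> Y v) -> Rm Y i -> Rm X i.
Proof. by move=> XY [e he]; exists e => /XY. Qed.

Lemma Cm_sub X Y j : (forall v, X v -> Y v) -> Cm X j -> Cm Y j.
Proof. by move=> XY [v /XY Yv nz]; exists v. Qed.

Lemma addS_l X Y v : is_sub Y -> X v -> addS X Y v.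
Proof.
move=> sY Xv; exists v, (fun _ _ => 0); split=> //; first exact: sub_0.
by apply/funext => b; apply/funext => i; rewrite addr0.
Qed.

Lemma addS_r X Y v : is_sub X -> Y v -> addS X Y v.
Proof.
move=> sX Yv; exists (fun _ _ => 0), v; split=> //; first exact: sub_0.
by apply/funext => b; apply/funext => i; rewrite add0r.
Qed.

Lemma Cm_add X Y j : Cm (addS X Y) j -> Cm X j \/ Cm Y j.
Proof.
move=> [_ [u [w [Xu Yw ->]]] nz].
have [uz|nu] := pselect (u true j = 0); last by left; exists u.
by right; exists w => // wz; apply: nz; rewrite uz wz addr0.
Qed.

Lemma Rm_cap X Y i : Rm (capS X Y) i -> Rm X i \/ Rm Y i.
Proof. by move=> [e /not_andP [] he]; [left | right]; exists e. Qed.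

Lemma avoid_add X Y c : is_sub X -> is_sub Y -> avoid X c -> avoid Y c -> avoid (addS X Y) c.
Proof.
move=> sX sY [X0|Xc] [Y0|Yc].
- by left=> i /(Rm_sub (fun v => @addS_l X Y v sY)) /X0.
- by left=> i /(Rm_sub (fun v => @addS_l X Y v sY)) /X0.
- by left=> i /(Rm_sub (fun v => @addS_r X Y v sX)) /Y0.
- by right=> /Cm_add [].
Qed.

Lemma avoid_cap X Y c : avoid X c -> avoid Y c -> avoid (capS X Y) c.
Proof.
move=> [X0|Xc] [Y0|Yc].
- by left=> i /Rm_cap [/X0|/Y0].
- by right=> /(Cm_sub (fun v (h : capS X Y v) => h.2)).
- by right=> /(Cm_sub (fun v (h : capS X Y v) => h.1)).
- by right=> /(Cm_sub (fun v (h : capS X Y v) => h.1)).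
Qed.

Lemma allowed_add X Y : is_sub X -> is_sub Y -> allowed X -> allowed Y -> allowed (addS X Y).
Proof.
move=> sX sY aX aY i j iXY /Cm_add [] jc.
  by apply: aX jc; apply: Rm_sub iXY => v; apply: addS_l.
by apply: aY jc; apply: Rm_sub iXY => v; apply: addS_r.
Qed.

Lemma allowed_cap X Y : allowed X -> allowed Y -> allowed (capS X Y).
Proof.
move=> aX aY i j /Rm_cap [] im jc.
  by apply: aX im _; apply: Cm_sub jc => v [].
by apply: aY im _; apply: Cm_sub jc => v [].
Qed.

Lemma allowed_RC X Y : Rm X = Rm Y -> Cm X = Cm Y -> allowed X -> allowed Y.
Proof. by rewrite /allowed => -> ->. Qed.

Lemma sub_sum X (l : seq 'I_n) v : is_sub X ->
  (forall i, i \in l -> X (mv i (v false i))) ->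
  X (fun b i => if b then 0 else if i \in l then v false i else 0).
Proof.
move=> sX; elim: l => [|i l IH] hl.
  by have := sub_0 sX; congr X; apply/funext => -[].
have {}IH := IH (fun k kl => hl k (mem_behead (s := i :: l) kl)).
have [il|il] := boolP (i \in l).
  move: IH; congr X; apply/funext => -[] //; apply/funext => k.
  by rewrite inE; case: eqP => // ->; rewrite il.
have := sub_D sX (hl i (mem_head _ _)) IH; congr X; apply/funext => -[];
  apply/funext => k; rewrite /mv ?addr0 //.
by rewrite inE; case: eqP => [->|_]; rewrite ?(negbTE il) ?addr0 ?add0r.
Qed.

(** If all rows are filled, [g v] differs from [v] by a vector supported on rows, which lies in [X].
    If no column is touched, [g] acts as [lam]. *)
Lemma gset_id X : is_sub X -> (forall i, ~ Rm X i) \/ (forall j, ~ Cm X j) -> gset X = X.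
Proof.
move=> sX h; suff gX v : X v -> X (ginv v) /\ X (g v).
  apply/funext => v; apply/propext; split=> [/gX [_]|/gX []] //.
  by rewrite ginvK.
move=> Xv; case: h => [Xr|Xc]; last first.
  have v0 j : v true j = 0 by apply: contrapT => nz; apply: (Xc j); exists v.
  split.
    have := sub_linv sX Xv; congr X; apply/funext => -[] //; apply/funext => i.
    by rewrite /= v0 linv0.
  have := sub_lam sX Xv; congr X; apply/funext => -[] //; apply/funext => i.
  by rewrite /= v0 lam0.
have Xm (u : 'I_n -> E) : X (fun b i => if b then 0 else u i).
  have := @sub_sum X (enum 'I_n) (fun _ => u) sX; move=> h.
  have := h _; rewrite (_ : (fun b i => _) = (fun (b : bool) i => if b then 0 else u i)).
    by apply=> i _; apply: contrapT => nX; apply: (Xr i); exists (u i).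
  by apply/funext => -[] //; apply/funext => i; rewrite mem_enum.
split.
  have := sub_D sX Xv (Xm (fun i => linv (v false i) - v false i)); congr X.
  by apply/funext => -[]; apply/funext => i /=; rewrite ?addr0 // addrC subrK.
have := sub_D sX Xv (Xm (fun i => lam (v false i) - v false i)); congr X.
by apply/funext => -[]; apply/funext => i /=; rewrite ?addr0 // addrC subrK.
Qed.

Lemma psi_id c X : is_sub X -> (forall i, ~ Rm X i) \/ (forall j, ~ Cm X j) -> psi c X = X.
Proof. by move=> sX h; rewrite /psi gset_id //; case: ifP. Qed.

Lemma val_ordS (j : 'I_n) : ordS j = (if j == N.+1 :> nat then 0 else j.+1) :> nat.
Proof.
rewrite /=; case: eqP => [->|/eqP jN]; first by rewrite modnn.
by rewrite modn_small // ltn_neqAle; rewrite eqSS jN ltn_ord.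
Qed.

(** Every unfilled row is [j] or its successor, and [c] differs from [j]. So the flag only records
    on which side of the cut [j] lies, and is the same for all elements touching [j]. *)
Lemma flag_pos X c (j : 'I_n) : allowed X -> (exists i, Rm X i) -> Cm X j -> avoid X c ->
  (0 < j)%N -> flag X c = (j < c)%N.
Proof.
move=> aX [i0 Ri0] Cj [/(_ _ Ri0) //|nCc] j0.
have jc : j != c :> nat by apply/eqP => /val_inj jc; apply: nCc; rewrite -jc.
apply/asboolP/idP => [[i [Ri /andP[i_gt ic]]]|lt_jc].
  have [ij|ij] := aX i j Ri Cj; first by rewrite ltn_neqAle jc -ij ic.
  move: i_gt ic; rewrite ij val_ordS; case: eqP => // _ _; exact.
exists i0; split=> //; have [->|->] := aX i0 j Ri0 Cj; first by rewrite j0 ltnW.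
rewrite val_ordS; case: eqP => [jN|//]; move: lt_jc; rewrite jN ltnNge.
by rewrite -ltnS ltn_ord.
Qed.

(** Column 0 carries the twist: of its two neighbours, row 0 is outside the range of the flag and
    row 1 inside, for every admissible cut. *)
Lemma flag_zero X c (j : 'I_n) : allowed X -> Cm X j -> (exists i, Rm X i) -> avoid X c ->
  j = 0%N :> nat -> flag X c = `[< Rm X (ordS j) >].
Proof.
move=> aX Cj [i0 Ri0] [/(_ _ Ri0) //|nCc] j0.
have c0 : (0 < c)%N.
  rewrite lt0n; apply/eqP => c0; apply: nCc; suff -> : c = j by [].
  by apply: val_inj; rewrite /= c0 j0.
have sj : ordS j = 1%N :> nat by rewrite val_ordS j0.
rewrite /flag; congr asbool; apply/propext; split=> [[i [Ri /andP[i_gt ic]]]|Rj].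
  have [ij|<- //] := aX i j Ri Cj; by move: i_gt; rewrite ij j0.
by exists (ordS j); rewrite sj c0.
Qed.

(** If one of the submodules has no unfilled row or touches no column, it is invariant under the
    twist. Otherwise both touch a common column [j]: for [j > 0] they have equal flags in each
    chart, and for [j = 0] their flags do not depend on the chart. *)
Lemma psi_chart X Y c c' : is_sub X -> is_sub Y -> allowed X -> allowed Y ->
  avoid X c -> avoid Y c -> avoid X c' -> avoid Y c' ->
  (forall v, psi c X v -> psi c Y v) -> forall v, psi c' X v -> psi c' Y v.
Proof.
move=> sX sY aX aY Xc Yc Xc' Yc' XY.
have CXY j : Cm X j -> Cm Y j by rewrite -(Cm_psi c X) -(Cm_psi c Y); apply: Cm_sub.
have RXY j : Rm Y j -> Rm X j by rewrite -(Rm_psi c X) -(Rm_psi c Y); apply: Rm_sub.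
have gsub Z W : (forall v, gset Z v -> gset W v) <-> (forall v, Z v -> W v).
  split=> h v; last exact: h.
  by rewrite -{1}(gK v) => /h; rewrite /gset gK.
have [hX|hX] := pselect ((forall i, ~ Rm X i) \/ (forall j, ~ Cm X j)).
  have e : (forall v, X v -> gset Y v) <-> (forall v, X v -> Y v).
    by rewrite -{1}(gset_id sX hX) gsub.
  move: XY; rewrite !(psi_id _ sX hX) /psi.
  by case: (flag Y c); case: (flag Y c'); rewrite ?e.
have [hY|hY] := pselect ((forall i, ~ Rm Y i) \/ (forall j, ~ Cm Y j)).
  have e : (forall v, gset X v -> Y v) <-> (forall v, X v -> Y v).
    by rewrite -{1}(gset_id sY hY) gsub.
  move: XY; rewrite !(psi_id _ sY hY) /psi.
  by case: (flag X c); case: (flag X c'); rewrite ?e.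
move/not_orP: hX => [/existsNP [i /contrapT Ri] /existsNP [j /contrapT Cj]].
move/not_orP: hY => [/existsNP [i' /contrapT Ri'] _].
have eX : exists i, Rm X i by exists i.
have eY : exists i, Rm Y i by exists i'.
have CjY := CXY _ Cj.
have [j0|j0] := posnP j.
  move: XY; rewrite /psi !(flag_zero aX Cj eX) // !(flag_zero aY CjY eY) //.
move: XY; rewrite /psi !(flag_pos aX eX Cj) // !(flag_pos aY eY CjY) //.
by case: ifP; case: ifP => _ _ //; rewrite gsub.
Qed.

(** * The glued lattice, compared chart by chart *)

Definition elt := {X : vec -> Prop | is_sub X /\ allowed X}.

Implicit Types (x y z : elt).

Let esub x : is_sub (sval x). Proof. by case: (svalP x). Qed.
Let eall x : allowed (sval x). Proof. by case: (svalP x). Qed.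

Lemma elt_eq x y : sval x = sval y -> x = y.
Proof.
case: x y => X hX [Y hY] /= e; move: hY; rewrite -e => hY.
by congr exist; apply: Prop_irrelevance.
Qed.

(** One unfilled row [i] confines the touched columns to [i] and its predecessor. *)
Lemma avoid_few x : exists A : {set 'I_n}, (#|A| <= 2)%N /\
  forall c, c \notin A -> avoid (sval x) c.
Proof.
have [[i Ri]|nR] := pselect (exists i, Rm (sval x) i); last first.
  by exists set0; rewrite cards0; split=> // c _; left=> i Ri; apply: nR; exists i.
exists [set i; ord_pred i]; split; first by rewrite cards2; case: eqP.
move=> c; rewrite !inE negb_or => /andP[ci cpi]; right=> Cc.
have [e|e] := eall Ri Cc; first by rewrite e eqxx in ci.
by move: cpi; rewrite e ordSK eqxx.
Qed.

Lemma chart (k : nat) (x : nat -> elt) : (2 * k < n)%N ->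
  exists c, forall i, (i < k)%N -> avoid (sval (x i)) c.
Proof.
move=> kn; have [A hA] := choice (fun i => avoid_few (x i)).
have [U [cU hU]] : exists U : {set 'I_n}, (#|U| <= 2 * k)%N /\
    forall i, (i < k)%N -> A i \subset U.
  elim: k {kn} => [|k [U [cU hU]]]; first by exists set0; rewrite cards0.
  exists (U :|: A k); split.
    apply: leq_trans (leq_card_setU _ _) _; rewrite mulnS addnC leq_add //.
    by case: (hA k).
  move=> i; rewrite ltnS leq_eqVlt => /orP[/eqP ->|/hU iU]; first exact: subsetUr.
  by apply: subset_trans iU _; apply: subsetUl.
have [c cU'] : exists c, c \notin U.
  apply/existsP; rewrite -negb_forall; apply/negP => /forallP all.
  have : (n <= #|U|)%N.
    rewrite -{1}(card_ord n) -cardsT; apply: subset_leq_card.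
    by apply/subsetP => c _.
  by move/leq_trans => /(_ _ cU); rewrite leqNgt kn.
exists c => i ik; have [_] := hA i; apply; apply: contra cU'.
by move/subsetP: (hU i ik); apply.
Qed.

Hypothesis n_gt : (6 < n)%N.

Lemma chart3 x y z : exists c, [/\ avoid (sval x) c, avoid (sval y) c & avoid (sval z) c].
Proof.
have [c hc] := @chart 3 (nth x [:: x; y; z]) n_gt.
by exists c; split; [apply: (hc 0) | apply: (hc 1) | apply: (hc 2)].
Qed.

(** By [psi_chart] the choice of the common chart is immaterial. Transitivity needs a chart for
    three elements, which exclude at most six columns; hence [6 < n]. *)
Definition tle x y : Prop := exists c, [/\ avoid (sval x) c, avoid (sval y) c &
  forall v, psi c (sval x) v -> psi c (sval y) v].

Lemma tle_chart x y c : tle x y -> avoid (sval x) c -> avoid (sval y) c ->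
  forall v, psi c (sval x) v -> psi c (sval y) v.
Proof. by move=> [c' [xc' yc' h]] xc yc; apply: (psi_chart _ _ _ _ xc' yc'). Qed.

Lemma tle_refl x : tle x x.
Proof. by have [c [xc _ _]] := chart3 x x x; exists c. Qed.

Lemma tle_trans x y z : tle x y -> tle y z -> tle x z.
Proof.
move=> xy yz; have [c [xc yc zc]] := chart3 x y z; exists c; split=> // v.
by move/(tle_chart xy xc yc)/(tle_chart yz yc zc).
Qed.

Lemma tle_anti x y : tle x y -> tle y x -> x = y.
Proof.
move=> xy yx; have [c [xc yc _]] := chart3 x y y; apply: elt_eq.
rewrite -(unpsiK c (sval x)) -(unpsiK c (sval y)); congr unpsi.
by apply/funext => v; apply/propext; split; apply: tle_chart.
Qed.

Lemma is_sub_psi c X : is_sub X -> is_sub (psi c X).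
Proof. by move=> sX; rewrite /psi; case: ifP => _ //; apply: is_sub_gset. Qed.

Lemma is_sub_unpsi c X : is_sub X -> is_sub (unpsi c X).
Proof. by move=> sX; rewrite /unpsi; case: ifP => _ //; apply: is_sub_gunset. Qed.

Lemma allowed_psi c X : allowed X -> allowed (psi c X).
Proof. by apply: allowed_RC; rewrite ?Rm_psi ?Cm_psi. Qed.

Lemma allowed_unpsi c X : allowed X -> allowed (unpsi c X).
Proof. by apply: allowed_RC; rewrite ?Rm_unpsi ?Cm_unpsi. Qed.

Definition join_at c x y : elt := exist _ (unpsi c (addS (psi c (sval x)) (psi c (sval y))))
  (conj (is_sub_unpsi c (is_sub_add (is_sub_psi c (esub x)) (is_sub_psi c (esub y))))
    (allowed_unpsi (allowed_add (is_sub_psi c (esub x)) (is_sub_psi c (esub y))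
      (allowed_psi (@eall x)) (allowed_psi (@eall y))))).

Definition meet_at c x y : elt := exist _ (unpsi c (capS (psi c (sval x)) (psi c (sval y))))
  (conj (is_sub_unpsi c (is_sub_cap (is_sub_psi c (esub x)) (is_sub_psi c (esub y))))
    (allowed_unpsi (allowed_cap (allowed_psi (@eall x)) (allowed_psi (@eall y))))).

Lemma avoid_psi c c' X : avoid X c' -> avoid (psi c X) c'.
Proof. by apply: avoid_RC; rewrite ?Rm_psi ?Cm_psi. Qed.

Lemma avoid_join_at c c' x y : avoid (sval x) c' -> avoid (sval y) c' ->
  avoid (sval (join_at c x y)) c'.
Proof.
move=> xc yc; apply: (avoid_RC _ _ (avoid_add (is_sub_psi c (esub x))
  (is_sub_psi c (esub y)) (avoid_psi c xc) (avoid_psi c yc))).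
  by rewrite /= Rm_unpsi.
by rewrite /= Cm_unpsi.
Qed.

Lemma avoid_meet_at c c' x y : avoid (sval x) c' -> avoid (sval y) c' ->
  avoid (sval (meet_at c x y)) c'.
Proof.
move=> xc yc; apply: (avoid_RC _ _ (avoid_cap (avoid_psi c xc) (avoid_psi c yc))).
  by rewrite /= Rm_unpsi.
by rewrite /= Cm_unpsi.
Qed.

Lemma join_at_ub c x y : avoid (sval x) c -> avoid (sval y) c ->
  tle x (join_at c x y) /\ tle y (join_at c x y).
Proof.
move=> xc yc; have jc := avoid_join_at c xc yc.
split; exists c; split=> // v h; rewrite psiK.
  by apply: addS_l h; apply: is_sub_psi.
by apply: addS_r h; apply: is_sub_psi.
Qed.

Lemma meet_at_lb c x y : avoid (sval x) c -> avoid (sval y) c ->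
  tle (meet_at c x y) x /\ tle (meet_at c x y) y.
Proof.
move=> xc yc; have jc := avoid_meet_at c xc yc.
by split; exists c; split=> // v; rewrite psiK => -[].
Qed.

Lemma join_at_lub c x y z : avoid (sval x) c -> avoid (sval y) c ->
  tle x z -> tle y z -> tle (join_at c x y) z.
Proof.
move=> xc yc xz yz; have [c1 [xc1 yc1 zc1]] := chart3 x y z.
apply: (@tle_trans _ (join_at c1 x y)).
  have [h1 h2] := join_at_ub xc1 yc1; have jc := avoid_join_at c1 xc yc.
  exists c; split=> //; first exact: avoid_join_at.
  move=> v; rewrite psiK => -[u [w [hu hw ->]]].
  apply: (sub_D (is_sub_psi c (esub (join_at c1 x y)))).
    exact: tle_chart h1 xc jc _ hu.
  exact: tle_chart h2 yc jc _ hw.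
exists c1; split=> //; first exact: avoid_join_at.
move=> v; rewrite psiK => -[u [w [hu hw ->]]]; apply: (sub_D (is_sub_psi c1 (esub z))).
  exact: tle_chart xz xc1 zc1 _ hu.
exact: tle_chart yz yc1 zc1 _ hw.
Qed.

Lemma meet_at_glb c x y z : avoid (sval x) c -> avoid (sval y) c ->
  tle z x -> tle z y -> tle z (meet_at c x y).
Proof.
move=> xc yc zx zy; have [c1 [xc1 yc1 zc1]] := chart3 x y z.
apply: (@tle_trans _ (meet_at c1 x y)); last first.
  have [h1 h2] := meet_at_lb xc1 yc1; have jc := avoid_meet_at c1 xc yc.
  exists c; split=> //; first exact: avoid_meet_at.
  by move=> v hv; rewrite psiK; split; [apply: tle_chart h1 _ _ _ hv | apply: tle_chart h2 _ _ _ hv].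
exists c1; split=> //; first exact: avoid_meet_at.
by move=> v hv; rewrite psiK; split; [apply: tle_chart zx _ _ _ hv | apply: tle_chart zy _ _ _ hv].
Qed.

Definition common_chart x y : 'I_n := projT1 (cid (chart3 x y y)).

Lemma common_chartP x y :
  avoid (sval x) (common_chart x y) /\ avoid (sval y) (common_chart x y).
Proof. by rewrite /common_chart; case: cid => c []. Qed.

Definition tjoin x y := join_at (common_chart x y) x y.
Definition tmeet x y := meet_at (common_chart x y) x y.

Lemma tjoin_at c x y : avoid (sval x) c -> avoid (sval y) c -> tjoin x y = join_at c x y.
Proof.
move=> xc yc; have [xd yd] := common_chartP x y.
have [h1 h2] := join_at_ub xc yc; have [h3 h4] := join_at_ub xd yd.
by apply: tle_anti; apply: join_at_lub.
Qed.

Lemma tmeet_at c x y : avoid (sval x) c -> avoid (sval y) c -> tmeet x y = meet_at c x y.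
Proof.
move=> xc yc; have [xd yd] := common_chartP x y.
have [h1 h2] := meet_at_lb xc yc; have [h3 h4] := meet_at_lb xd yd.
by apply: tle_anti; apply: meet_at_glb.
Qed.

Let tle_b x y : bool := `[< tle x y >].

Let tle_b_refl : reflexive tle_b.
Proof. by move=> x; apply/asboolP/tle_refl. Qed.

Let tle_b_anti : antisymmetric tle_b.
Proof. by move=> x y /andP[/asboolP xy /asboolP yx]; apply: tle_anti. Qed.

Let tle_b_trans : transitive tle_b.
Proof. by move=> y x z /asboolP xy /asboolP yz; apply/asboolP/(tle_trans xy). Qed.

Let tw_choice : choiceType :=
  HB.pack_for choiceType elt (gen_eqMixin elt) (gen_choiceMixin elt).

Let tw_porder : porderType con_display := HB.pack_for (porderType con_display) tw_choice
  (Order.Le_isPOrder.Build con_display tw_choice tle_b_refl tle_b_anti tle_b_trans).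

Let tmeetP (x y z : tw_porder) :
  (x <= (tmeet y z : tw_porder))%O = (x <= y)%O && (x <= z)%O.
Proof.
have [yc zc] := common_chartP y z; have [h1 h2] := meet_at_lb yc zc.
apply/asboolP/andP => [h|[/asboolP xy /asboolP xz]].
  by split; apply/asboolP; [apply: tle_trans h h1 | apply: tle_trans h h2].
exact: meet_at_glb.
Qed.

Let tjoinP (x y z : tw_porder) :
  ((tjoin x y : tw_porder) <= z)%O = (x <= z)%O && (y <= z)%O.
Proof.
have [xc yc] := common_chartP x y; have [h1 h2] := join_at_ub xc yc.
apply/asboolP/andP => [h|[/asboolP xz /asboolP yz]].
  by split; apply/asboolP; [apply: tle_trans h1 h | apply: tle_trans h2 h].
exact: join_at_lub.
Qed.

Definition twisted : latticeType con_display := HB.pack_for (latticeType con_display)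
  tw_porder (Order.POrder_MeetJoin_isLattice.Build con_display tw_porder tmeetP tjoinP).

Lemma twisted_le (x y : twisted) : (x <= y)%O <-> tle x y.
Proof. by split=> [/asboolP|h]; last exact/asboolP. Qed.

(** * Inequalities in few variables hold in the glued lattice *)

Fixpoint vars_lt (k : nat) (t : lattice_term) : bool :=
  match t with
  | LVar i => (i < k)%N
  | LMeet s u | LJoin s u => vars_lt k s && vars_lt k u
  end.

Fixpoint seval (X : nat -> vec -> Prop) (t : lattice_term) : vec -> Prop :=
  match t with
  | LVar i => X i
  | LMeet s u => capS (seval X s) (seval X u)
  | LJoin s u => addS (seval X s) (seval X u)
  end.

Lemma chart_eval (e : nat -> twisted) k c t : vars_lt k t ->
  (forall i, (i < k)%N -> avoid (sval (e i)) c) ->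
  avoid (sval (lattice_eval e t : elt)) c /\
  psi c (sval (lattice_eval e t : elt)) = seval (fun i => psi c (sval (e i))) t.
Proof.
move=> + hc; elim: t => [i|s IHs u IHu|s IHs u IHu] /=; first by move=> /hc.
  move=> /andP[/IHs [sc sE] /IHu [uc uE]].
  change (avoid (sval (tmeet (lattice_eval e s) (lattice_eval e u))) c /\
    psi c (sval (tmeet (lattice_eval e s) (lattice_eval e u))) =
    capS (seval (fun i => psi c (sval (e i))) s) (seval (fun i => psi c (sval (e i))) u)).
  rewrite (tmeet_at sc uc); split; first exact: avoid_meet_at.
  by rewrite psiK sE uE.
move=> /andP[/IHs [sc sE] /IHu [uc uE]].
change (avoid (sval (tjoin (lattice_eval e s) (lattice_eval e u))) c /\
  psi c (sval (tjoin (lattice_eval e s) (lattice_eval e u))) =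
  addS (seval (fun i => psi c (sval (e i))) s) (seval (fun i => psi c (sval (e i))) u)).
rewrite (tjoin_at sc uc); split; first exact: avoid_join_at.
by rewrite psiK sE uE.
Qed.

Lemma is_sub_seval (X : nat -> vec -> Prop) t : (forall i, is_sub (X i)) -> is_sub (seval X t).
Proof.
move=> sX; elim: t => [i|s IHs u IHu|s IHs u IHu] //=; first exact: is_sub_cap.
exact: is_sub_add.
Qed.

Definition dif (u w : vec) : vec := fun b i => u b i - w b i.

Definition coset_rel (X : vec -> Prop) u w := X (dif u w).

Lemma coset_equiv X : is_sub X -> equivalence_rel_prop (coset_rel X).
Proof.
move=> sX; rewrite /coset_rel /dif; split=> [u|u w h|u w z h h'].
- have := sub_0 sX; congr X; apply/funext => b; apply/funext => i.
  by rewrite subrr.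
- have := sub_N sX h; congr X; apply/funext => b; apply/funext => i.
  by rewrite opprB.
- have := sub_D sX h h'; congr X; apply/funext => b; apply/funext => i.
  by rewrite addrA subrK.
Qed.

Lemma seval_eqv (X : nat -> vec -> Prop) t u w : (forall i, is_sub (X i)) ->
  eqv_eval (fun i => coset_rel (X i)) t u w <-> coset_rel (seval X t) u w.
Proof.
move=> sX; elim: t u w => [i|s IHs t IHt|s IHs t IHt] u w //=.
  by rewrite IHs IHt.
have ss : is_sub (seval X s) by apply: is_sub_seval.
have st : is_sub (seval X t) by apply: is_sub_seval.
have [r sy tr] := coset_equiv (is_sub_add ss st); split.
  elim=> {u w} [u|u w z /IHs uw _ wz|u w z /IHt uw _ wz]; first exact: r.
    by apply: tr wz; apply: addS_l.
  by apply: tr wz; apply: addS_r.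
move=> [a [b [sa tb e]]].
apply: (@jn_stepl _ _ _ _ (dif u a)); last apply: jn_r.
  apply/IHs; move: sa; rewrite /coset_rel /dif; congr (seval X s _).
  by apply/funext => c; apply/funext => i; rewrite opprB addrC subrK.
apply/IHt; move: tb; rewrite /coset_rel; congr (seval X t _).
apply/funext => c; apply/funext => i; have := congr1 (fun v : vec => v c i) e.
by rewrite /dif => /= h; rewrite addrAC h addrAC subrr add0r.
Qed.

(** One column [c] is avoided by all the variables involved, and [psi c] turns lattice operations
    into sums and intersections of submodules. There [transfer] applies to the coset relations, with
    vectors as variables and terms acting coordinatewise. *)
Lemma twisted_holds p q k : holds V p q -> vars_lt k p -> vars_lt k q -> (2 * k < n)%N ->
  forall e : nat -> twisted, (lattice_eval e p <= lattice_eval e q)%O.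
Proof.
move=> hpq vp vq kn e; have [c hc] := chart e kn.
have [pc pE] := chart_eval vp hc; have [qc qE] := chart_eval vq hc.
apply/twisted_le; exists c; split=> // v; rewrite pE qE.
pose X (i : nat) : vec -> Prop := psi c (sval (e i : elt)).
have sX i : is_sub (X i) by apply/is_sub_psi/esub.
pose act (t : tm S vec) : vec := fun b i => la vec t (fun w : vec => w b i).
have h := @transfer S V hV p q vec (fun _ _ => 0) act (fun i => coset_rel (X i)) hpq
  (fun i => coset_equiv (sX i)) _ _ _.
have dif0 : dif v (fun _ _ => 0) = v.
  by apply/funext => b; apply/funext => i; rewrite /dif subr0.
move=> pv; rewrite -dif0; apply/(seval_eqv q _ _ sX); apply: h.
- by move=> y; apply/funext => b; apply/funext => i; apply: tact_var.
- move=> t t' it it' tt'; apply/funext => b; apply/funext => i; exact: tact_veq.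
- move=> i t s it hs; have [_ sy _] := coset_equiv (sX i).
  have := sub_act (sX i) it (fun y : vec => sy _ _ (hs y)); congr (X i).
  apply/funext => b; apply/funext => j; rewrite /dif /act tact_map.
  by rewrite -la_opp // -tact_add.
- by apply/(seval_eqv p _ _ sX); rewrite /coset_rel dif0.
Qed.

(** * Failure of the cycle identity *)

Record lin (f : vec -> E) : Prop := Lin {
  lin_D : forall u w, f (fun b i => u b i + w b i) = f u + f w;
  lin_lam : forall u, f (fun b i => lam (u b i)) = lam (f u);
  lin_act : forall T (t : tm S T) (w : T -> vec), idem V t ->
    f (fun b i => la T t (fun s => w s b i)) = la T t (fun s => f (w s))
}.

Lemma lin_coord b i : lin (fun v => v b i).
Proof. by []. Qed.

Lemma lin_zero : lin (fun=> 0).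
Proof. by split=> [u w|u|T t w it]; rewrite ?addr0 ?lam0 ?la_zero. Qed.

Lemma lin_add f h : lin f -> lin h -> lin (fun v => f v + h v).
Proof.
move=> lf lh; split=> [u w|u|T t w it].
- by rewrite (lin_D lf) (lin_D lh) addrACA.
- by rewrite (lin_lam lf) (lin_lam lh) lamD.
- by rewrite (lin_act lf) // (lin_act lh) // -tact_add.
Qed.

Lemma lin_comp f : lin f -> lin (fun v => lam (f v)).
Proof.
move=> lf; split=> [u w|u|T t w it].
- by rewrite (lin_D lf) lamD.
- by rewrite (lin_lam lf).
- by rewrite (lin_act lf) // lamA.
Qed.

Lemma lin_sum (l : seq 'I_n) : lin (fun v => \sum_(i <- l) v true i).
Proof.
elim: l => [|i l IH].
  rewrite (_ : (fun v => _) = fun=> 0); first exact: lin_zero.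
  by apply/funext => v; rewrite big_nil.
rewrite (_ : (fun v => _) = fun v => v true i + \sum_(k <- l) v true k).
  by apply: lin_add IH; apply: lin_coord.
by apply/funext => v; rewrite big_cons.
Qed.

Lemma lin_0 f : lin f -> f (fun _ _ => 0) = 0.
Proof.
move=> lf; apply: (addrI (f (fun _ _ => 0))); rewrite addr0 -(lin_D lf).
by congr f; apply/funext => b; apply/funext => i; rewrite addr0.
Qed.

Lemma lin_N f u : lin f -> f (fun b i => - u b i) = - f u.
Proof.
move=> lf; apply: (addrI (f u)); rewrite subrr -(lin_D lf) -[RHS](lin_0 lf).
by congr f; apply/funext => b; apply/funext => i; rewrite subrr.
Qed.

Lemma lin_linv f u : lin f -> f (fun b i => linv (u b i)) = linv (f u).
Proof.
move=> lf; apply: (can_inj lamK); rewrite linvK -(lin_lam lf); congr f.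
by apply/funext => b; apply/funext => i; rewrite linvK.
Qed.

Lemma is_sub_eq f h : lin f -> lin h -> is_sub (fun v => f v = h v).
Proof.
move=> lf lh; split.
- by rewrite !lin_0.
- by move=> u w e e'; rewrite (lin_D lf) (lin_D lh) e e'.
- by move=> u e; rewrite !lin_N ?e.
- by move=> u e; rewrite (lin_lam lf) (lin_lam lh) e.
- by move=> u e; rewrite !lin_linv ?e.
- move=> T t w it hw; rewrite (lin_act lf) // (lin_act lh) //; congr (la _ _ _).
  by apply/funext.
Qed.

Lemma is_sub_all I (X : I -> vec -> Prop) :
  (forall i, is_sub (X i)) -> is_sub (fun v => forall i, X i v).
Proof.
move=> sX; split=> [i|u w Xu Xw i|u Xu i|u Xu i|u Xu i|T t w it Xw i].
- exact: sub_0.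
- exact: sub_D.
- exact: sub_N.
- exact: sub_lam.
- exact: sub_linv.
- by apply: sub_act.
Qed.

(** Quantifying over a subtype presents the support condition as an intersection of kernels, to
    which [is_sub_all] applies. *)
Definition mk (C : 'I_n -> bool) (P : vec -> Prop) v :=
  (forall k : {k | ~~ C k}, v true (sval k) = 0) /\ P v.

Lemma is_sub_mk C P : is_sub P -> is_sub (mk C P).
Proof.
move=> sP; apply: is_sub_cap sP; apply: is_sub_all => k.
by apply: is_sub_eq (lin_coord true (sval k)) lin_zero.
Qed.

Lemma mkP C P v : mk C P v <-> (forall k, ~~ C k -> v true k = 0) /\ P v.
Proof.
by split=> -[h Pv]; split=> // k; [move=> Ck; apply: (h (exist _ k Ck)) | apply: h; case: k].
Qed.

Lemma Cm_mk C P j : Cm (mk C P) j -> C j.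
Proof.
by move=> [v /mkP [h _] nz]; case Cj : (C j) => //; case: nz; apply: h; rewrite Cj.
Qed.

Lemma Rm_mk C P : Rm (mk C P) = Rm P.
Proof.
apply/funext => i; apply/propext; split=> -[e he]; exists e.
  by move=> Pe; apply: he; apply/mkP.
by move/mkP => [].
Qed.

Lemma avoid_mk C P c : ~~ C c -> avoid (mk C P) c.
Proof. by move=> Cc; right=> /Cm_mk; apply/negP. Qed.

Lemma allowed_mk (C : 'I_n -> bool) P (R : 'I_n -> Prop) : (forall i, Rm P i -> R i) ->
  (forall i j, R i -> C j -> i = j \/ i = ordS j) -> allowed (mk C P).
Proof. by move=> hR h i j; rewrite Rm_mk => /hR Ri /Cm_mk; apply: h. Qed.

Hypothesis (e0 : E) (lam_e0 : lam e0 <> e0).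

Let e0_nz : e0 <> 0.
Proof. by move=> e; apply: lam_e0; rewrite e lam0. Qed.

Let ord_neqS (j : 'I_n) : ordS j != j.
Proof.
apply/eqP => /(congr1 val); rewrite [val _]val_ordS /=.
case: eqP => [-> //|_ e]; by move: (leqnn j); rewrite -{1}e ltnn.
Qed.

Definition rows2 (j i : 'I_n) := i = j \/ i = ordS j.
Definition rows1 (j i : 'I_n) := i = ordS j.
Definition cols2 (j : 'I_n) := [pred k : 'I_n | (k == j) || (k == ordS j)].

(** With columns restricted, [PA], [PA'] and [PM] give three elements at column [j], each below the
    join of the other two. The [PY] conditions bound the joins at neighbouring columns, and [PYt] is
    [PY1] at the edge where the cycle closes, corrected by the twist. *)
Definition PA j v := v false j = 0 /\ v false (ordS j) = 0.
Definition PA' j v := v false j = v true j /\ v false (ordS j) = v true j.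
Definition PM j v := v false j = v false (ordS j).
Definition PY0 j v := v false (ordS j) = 0.
Definition PY1 j v := v false (ordS j) = v true j + v true (ordS j).
Definition PYt v := v false (ordS ord_max) = v true ord_max + lam (v true (ordS ord_max)).
Definition PA1 v := v false (ordS ord_max) = 0 /\
  lam (v true (ordS ord_max)) = v true (ordS ord_max).
Definition PW0 v := PA ord0 v /\ lam (v true ord0) = v true ord0.
Definition PW v := PM ord0 v /\
  lam (v false ord0) + v true ord0 = lam (v true ord0) + v false ord0.
Definition PK v := \sum_(i <- enum 'I_n) v true i = 0.
Definition PD v := forall i k : 'I_n, v false i = v false k.

Let mvE i e k : mv i e false k = if k == i then e else 0. Proof. by []. Qed.
Let mvT i e k : mv i e true k = 0. Proof. by []. Qed.

Let neq_mv i e k : i <> k -> mv i e false k = 0.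
Proof. by rewrite mvE; case: eqP => // ->. Qed.

Let mv_eq i e : mv i e false i = e.
Proof. by rewrite mvE eqxx. Qed.

Let mv_S i e : mv i e false (ordS i) = 0.
Proof. by rewrite mvE (negbTE (ord_neqS i)). Qed.

Let mv_P i e : mv (ordS i) e false i = 0.
Proof. by rewrite mvE eq_sym (negbTE (ord_neqS i)). Qed.

Let RmE (P R : _ -> Prop) : (forall i e, ~ R i -> P (mv i e)) ->
  (forall i, R i -> ~ P (mv i e0)) -> Rm P = R.
Proof.
move=> h1 h2; apply/funext => i; apply/propext; split=> [[e he]|Ri].
  by apply: contrapT => nR; apply: he; apply: h1.
by exists e0; apply: h2.
Qed.

Lemma Rm_PA j : Rm (PA j) = rows2 j.
Proof.
apply: RmE => [i e /not_orP [h1 h2]|i [] -> []]; first by split; apply: neq_mv.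
  by rewrite mv_eq.
by rewrite mv_eq.
Qed.

Lemma Rm_PA' j : Rm (PA' j) = rows2 j.
Proof.
apply: RmE => [i e /not_orP [h1 h2]|i [] -> []]; first by split; apply: neq_mv.
  by rewrite mv_eq.
by rewrite mv_eq.
Qed.

Lemma Rm_PM j : Rm (PM j) = rows2 j.
Proof.
apply: RmE => [i e /not_orP [h1 h2]|i [] ->]; first by rewrite /PM !neq_mv.
  by rewrite /PM mv_eq mv_S.
by rewrite /PM mv_eq mv_P => /esym.
Qed.

Lemma Rm_PY0 j : Rm (PY0 j) = rows1 j.
Proof.
by apply: RmE => [i e h|i ->]; rewrite /PY0 ?mv_eq //; apply: neq_mv.
Qed.

Lemma Rm_PY1 j : Rm (PY1 j) = rows1 j.
Proof.
by apply: RmE => [i e h|i ->]; rewrite /PY1 !mvT addr0 ?mv_eq //; apply: neq_mv.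
Qed.

Lemma Rm_PYt : Rm PYt = rows1 ord_max.
Proof.
by apply: RmE => [i e h|i ->]; rewrite /PYt !mvT lam0 addr0 ?mv_eq //; apply: neq_mv.
Qed.

Lemma Rm_PA1 : Rm PA1 = rows1 ord_max.
Proof.
apply: RmE => [i e h|i -> []]; rewrite /PA1 ?mv_eq // !mvT lam0; split=> //.
exact: neq_mv.
Qed.

Lemma Rm_PW0 : Rm PW0 = rows2 ord0.
Proof.
apply: RmE => [i e /not_orP [h1 h2]|i [] -> [[]]]; rewrite ?mv_eq //.
by rewrite /PW0 mvT lam0; split=> //; split; apply: neq_mv.
Qed.

Lemma Rm_PW : Rm PW = rows2 ord0.
Proof.
apply: RmE => [i e /not_orP [h1 h2]|i [] -> []]; rewrite /PM.
- by rewrite /PW /PM mvT !neq_mv // lam0.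
- by rewrite mv_eq mv_S.
- by rewrite mv_eq mv_P => /esym.
Qed.

Lemma Rm_PK i : ~ Rm PK i.
Proof. by move=> [e]; apply; rewrite /PK big1. Qed.

Lemma rows2_edge j i k : rows2 j i -> k == j -> i = k \/ i = ordS k.
Proof. by move=> h /eqP ->. Qed.

Lemma rows1_edge j i k : rows1 j i -> cols2 j k -> i = k \/ i = ordS k.
Proof. by move=> -> /orP[] /eqP ->; [right | left]. Qed.

Definition build C P (sP : is_sub P) (aP : allowed (mk C P)) : elt :=
  exist _ (mk C P) (conj (is_sub_mk C sP) aP).

Lemma allowed_rows (C : 'I_n -> bool) P R : Rm P = R ->
  (forall i j, R i -> C j -> i = j \/ i = ordS j) -> allowed (mk C P).
Proof. by move=> <-; apply: allowed_mk. Qed.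

Let coord b i := lin_coord b i.

Definition EA j : elt := @build (pred1 j) (PA j)
  (is_sub_cap (is_sub_eq (coord false j) lin_zero) (is_sub_eq (coord false (ordS j)) lin_zero))
  (allowed_rows (Rm_PA j) (@rows2_edge j)).

Definition EA' j : elt := @build (pred1 j) (PA' j)
  (is_sub_cap (is_sub_eq (coord false j) (coord true j))
     (is_sub_eq (coord false (ordS j)) (coord true j)))
  (allowed_rows (Rm_PA' j) (@rows2_edge j)).

Definition EM j : elt := @build pred0 (PM j)
  (is_sub_eq (coord false j) (coord false (ordS j)))
  (allowed_rows (Rm_PM j) (fun i k _ (h : false) => False_ind _ (notF h))).

Definition EY0 j : elt := @build (cols2 j) (PY0 j)
  (is_sub_eq (coord false (ordS j)) lin_zero) (allowed_rows (Rm_PY0 j) (@rows1_edge j)).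

Definition EY1 j : elt := @build (cols2 j) (PY1 j)
  (is_sub_eq (coord false (ordS j)) (lin_add (coord true j) (coord true (ordS j))))
  (allowed_rows (Rm_PY1 j) (@rows1_edge j)).

Definition EYt : elt := @build (cols2 ord_max) PYt
  (is_sub_eq (coord false (ordS ord_max))
    (lin_add (coord true ord_max) (lin_comp (coord true (ordS ord_max)))))
  (allowed_rows Rm_PYt (@rows1_edge ord_max)).

Definition EA1 : elt := @build (cols2 ord_max) PA1
  (is_sub_cap (is_sub_eq (coord false (ordS ord_max)) lin_zero)
    (is_sub_eq (lin_comp (coord true (ordS ord_max))) (coord true (ordS ord_max))))
  (allowed_rows Rm_PA1 (@rows1_edge ord_max)).

Definition EW0 : elt := @build (pred1 ord0) PW0
  (is_sub_cap (is_sub_cap (is_sub_eq (coord false ord0) lin_zero)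
      (is_sub_eq (coord false (ordS ord0)) lin_zero))
    (is_sub_eq (lin_comp (coord true ord0)) (coord true ord0)))
  (allowed_rows Rm_PW0 (@rows2_edge ord0)).

Definition EW : elt := @build (pred1 ord0) PW
  (is_sub_cap (is_sub_eq (coord false ord0) (coord false (ordS ord0)))
    (is_sub_eq (lin_add (lin_comp (coord false ord0)) (coord true ord0))
      (lin_add (lin_comp (coord true ord0)) (coord false ord0))))
  (allowed_rows Rm_PW (@rows2_edge ord0)).

Definition EK : elt := @build predT PK (is_sub_eq (lin_sum (enum 'I_n)) lin_zero)
  (allowed_mk (fun i (h : Rm PK i) => False_ind False (Rm_PK h)) (fun i j => @False_ind _)).

Definition ED : elt := @build pred0 PD
  (is_sub_all (fun i => is_sub_all (fun k => is_sub_eq (coord false i) (coord false k))))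
  (fun i j _ Cj => False_ind _ (notF (Cm_mk Cj))).

Lemma tle_sameR x y : Rm (sval x) = Rm (sval y) -> (forall v, sval x v -> sval y v) ->
  tle x y.
Proof.
move=> R xy; have [c [xc yc _]] := chart3 x y y; exists c; split=> // v.
by rewrite /psi (flag_Rm c R); case: (flag (sval y) c) => // /xy.
Qed.

Lemma tle_fixed x y : gset (sval x) = sval x \/ gset (sval y) = sval y ->
  (forall v, sval x v -> sval y v) -> tle x y.
Proof.
move=> fix_ xy; have [c [xc yc _]] := chart3 x y y; exists c; split=> // v.
rewrite /psi; case: fix_ => e; rewrite e.
  case: (flag (sval y) c); case: (flag (sval x) c); try exact: xy.
    by rewrite -{1}e; apply: xy.
  by rewrite -{1}e; apply: xy.
by case: (flag (sval y) c); case: (flag (sval x) c); try exact: xy;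
  rewrite -{1}e; apply: xy.
Qed.

Lemma gset_add X Y v : addS X Y (ginv v) -> addS (gset X) (gset Y) v.
Proof.
move=> [u [w [Xu Yw e]]]; exists (g u), (g w); rewrite /gset !gK; split=> //.
by rewrite -[v]ginvK e; apply/funext => -[]; apply/funext => i //=; rewrite /g lamD.
Qed.

Lemma tle_join x y z : Rm (sval x) = Rm (sval y) -> Rm (sval x) = Rm (sval z) ->
  (forall v, sval x v -> addS (sval y) (sval z) v) -> tle x (tjoin y z).
Proof.
move=> Rxy Rxz h; have [c [xc yc zc]] := chart3 x y z.
rewrite (tjoin_at yc zc); exists c; split=> //; first exact: avoid_join_at.
move=> v; rewrite psiK /psi -(flag_Rm c Rxy) -(flag_Rm c Rxz).
by case: (flag (sval x) c); [move/h/gset_add | move/h].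
Qed.

Lemma tle_meet x y z : Rm (sval x) = Rm (sval y) -> Rm (sval x) = Rm (sval z) ->
  (forall v, sval x v -> sval y v -> sval z v) -> tle (tmeet x y) z.
Proof.
move=> Rxy Rxz h; have [c [xc yc zc]] := chart3 x y z.
rewrite (tmeet_at xc yc); exists c; split=> //; first exact: avoid_meet_at.
move=> v; rewrite psiK /psi -(flag_Rm c Rxy) -(flag_Rm c Rxz).
by case: (flag (sval x) c) => -[xv yv]; apply: h.
Qed.

Lemma tle_meet_fixed x y z : Rm (sval x) = Rm (sval y) -> gset (sval z) = sval z ->
  (forall v, sval x v -> sval y v -> sval z v) -> tle (tmeet x y) z.
Proof.
move=> Rxy fz h; have [c [xc yc zc]] := chart3 x y z.
rewrite (tmeet_at xc yc); exists c; split=> //; first exact: avoid_meet_at.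
move=> v; rewrite psiK /psi -(flag_Rm c Rxy) fz.
case: (flag (sval x) c); case: (flag (sval z) c) => -[xv yv]; try exact: h.
  by rewrite -fz; apply: h.
by rewrite -fz; apply: h.
Qed.

(** Away from the closing edge there is a chart in which the flags agree: for [j = 0] the cut at
    [ord_max], where the unfilled row 1 flags both elements, and otherwise the cut at 0, where
    nothing is flagged. *)
Lemma tle_row (j : 'I_n) x y : j != ord_max ->
  (forall c, ~~ cols2 j c -> avoid (sval x) c /\ avoid (sval y) c) ->
  Rm (sval x) (ordS j) -> Rm (sval y) (ordS j) -> (forall v, sval x v -> sval y v) ->
  tle x y.
Proof.
move=> jmax av Rx Ry xy; have jN : j != N.+1 :> nat by [].
have [j0|j0] := eqVneq j ord0.
  have s1 : ordS j = 1%N :> nat by rewrite val_ordS j0.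
  have fl X : Rm X (ordS j) -> flag X ord_max.
    by move=> RX; apply/asboolP; exists (ordS j); rewrite s1.
  have [|xc yc] := av ord_max; last exists ord_max; last split=> //.
    rewrite negb_or eq_sym jmax; apply/eqP => e.
    have := congr1 (@nat_of_ord _) e; rewrite s1 => -[N0].
    by move: n_gt; rewrite N0.
  by move=> v; rewrite /psi !fl //; apply: xy.
have fl X : flag X ord0 = false.
  by apply/asboolP => -[i [_ /andP[i0 ic]]]; move: (leq_trans i0 ic).
have [|xc yc] := av ord0; last exists ord0; last split=> //.
  rewrite negb_or eq_sym j0; apply/eqP => e.
  by have := congr1 (@nat_of_ord _) e; rewrite val_ordS (negbTE jN).
by move=> v; rewrite /psi !fl; apply: xy.
Qed.

Lemma Rm_build C P (sP : is_sub P) (aP : allowed (mk C P)) : Rm (sval (build sP aP)) = Rm P.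
Proof. exact: Rm_mk. Qed.

Lemma avoid_build C P (sP : is_sub P) (aP : allowed (mk C P)) c :
  ~~ C c -> avoid (sval (build sP aP)) c.
Proof. exact: avoid_mk. Qed.

Let addvE (v u w : vec) : (forall b i, v b i = u b i + w b i) ->
  v = fun b i => u b i + w b i.
Proof. by move=> h; apply/funext => b; apply/funext => i. Qed.

Let split_vec (j : 'I_n) C P C' P' v u : mk C P u -> mk C' P' (dif v u) ->
  addS (mk C P) (mk C' P') v.
Proof.
move=> hu hw; exists u, (dif v u); split=> //; apply: addvE => b i.
by rewrite /dif addrC subrK.
Qed.

Let Rm_EA j : Rm (sval (EA j)) = rows2 j. Proof. by rewrite Rm_build Rm_PA. Qed.
Let Rm_EA' j : Rm (sval (EA' j)) = rows2 j. Proof. by rewrite Rm_build Rm_PA'. Qed.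
Let Rm_EM j : Rm (sval (EM j)) = rows2 j. Proof. by rewrite Rm_build Rm_PM. Qed.
Let Rm_EY0 j : Rm (sval (EY0 j)) = rows1 j. Proof. by rewrite Rm_build Rm_PY0. Qed.
Let Rm_EY1 j : Rm (sval (EY1 j)) = rows1 j. Proof. by rewrite Rm_build Rm_PY1. Qed.

Let fill (j : 'I_n) (x : E) v : vec := fun b k =>
  if b then v true k else if (k == j) || (k == ordS j) then x else 0.

Let fill_j j (x : E) v : fill j x v false j = x. Proof. by rewrite /fill eqxx. Qed.
Let fill_S j (x : E) v : fill j x v false (ordS j) = x. Proof. by rewrite /fill eqxx orbT. Qed.

Lemma EA_le j : tle (EA j) (tjoin (EA' j) (EM j)).
Proof.
apply: tle_join; rewrite ?Rm_EA ?Rm_EA' ?Rm_EM // => v /mkP [sv [h1 h2]].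
apply: (@split_vec j _ _ _ _ _ (fill j (v true j) v)); apply/mkP.
  by split=> //; rewrite /PA' fill_j fill_S.
split=> [k _|]; first by rewrite /dif subrr.
by rewrite /PM /dif fill_j fill_S h1 h2.
Qed.

Lemma EA'_le j : tle (EA' j) (tjoin (EA j) (EM j)).
Proof.
apply: tle_join; rewrite ?Rm_EA ?Rm_EA' ?Rm_EM // => v /mkP [sv [h1 h2]].
apply: (@split_vec j _ _ _ _ _ (fill j 0 v)); apply/mkP.
  by split=> //; rewrite /PA fill_j fill_S.
split=> [k _|]; first by rewrite /dif subrr.
by rewrite /PM /dif fill_j fill_S h1 h2.
Qed.

Lemma EM_le j : tle (EM j) (tjoin (EA j) (EA' j)).
Proof.
apply: tle_join; rewrite ?Rm_EA ?Rm_EA' ?Rm_EM // => v /mkP [sv h].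
apply: (@split_vec j _ _ _ _ _ (fun b k => if b && (k == j) then - v false j else 0)).
  by apply/mkP; split=> [k /= /negbTE -> //|]; split.
apply/mkP; split=> [k kj|]; first by rewrite /dif (sv k) // (negbTE (kj : k != j)) subrr.
by rewrite /PA' /dif eqxx (sv j) //= !subr0 sub0r opprK -h.
Qed.

Lemma EA_EM_le j : tle (tmeet (EA j) (EM j)) (EA' j).
Proof.
apply: tle_meet; rewrite ?Rm_EA ?Rm_EA' ?Rm_EM // => v /mkP [sv [h1 h2]] /mkP [h3 _].
by apply/mkP; split=> //; rewrite /PA' h1 h2 h3.
Qed.

Lemma EA'_EM_le j : tle (tmeet (EA' j) (EM j)) (EA j).
Proof.
apply: tle_meet; rewrite ?Rm_EA ?Rm_EA' ?Rm_EM // => v /mkP [sv [h1 h2]] /mkP [h3 _].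
by apply/mkP; split=> //; rewrite /PA h1 h2 h3.
Qed.

Let gset_ED : gset (sval ED) = sval ED.
Proof. by apply: gset_id (esub _) _; right=> j /Cm_mk. Qed.

Let gset_EK : gset (sval EK) = sval EK.
Proof. by apply: gset_id (esub _) _; left=> i; rewrite Rm_build; apply: Rm_PK. Qed.

Lemma ED_le j : tle ED (EM j).
Proof. by apply: tle_fixed; [left | move=> v /mkP [sv h]; apply/mkP; split=> //; apply: h]. Qed.

(** The vector with all rows [e0] and all columns 0 lies in [ED]; in [EW] it would force
    [lam e0 = e0], in either state of the flag. *)
Lemma ED_EW : ~ tle ED EW.
Proof.
move=> le; have [c [dc wc _]] := chart3 ED EW EW.
pose v : vec := fun b k => if b then 0 else e0.
have := tle_chart le dc wc (v := v); rewrite {1}/psi gset_ED if_same.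
have vD : sval ED v by apply/mkP.
move/(_ vD); rewrite /psi; case: (flag (sval EW) c) => /mkP [_ [_]];
  rewrite /v /= lam0 addr0 add0r; last exact: lam_e0.
by rewrite linvK => h; apply: lam_e0; rewrite {1}h linvK.
Qed.

Let A_sub_Y0 j v : sval (EA j) v -> sval (EY0 j) v.
Proof.
by move=> /mkP [sv [h1 h2]]; apply/mkP; split=> // k; rewrite negb_or => /andP[/sv].
Qed.

Let A'_sub_Y1 j v : sval (EA' j) v -> sval (EY1 j) v.
Proof.
move=> /mkP [sv [h1 h2]]; apply/mkP; split; last by rewrite /PY1 h2 (sv (ordS j)) ?addr0 //=.
by move=> k; rewrite negb_or => /andP[/sv].
Qed.

Ltac avoid_cols := let c := fresh in let cj := fresh in
  move=> c cj; split; apply: avoid_build => //; move: cj; rewrite negb_or => /andP[].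

Lemma EA_Y0 j : j != ord_max -> tle (EA j) (EY0 j).
Proof.
move=> jm; apply: (tle_row jm); rewrite ?Rm_EA ?Rm_EY0; [|by right|by []|exact: A_sub_Y0].
by avoid_cols.
Qed.

Lemma EAS_Y0 j : j != ord_max -> tle (EA (ordS j)) (EY0 j).
Proof.
move=> jm; apply: (tle_row jm); rewrite ?Rm_EA ?Rm_EY0; [|by left|by []|].
  by avoid_cols.
move=> v /mkP [sv [h1 h2]]; apply/mkP; split=> // k.
by rewrite negb_or => /andP[_ /sv].
Qed.

Lemma EA'_Y1 j : j != ord_max -> tle (EA' j) (EY1 j).
Proof.
move=> jm; apply: (tle_row jm); rewrite ?Rm_EA' ?Rm_EY1; [|by right|by []|exact: A'_sub_Y1].
by avoid_cols.
Qed.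

Lemma EA'S_Y1 j : j != ord_max -> tle (EA' (ordS j)) (EY1 j).
Proof.
move=> jm; apply: (tle_row jm); rewrite ?Rm_EA' ?Rm_EY1; [|by left|by []|].
  by avoid_cols.
move=> v /mkP [sv [h1 h2]]; apply/mkP; split.
  by move=> k; rewrite negb_or => /andP[_ /sv].
by rewrite /PY1 (sv j) ?add0r //= eq_sym.
Qed.

Let sum_cols2 j v : (forall k, ~~ cols2 j k -> v true k = 0) ->
  \sum_(i <- enum 'I_n) v true i = v true j + v true (ordS j).
Proof.
move=> sv; rewrite big_enum /= (bigD1 j) //= (bigD1 (ordS j)) /=; last exact: ord_neqS.
by rewrite big1 ?addr0 // => i /andP[i1 i2]; apply: sv; rewrite negb_or i1.
Qed.

Lemma EY_EK j : tle (tmeet (EY0 j) (EY1 j)) EK.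
Proof.
apply: tle_meet_fixed; rewrite ?Rm_EY0 ?Rm_EY1 // => v /mkP [sv h1] /mkP [_ h2].
by apply/mkP; split=> //; rewrite /PK (sum_cols2 sv) -h2.
Qed.

Let c1 : 'I_n := ordS ord0.
Let val_c1 : c1 = 1%N :> nat. Proof. by rewrite /c1 val_ordS. Qed.
Let S_max : ordS ord_max = ord0 :> 'I_n.
Proof. by apply: val_inj; rewrite [LHS]val_ordS eqxx. Qed.
Let c1_max : c1 != ord_max.
Proof.
apply/eqP => /(congr1 (@nat_of_ord _)); rewrite val_c1 /= => -[N0].
by move: n_gt; rewrite -N0.
Qed.
Let c1_0 : c1 != ord0. Proof. exact: ord_neqS. Qed.
Let cols_c1 : ~~ cols2 ord_max c1.
Proof. by rewrite negb_or c1_max S_max c1_0. Qed.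

(** The cut at column 1 is used at the closing edge. There elements with rows 0 and 1 unfilled are
    twisted and those whose unfilled rows are among [ord_max] and 0 are not; this mismatch is the
    source of [lam] in [PYt]. *)
Let flag_c1 X : (forall i, Rm X i -> rows2 ord_max i) -> flag X c1 = false.
Proof.
move=> h; apply/asboolP => -[i [/h]]; rewrite /rows2 S_max => -[] -> //.
rewrite val_c1 /= => N1; by have := leq_trans n_gt (N1 : (N.+2 <= 2)%N).
Qed.

Let flag_c1_0 X : Rm X = rows2 ord0 -> flag X c1 = true.
Proof. by move=> R; apply/asboolP; exists c1; rewrite R val_c1; split=> //; right. Qed.

Lemma EAmax_Y0 : tle (EA ord_max) (EY0 ord_max).
Proof.
exists c1; split; try exact: avoid_build.
move=> v; rewrite /psi !flag_c1 ?Rm_EA ?Rm_EY0 => [|i ->|//]; first exact: A_sub_Y0.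
by right.
Qed.

Lemma EAmax_A1 : tle (EA ord_max) EA1.
Proof.
exists c1; split; try exact: avoid_build.
move=> v; rewrite /psi !flag_c1 ?Rm_EA ?Rm_build ?Rm_PA1 => [|i ->|//]; last by right.
move=> /mkP [sv [h1 h2]]; apply/mkP; split=> [k|].
  by rewrite negb_or => /andP[/sv].
by rewrite /PA1 h2 (sv (ordS ord_max)) ?lam0 //=; apply: ord_neqS.
Qed.

Lemma EA0_Y0 : tle (EA ord0) (EY0 ord_max).
Proof.
exists c1; split; try exact: avoid_build.
move=> v; rewrite /psi (flag_c1_0 (Rm_EA _)) flag_c1; last by rewrite Rm_EY0 => i ->; right.
move=> /mkP [sv [h1 h2]]; apply/mkP; split=> [k|].
  by rewrite negb_or S_max => /andP[_ /sv].
by rewrite /PY0 S_max -[LHS]linvK [linv _]h1 lam0.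
Qed.

Lemma EA'max_Yt : tle (EA' ord_max) EYt.
Proof.
exists c1; split; try exact: avoid_build.
move=> v; rewrite /psi !flag_c1 ?Rm_EA' ?Rm_build ?Rm_PYt => [|i ->|//]; last by right.
move=> /mkP [sv [h1 h2]]; apply/mkP; split=> [k|].
  by rewrite negb_or => /andP[/sv].
by rewrite /PYt h2 (sv (ordS ord_max)) ?lam0 ?addr0 //=; apply: ord_neqS.
Qed.

Lemma EA'0_Yt : tle (EA' ord0) EYt.
Proof.
exists c1; split; try exact: avoid_build.
move=> v; rewrite /psi (flag_c1_0 (Rm_EA' _)) flag_c1; last by rewrite Rm_build Rm_PYt => i ->; right.
move=> /mkP [sv [h1 h2]]; apply/mkP; split=> [k|].
  by rewrite negb_or S_max => /andP[_ /sv].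
by rewrite /PYt S_max -[LHS]linvK [linv _]h1 [v true ord_max](sv ord_max) ?add0r.
Qed.

Let psi_tmeet c x y : avoid (sval x) c -> avoid (sval y) c ->
  avoid (sval (tmeet x y)) c /\ psi c (sval (tmeet x y)) = capS (psi c (sval x)) (psi c (sval y)).
Proof.
by move=> xc yc; rewrite (tmeet_at xc yc) psiK; split=> //; apply: avoid_meet_at.
Qed.

(** The holonomy of the cycle: the last two columns satisfy [a + lam b = 0] by the closing link and
    [a + b = 0] by the chain of all other links, so [lam b = b]. *)
Lemma EY_EA1 : tle (tmeet (tmeet (EY0 ord_max) EYt) EK) EA1.
Proof.
have a1 : avoid (sval (EY0 ord_max)) c1 by apply: avoid_build.
have a2 : avoid (sval EYt) c1 by apply: avoid_build.
have a3 : avoid (sval EK) c1 by left=> i; rewrite Rm_build; apply: Rm_PK.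
have [a12 e12] := psi_tmeet a1 a2; have [a123 e123] := psi_tmeet a12 a3.
exists c1; split=> //; first exact: avoid_build.
move=> v; rewrite e123 e12 /psi !flag_c1 ?Rm_EY0 ?Rm_build ?Rm_PYt ?Rm_PA1;
  try by move=> i; first [move=> -> | move=> /Rm_PK //]; right.
move=> [[/mkP [sv h1] /mkP [_ h2]] /mkP [_ h3]]; apply/mkP; split=> //; split=> //.
move: h2 h3; rewrite /PYt /PK (sum_cols2 sv) h1 => /esym /eqP.
rewrite addrC addr_eq0 => /eqP -> /eqP; rewrite addr_eq0 => /eqP ->.
by rewrite opprK.
Qed.

Lemma EA0_EW0 : tle (tmeet (EA ord0) EA1) EW0.
Proof.
have a1 : avoid (sval (EA ord0)) c1 by apply: avoid_build.
have a2 : avoid (sval EA1) c1 by apply: avoid_build.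
have [a12 e12] := psi_tmeet a1 a2.
exists c1; split=> //; first exact: avoid_build.
move=> v; rewrite e12 /psi (flag_c1_0 (Rm_EA _)).
rewrite [flag (sval EW0) _]flag_c1_0 ?Rm_build ?Rm_PW0 //.
rewrite flag_c1 ?Rm_build ?Rm_PA1; last by move=> i ->; right.
move=> [/mkP [sv [h1 h2]] /mkP [_ [_ h3]]]; apply/mkP; split=> //; split=> //.
by move: h3; rewrite S_max.
Qed.

Lemma EW0_EW : tle EW0 EW.
Proof.
apply: tle_sameR; first by rewrite !Rm_build Rm_PW0 Rm_PW.
move=> v /mkP [sv [[h1 h2] h3]]; apply/mkP; split=> //; split; first by rewrite /PM h1 h2.
by rewrite h1 h3 lam0 add0r addr0.
Qed.

Lemma EA'0_EW : tle (EA' ord0) EW.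
Proof.
apply: tle_sameR; first by rewrite Rm_EA' Rm_build Rm_PW.
move=> v /mkP [sv [h1 h2]]; apply/mkP; split=> //; split; first by rewrite /PM h1 h2.
by rewrite h1.
Qed.

(** * Evaluating the cycle identity in the glued lattice *)

Definition cycle_val (k : nat) : twisted :=
  let j : 'I_n := inord (k %/ 3) in
  if (k %% 3 == 0)%N then EA j else if (k %% 3 == 1)%N then EA' j else EM j.

Local Notation ev := (lattice_eval cycle_val).

Let LA j : twisted := EA (inord j).
Let LA' j : twisted := EA' (inord j).
Let LM j : twisted := EM (inord j).

Let val0 j : cycle_val (3 * j) = LA j.
Proof. by rewrite /cycle_val modnMr mulKn. Qed.

Let val1 j : cycle_val (3 * j + 1) = LA' j.
Proof. by rewrite /cycle_val mulnC modnMDl divnMDl // addn0. Qed.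

Let val2 j : cycle_val (3 * j + 2) = LM j.
Proof. by rewrite /cycle_val mulnC modnMDl divnMDl // addn0. Qed.

Let leE (x y : twisted) : tle x y -> (x <= y)%O.
Proof. by move/twisted_le. Qed.

Let LA_le j : (LA j <= LA' j `|` LM j)%O. Proof. exact/leE/EA_le. Qed.
Let LA'_le j : (LA' j <= LA j `|` LM j)%O. Proof. exact/leE/EA'_le. Qed.
Let LM_le j : (LM j <= LA j `|` LA' j)%O. Proof. exact/leE/EM_le. Qed.
Let LAM_le j : (LA j `&` LM j <= LA' j)%O. Proof. exact/leE/EA_EM_le. Qed.
Let LA'M_le j : (LA' j `&` LM j <= LA j)%O. Proof. exact/leE/EA'_EM_le. Qed.

(** Each of the three elements lies below the join of the other two, so refinement changes nothing;
    this makes the identity fail at every depth [K]. *)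
Let level_val j i : let: (a, b, c) := level j i in
  [/\ ev a = LA j, ev b = LA' j & ev c = LM j].
Proof.
elim: i => [|i]; first by rewrite /level /= val0 val1 val2.
rewrite /level iterS -/(level j i); case: (level j i) => -[a b] c [ea eb ec].
rewrite /= ea eb ec; split; apply: (@meet_l _ twisted).
- exact: LA_le.
- exact: LA'_le.
- exact: LM_le.
Qed.

Let pairs_le j : (ev (pairs3 (level j 0)) <= LA j)%O /\
  (ev (pairs3 (level j 0)) <= LA' j)%O.
Proof.
rewrite /= val0 val1 val2; split; rewrite !leUx ?leIl ?leIr /=.
  exact: LA'M_le.
by rewrite andbT; apply: LAM_le.
Qed.

Let bar1_val j : ev (bar1 j) = LA j.
Proof.
rewrite -[LHS]/(cycle_val (3 * j) `|` ev (pairs3 (level j 0)))%O val0.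
by apply: (@join_l _ twisted); case: (pairs_le j).
Qed.

Let bar2_val j : ev (bar2 j) = LA' j.
Proof.
rewrite -[LHS]/(cycle_val (3 * j + 1) `|` ev (pairs3 (level j 0)))%O val1.
by apply: (@join_l _ twisted); case: (pairs_le j).
Qed.

Let inord_S j : (j < N.+1)%N -> inord j.+1 = ordS (inord j) :> 'I_n.
Proof.
move=> jN; apply: val_inj; rewrite [RHS]val_ordS /= !inordK ?ltnS // 1?ltnW //.
by rewrite (ltn_eqF jN).
Qed.

Let LK : twisted := EK.
Let LD : twisted := ED.
Let LY0 j : twisted := EY0 j.
Let LY1 j : twisted := EY1 j.
Let LYt : twisted := EYt.
Let LA1 : twisted := EA1.
Let LW0 : twisted := EW0.
Let LW : twisted := EW.

Let max_ : inord N.+1 = ord_max :> 'I_n.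
Proof. by apply: val_inj; rewrite /= inordK. Qed.
Let zero_ : inord 0 = ord0 :> 'I_n.
Proof. by apply: val_inj; rewrite /= inordK. Qed.

Let linkE i j : ev (link i j) = ((LA i `|` LA j) `&` (LA' i `|` LA' j))%O.
Proof. by rewrite -!bar1_val -!bar2_val. Qed.

Let link_le j : (j < N.+1)%N -> (ev (link j j.+1) <= LK)%O.
Proof.
move=> jN; have jm : (inord j : 'I_n) != ord_max.
  apply/eqP => /(congr1 (@nat_of_ord _)); rewrite inordK ?ltnS 1?ltnW //= => e.
  by move: jN; rewrite e ltnn.
have h : (LY0 (inord j) `&` LY1 (inord j) <= LK)%O by exact/leE/EY_EK.
have a1 : (LA j <= LY0 (inord j))%O by exact/leE/EA_Y0.
have a2 : (LA j.+1 <= LY0 (inord j))%O by apply: leE; rewrite /LA inord_S //; apply: EAS_Y0.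
have b1 : (LA' j <= LY1 (inord j))%O by exact/leE/EA'_Y1.
have b2 : (LA' j.+1 <= LY1 (inord j))%O by apply: leE; rewrite /LA' inord_S //; apply: EA'S_Y1.
by apply: le_trans h; rewrite linkE leI2 // leUx ?a1 ?b1.
Qed.

Let ED_lhs K : (LD <= ev (cycle_lhs N K))%O.
Proof.
have h j : (LD <= ev (top3 (level j K)))%O.
  have := level_val j K; case: (level j K) => -[a b] c [_ _ ec].
  have dm : (LD <= ev c)%O by rewrite ec; apply/leE/ED_le.
  rewrite -[ev _]/(ev a `|` (ev b `|` ev c))%O.
  by apply: lexU2; rewrite [X in _ || X]lexU2 ?dm ?orbT.
rewrite /cycle_lhs; elim: N.+1 => [|m IH]; first exact: h.
rewrite -[ev _]/(ev (bigmeet (fun j => top3 (level j K)) m) `&` ev (top3 (level m.+1 K)))%O.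
by rewrite lexI IH h.
Qed.

Let rhs_EW : (ev (cycle_rhs N) <= LW)%O.
Proof.
have h1 : (ev (bigjoin (fun j => link j j.+1) N) <= LK)%O.
  have : (N < N.+1)%N by [].
  elim: {1 3}N => [|m IH] mN; first exact: link_le.
  rewrite -[ev _]/(ev (bigjoin (fun j => link j j.+1) m) `|` ev (link m.+1 m.+2))%O.
  by rewrite leUx IH ?(ltnW mN) // link_le.
have eA : LA N.+1 = EA ord_max by rewrite /LA max_.
have eA' : LA' N.+1 = EA' ord_max by rewrite /LA' max_.
have eA0 : LA 0 = EA ord0 by rewrite /LA zero_.
have eA'0 : LA' 0 = EA' ord0 by rewrite /LA' zero_.
have a1 : (LA N.+1 <= LY0 ord_max)%O by rewrite eA; apply/leE/EAmax_Y0.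
have a2 : (LA 0 <= LY0 ord_max)%O by rewrite eA0; apply/leE/EA0_Y0.
have a3 : (LA' N.+1 <= LYt)%O by rewrite eA'; apply/leE/EA'max_Yt.
have a4 : (LA' 0 <= LYt)%O by rewrite eA'0; apply/leE/EA'0_Yt.
have a5 : (LA N.+1 <= LA1)%O by rewrite eA; apply/leE/EAmax_A1.
have a6 : ((LY0 ord_max `&` LYt) `&` LK <= LA1)%O by exact/leE/EY_EA1.
have a7 : (LA 0 `&` LA1 <= LW0)%O by rewrite eA0; apply/leE/EA0_EW0.
have a8 : (LW0 <= LW)%O by exact/leE/EW0_EW.
have a9 : (LA' 0 <= LW)%O by rewrite eA'0; apply/leE/EA'0_EW.
rewrite -[ev _]/(ev (bar2 0) `|` (ev (bar1 0) `&` (ev (bar1 N.+1) `|`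
  (ev (link N.+1 0) `&` ev (bigjoin (fun j => link j j.+1) N)))))%O.
rewrite bar2_val !bar1_val linkE leUx a9 /=.
apply: le_trans a8; apply: le_trans a7; apply: leI2 => //.
rewrite leUx a5 /=; apply: le_trans a6; apply: leI2 h1.
by apply: leI2; rewrite leUx ?a1 ?a3.
Qed.

Lemma cycle_fails K : ~ (ev (cycle_lhs N K) <= ev (cycle_rhs N))%O.
Proof.
move=> h; apply: ED_EW; apply/twisted_le.
exact: le_trans (ED_lhs K) (le_trans h rhs_EW).
Qed.

End Twisted.

From mathcomp Require Import classical_sets cardinality.

(** * The main theorem *)

Section Square.
Variables (S : signature) (V : algebra S -> Prop) (D : zmodType) (la : linear_action V D).
Local Open Scope ring_scope.

Definition act_square (Y : Type) (t : tm S Y) (u : Y -> (D * D)%type) : (D * D)%type :=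
  (la Y t (fun y => (u y).1), la Y t (fun y => (u y).2)).

Definition linear_square : linear_action V (D * D)%type.
Proof.
exists act_square.
- by move=> Y y u; rewrite /act_square !tact_var -surjective_pairing.
- by move=> Y t t' u it it' tt'; congr pair; apply: tact_veq.
- by move=> X Y f t u; rewrite /act_square !tact_map.
- by move=> Y t u w it; rewrite /act_square !tact_add.
Defined.

Definition shear (a : D * D) : D * D := (a.1 + a.2, a.2).
Definition unshear (a : D * D) : D * D := (a.1 - a.2, a.2).

Lemma shearD a b : shear (a + b) = shear a + shear b.
Proof. by congr pair; rewrite /= addrACA. Qed.

Lemma shearK : cancel shear unshear.
Proof. by case=> a b; congr pair; rewrite /= addrK. Qed.

Lemma unshearK : cancel unshear shear.
Proof. by case=> a b; congr pair; rewrite /= subrK. Qed.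

Lemma shear_act Y (t : tm S Y) u : idem V t ->
  linear_square Y t (fun y => shear (u y)) = shear (linear_square Y t u).
Proof. by move=> it; congr pair; rewrite /= -tact_add. Qed.

Lemma shear_neq (d : D) : d <> 0 -> shear (0, d) <> (0, d).
Proof. by move=> nz [] /=; rewrite add0r. Qed.

End Square.

Fixpoint maxvar (t : lattice_term) : nat :=
  match t with
  | LVar i => i
  | LMeet s u | LJoin s u => maxn (maxvar s) (maxvar u)
  end.

Lemma maxvar_lt k t : maxvar t < k -> vars_lt k t.
Proof.
elim: t => [i|s IHs u IHu|s IHs u IHu] //=; rewrite gtn_max => /andP[/IHs -> /IHu ->] //.
Qed.

Lemma finite_maxvar (Sigma : set lattice_identity) : finite_set Sigma ->
  exists k, forall e, Sigma e -> vars_lt k e.1 /\ vars_lt k e.2.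
Proof.
pose f (e : lattice_identity) := maxn (maxvar e.1) (maxvar e.2).
move=> /(finite_image f) /finite_seqP [s hs].
exists (\max_(i <- s) i).+1 => e Se.
have fs : f e \in s.
  by have : [set` s]%classic (f e) by rewrite -hs; exists e.
have : (f e < (\max_(i <- s) i).+1)%N by rewrite ltnS; apply: leq_bigmax_seq.
by rewrite gtn_max => /andP[/maxvar_lt ? /maxvar_lt ?].
Qed.

Lemma satisfies_of_holds (S : signature) (V : algebra S -> Prop) p q : holds V p q ->
  class_satisfies (Con V) (LMeet p q, p).
Proof.
move=> h d L [A VA] v /=; apply: congruence_eq => a b; split=> [[]//|pab].
move: pab; rewrite !lattice_eval_con => pab; split=> //.
by apply/cevalE/h => //; apply/cevalE.
Qed.

Theorem theorem1p2 (S : signature) (V : algebra S -> Prop)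
    (hV : variety V)
    (hnontriv : exists e : lattice_identity,
        nontrivial_identity e /\ class_satisfies (Con V) e)
    (hfin : finitely_based (Con V)) :
  class_semidistributive (Con V).
Proof.
move=> d0 L0 [A VA]; apply: contrapT => nsd.
have hind : term_induction V.
  by case: hnontriv => e [ne he] I; apply: binary_term_induction ne he.
have [B [N [VB cl PN [o [b [No Nb ob]]]]]] := not_semidistributive_source hV hind VA nsd.
have [m mN] := P_malcev hind VB cl PN.
have [D [la [d nz]]] := linear_action_exists VB cl PN mN No Nb (nesym ob).
have [Sigma [/finite_maxvar [k hk] hS hcons]] := hfin.
(* The cycle has [n.+2] columns: more than six, so that any three elements share a chart, and more
   than [2 * k], so that [k] variables do. *)
pose n := (2 * k + 6)%N.
have n6 : (6 < n.+2)%N by rewrite /n -!addnS; apply: leq_trans (leq_addl _ _).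
have kn : (2 * k < n.+2)%N by apply: leq_trans (leqnSn _); rewrite ltnS leq_addr.
pose L := @twisted S V _ (linear_square la) _ _ (@shearD D) (@shearK D) (@unshearK D)
  (@shear_act S V D la) n n6.
have hL p q : holds V p q -> vars_lt k p -> vars_lt k q ->
    forall v : nat -> L, (lattice_eval v p <= lattice_eval v q)%O.
  by move=> hpq vp vq; apply: twisted_holds hpq vp vq kn.
have [K hK] := cycle_identity hV hind n.
have LS e : Sigma e -> lattice_satisfies L e.
  move=> Se v; have [v1 v2] := hk e Se; have he := hS e Se.
  case: e {Se} v1 v2 he => p q /= vp vq he.
  have hpq : holds V p q by apply: holds_of_satisfies.
  have hqp : holds V q p.
    by apply: holds_of_satisfies => d' L' CL v'; rewrite /= (he d' L' CL v').
  apply: (@le_anti _ L); apply/andP; split.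
    exact: (hL p q hpq vp vq).
  exact: (hL q p hqp vq vp).
have := hcons _ (satisfies_of_holds hK) _ L LS.
move/(_ (@cycle_val S V _ (linear_square la) _ _ (@shearD D) (@shearK D)
  (@unshearK D) (@shear_act S V D la) n n6 _ (@shear_neq D d nz))) => e.
apply: (@cycle_fails S V _ (linear_square la) _ _ (@shearD D) (@shearK D)
  (@unshearK D) (@shear_act S V D la) n n6 _ (@shear_neq D d nz) K).
exact/(@meet_idPl _ L)/e.
Qed.
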